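(* There exists an absolute constant $K>0$ such that the following holds. Let $\Gamma$ be a hyperbolic surface group and let $\rho,\rho_\ast:\Gamma\to \mathrm{PSL}_2(\mathbb C)$ be convex-cocompact representations, inducing length functions $\ell_\rho,\ell_{\rho_\ast}:\mathbf{conj}\to\mathbb R$. If the $\rho$-action of $\Gamma$ on the convex hull of the limit set $\Lambda_{\rho(\Gamma)}$ is $D$-cobounded and $L>6D$, then $$\operatorname{Dil}(\rho_\ast,\rho):=\sup_{[g]\in\mathbf{conj}'}\frac{\ell_{\rho_\ast}[g]}{\ell_\rho[g]}\le\frac{L}{L-6D}\cdot\left(\max_{0<\ell_\rho[g]\le L}\frac{\ell_{\rho_\ast}[g]}{\ell_\rho[g]}\right)+\frac{2K\log 4}{L-6D}.$$
   Context: A hyperbolic surface group is the fundamental group of a closed orientable surface of genus at least $2$. $\mathbf{conj}$ is the set of conjugacy classes of $\Gamma$ and $\mathbf{conj}'$ the set of conjugacy classes of non-torsion elements (here, the non-trivial classes). A representation $\rho:\Gamma\to\mathrm{PSL}_2(\mathbb C)$ is convex-cocompact if it is faithful with discrete image and $\rho(\Gamma)$ acts cocompactly on the convex hull in $\mathbb H^3$ of its limit set $\Lambda_{\rho(\Gamma)}\subset\partial\mathbb H^3$. The length function is $\ell_\rho[g]=\lim_{k\to\infty}\frac1k d_{\mathbb H^3}(x,\rho(g)^kx)$, for any $x\in\mathbb H^3$. An isometric action of $\Gamma$ on a metric space $(X,d)$ is $D$-cobounded ($D\ge0$) if for any $x,x'\in X$ there is $g\in\Gamma$ with $d(gx,x')\le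 D$; the convex hull carries the metric restricted from $\mathbb H^3$. *)

(* Defs.v *)
From HB Require Import structures.
From mathcomp Require Import all_boot all_order all_algebra generic_quotient.
From mathcomp Require Import complex.
From mathcomp Require Import all_classical all_reals all_analysis.
From Stdlib Require Import Relation_Operators.

Set Implicit Arguments.
Unset Strict Implicit.
Unset Printing Implicit Defensive.

Import Order.TTheory GRing.Theory Num.Theory.
Import numFieldNormedType.Exports.

Local Open Scope classical_set_scope.
Local Open Scope ring_scope.
Local Open Scope quotient_scope.

(** * Surface groups *)

Section FundamentalGroup.
Context {R : realType} {X : topologicalType} (x0 : X).
Implicit Types f g : R -> X.

Definition is_loop f :=
  [/\ {within `[0, 1], continuous f}, f 0 = x0 & f 1 = x0].

Definition loop_concat f g : R -> X :=
  fun t => if t <= 2^-1 then f (2 * t) else g (2 * t - 1).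

Definition loop_homotopic f g := exists H : R * R -> X,
  [/\ {within `[0, 1] `*` `[0, 1], continuous H},
      (forall t : R, t \in `[0, 1] -> H (0, t) = f t /\ H (1, t) = g t)
    & (forall s : R, s \in `[0, 1] -> H (s, 0) = x0 /\ H (s, 1) = x0)].

(* [cls] induces a group isomorphism from pi_1(X, x0), the loops at x0 up to
   homotopy, onto G. *)
Definition is_fundamental_group (G : groupType) := exists cls : (R -> X) -> G,
  [/\ (forall c, exists2 f, is_loop f & cls f = c),
      (forall f g, is_loop f -> is_loop g ->
         cls f = cls g <-> loop_homotopic f g)
    & (forall f g, is_loop f -> is_loop g ->
         cls (loop_concat f g) = (cls f * cls g)%g)].

End FundamentalGroup.

Section Surface.
Context {R : realType}.

Definition disk : set (R * R) := [set p | p.1 ^+ 2 + p.2 ^+ 2 <= 1].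

(* The unit circle is cut into the 4n sides of a polygon; side k is the arc
   s \in [k, k + 1]. *)
Definition polygon_bd (n : nat) (s : R) : R * R :=
  (cos (2 * pi * s / (4 * n)%:R), sin (2 * pi * s / (4 * n)%:R)).

(* Side pairing of the boundary word prod_i [a_i, b_i]: side 4i + c is glued,
   with its orientation reversed, to side 4i + c + 2, where c = 0 for a_i and
   c = 1 for b_i. *)
Definition side_pairing (n : nat) (p q : R * R) :=
  exists (i : 'I_n) (c : bool) (t : R),
  [/\ t \in `[0, 1], p = polygon_bd n ((4 * i + c)%:R + t)
    & q = polygon_bd n ((4 * i + c + 2)%:R + (1 - t))].

(* X is homeomorphic to the 4n-gon modulo the side pairing: [q] is a quotient
   map from the disk whose fibres are the gluing classes. *)
Definition closed_orientable_surface (n : nat) (X : topologicalType) :=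
  exists q : R * R -> X,
  [/\ q @` disk = setT,
      (forall U : set X,
         open U <-> open (q @^-1` U : set (subspace disk)))
    & {in disk &, forall x y, q x = q y <->
         clos_refl_sym_trans _ (side_pairing n) x y}].

End Surface.

Definition hyperbolic_surface_group (R : realType) (G : groupType) :=
  exists (n : nat) (X : topologicalType) (x0 : X),
  [/\ (2 <= n)%N, @closed_orientable_surface R n X
    & @is_fundamental_group R X x0 G].

(** * PSL_2(C) *)

Section SL2.
Variable R : realType.

Record SL2 := MkSL2 { sl2_val :> 'M[R[i]]_2; sl2_det : \det sl2_val == 1 }.
HB.instance Definition _ := [isSub for sl2_val].
HB.instance Definition _ := [Choice of SL2 by <:].

Fact sl2_one_subproof : \det (1%:M : 'M[R[i]]_2) == 1.
Proof. by rewrite det1. Qed.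
Definition sl2_one : SL2 := MkSL2 sl2_one_subproof.

Fact sl2_opp_subproof (A : SL2) : \det (- val A) == 1.
Proof. by rewrite -scaleN1r detZ (eqP (valP A)) sqrrN expr1n mulr1. Qed.
Definition sl2_opp (A : SL2) : SL2 := MkSL2 (sl2_opp_subproof A).

Fact sl2_mul_subproof (A B : SL2) : \det (val A *m val B) == 1.
Proof. by rewrite det_mulmx (eqP (valP A)) (eqP (valP B)) mulr1. Qed.
Definition sl2_mul (A B : SL2) : SL2 := MkSL2 (sl2_mul_subproof A B).

Fact sl2_inv_subproof (A : SL2) : \det (invmx (val A)) == 1.
Proof. by rewrite det_inv (eqP (valP A)) invr1. Qed.
Definition sl2_inv (A : SL2) : SL2 := MkSL2 (sl2_inv_subproof A).

Fact sl2_unitmx (A : SL2) : val A \in unitmx.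
Proof. by rewrite unitmxE (eqP (valP A)) unitr1. Qed.

Fact sl2_mulA : associative sl2_mul.
Proof. by move=> A B C; apply: val_inj; rewrite /= mulmxA. Qed.
Fact sl2_mul1 : left_id sl2_one sl2_mul.
Proof. by move=> A; apply: val_inj; rewrite /= mul1mx. Qed.
Fact sl2_1mul : right_id sl2_one sl2_mul.
Proof. by move=> A; apply: val_inj; rewrite /= mulmx1. Qed.
Fact sl2_mulV : left_inverse sl2_one sl2_inv sl2_mul.
Proof. by move=> A; apply: val_inj; rewrite /= mulVmx ?sl2_unitmx. Qed.
Fact sl2_Vmul : right_inverse sl2_one sl2_inv sl2_mul.
Proof. by move=> A; apply: val_inj; rewrite /= mulmxV ?sl2_unitmx. Qed.

HB.instance Definition _ :=
  isGroup.Build SL2 sl2_mulA sl2_mul1 sl2_1mul sl2_mulV sl2_Vmul.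

(* R[i]^o is R[i] with its normed topology; matrices carry the entrywise one. *)
Definition sl2_mx (A : SL2) : 'M[R[i]^o]_2 := val A.
HB.instance Definition _ :=
  Topological.copy SL2 (initial_topology sl2_mx).

Definition sl2_eqv (A B : SL2) := (A == B) || (A == sl2_opp B).

Fact sl2_oppK : involutive sl2_opp.
Proof. by move=> A; apply: val_inj; rewrite /= opprK. Qed.

Fact sl2_eqv_refl : reflexive sl2_eqv.
Proof. by move=> A; rewrite /sl2_eqv eqxx. Qed.
Fact sl2_eqv_sym : symmetric sl2_eqv.
Proof.
move=> A B; rewrite /sl2_eqv eq_sym; congr (_ || _).
by apply/eqP/eqP => ->; rewrite sl2_oppK.
Qed.
Fact sl2_eqv_trans : transitive sl2_eqv.
Proof.
move=> B A C /orP[] /eqP-> // /orP[] /eqP->.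
  by rewrite /sl2_eqv eqxx orbT.
by rewrite sl2_oppK sl2_eqv_refl.
Qed.
Canonical sl2_eqv_equiv :=
  EquivRel sl2_eqv sl2_eqv_refl sl2_eqv_sym sl2_eqv_trans.

Definition PSL2 : Type := quotient_topology {eq_quot sl2_eqv}.
HB.instance Definition _ := Topological.on PSL2.
HB.instance Definition _ := Quotient.on PSL2.

Definition psl2_of (A : SL2) : PSL2 := \pi_{eq_quot sl2_eqv} A.
Definition psl2_repr (x : PSL2) : SL2 := repr (x : {eq_quot sl2_eqv}).

Fact psl2_reprK x : psl2_of (psl2_repr x) = x.
Proof. exact: reprK. Qed.

Fact psl2_ofE A B : psl2_of A = psl2_of B <-> sl2_eqv A B.
Proof. by split=> [/eqmodP|?]; [|apply/eqmodP]. Qed.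

Fact psl2_repr_of A : psl2_repr (psl2_of A) = A \/
  psl2_repr (psl2_of A) = sl2_opp A.
Proof.
by have /psl2_ofE/orP[/eqP|/eqP] := psl2_reprK (psl2_of A); [left|right].
Qed.

Definition psl2_mul (x y : PSL2) :=
  psl2_of (sl2_mul (psl2_repr x) (psl2_repr y)).
Definition psl2_inv (x : PSL2) := psl2_of (sl2_inv (psl2_repr x)).
Definition psl2_one : PSL2 := psl2_of sl2_one.

Fact sl2_oppM A B : sl2_mul (sl2_opp A) B = sl2_opp (sl2_mul A B).
Proof. by apply: val_inj; rewrite /= mulNmx. Qed.
Fact sl2_mulN A B : sl2_mul A (sl2_opp B) = sl2_opp (sl2_mul A B).
Proof. by apply: val_inj; rewrite /= mulmxN. Qed.
Fact psl2_of_opp A : psl2_of (sl2_opp A) = psl2_of A.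
Proof. by apply/psl2_ofE; rewrite /sl2_eqv eqxx orbT. Qed.

Fact psl2_mulE A B : psl2_mul (psl2_of A) (psl2_of B) = psl2_of (sl2_mul A B).
Proof.
rewrite /psl2_mul; case: (psl2_repr_of A) => ->; case: (psl2_repr_of B) => ->;
by rewrite ?(sl2_oppM, sl2_mulN, psl2_of_opp).
Qed.

Fact psl2_mulA : associative psl2_mul.
Proof.
move=> x y z; rewrite -(psl2_reprK x) -(psl2_reprK y) -(psl2_reprK z).
by rewrite !psl2_mulE sl2_mulA.
Qed.
Fact psl2_mul1 : left_id psl2_one psl2_mul.
Proof. by move=> x; rewrite -(psl2_reprK x) psl2_mulE sl2_mul1. Qed.
Fact psl2_1mul : right_id psl2_one psl2_mul.
Proof. by move=> x; rewrite -(psl2_reprK x) psl2_mulE sl2_1mul. Qed.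
Fact psl2_mulV : left_inverse psl2_one psl2_inv psl2_mul.
Proof.
by move=> x; rewrite /psl2_inv -{2}(psl2_reprK x) psl2_mulE sl2_mulV.
Qed.
Fact psl2_Vmul : right_inverse psl2_one psl2_inv psl2_mul.
Proof.
by move=> x; rewrite /psl2_inv -{1}(psl2_reprK x) psl2_mulE sl2_Vmul.
Qed.

HB.instance Definition _ :=
  isGroup.Build PSL2 psl2_mulA psl2_mul1 psl2_1mul psl2_mulV psl2_Vmul.

End SL2.

(** * Hyperbolic 3-space, upper half-space model *)

Section H3.
Variable R : realType.

Record H3 := MkH3 { h3_pt :> R[i] * R; h3_gt0 : 0 < h3_pt.2 }.
HB.instance Definition _ := [isSub for h3_pt].
HB.instance Definition _ := [Choice of H3 by <:].

Definition h3_val (p : H3) : R[i]^o * R := h3_pt p.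
HB.instance Definition _ := Topological.copy H3 (initial_topology h3_val).

Definition sqmod (z : R[i]) : R := complex.Re z ^+ 2 + complex.Im z ^+ 2.

Definition arcosh (x : R) : R := ln (x + Num.sqrt (x ^+ 2 - 1)).

Definition hdist (p q : H3) : R :=
  arcosh (1 + (sqmod (p.1 - q.1) + (p.2 - q.2) ^+ 2) / (2 * p.2 * q.2)).

(* Poincare extension of the Moebius transformation of A. *)
Section Action.
Variables (A : SL2 R) (p : H3).
Let a := val A 0 0.
Let b := val A 0 1.
Let c := val A 1 0.
Let d := val A 1 1.
Let z := p.1.
Let t := p.2.

Definition moebius_den : R := sqmod (c * z + d) + sqmod c * t ^+ 2.

Definition moebius_fun : R[i] * R :=
  (((a * z + b) * conjc (c * z + d) + a * conjc c * real_complex R (t ^+ 2))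
     / real_complex R moebius_den,
   t / moebius_den).

Fact sqmod_ge0 w : 0 <= sqmod w.
Proof. by rewrite addr_ge0 ?sqr_ge0. Qed.

Fact sqmod_eq0 w : sqmod w = 0 -> w = 0.
Proof.
case: w => x y /eqP; rewrite /sqmod /= paddr_eq0 ?sqr_ge0 //.
by rewrite !sqrf_eq0 => /andP[/eqP-> /eqP->].
Qed.

Fact moebius_den_gt0 : 0 < moebius_den.
Proof.
have t0 : 0 < t ^+ 2 by rewrite exprn_gt0 // h3_gt0.
have h1 := sqmod_ge0 (c * z + d); have h2 := sqmod_ge0 c.
have h3 := mulr_ge0 h2 (ltW t0).
rewrite lt_def (addr_ge0 h1 h3) andbT.
apply/negP; rewrite paddr_eq0 //.
rewrite mulf_eq0 (gt_eqF t0) orbF => /andP[/eqP/sqmod_eq0 e /eqP/sqmod_eq0 c0].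
have d0 : d = 0 by move: e; rewrite c0 mul0r add0r.
have := valP A; rewrite /= (expand_det_row _ 1) !big_ord_recl big_ord0.
have -> : val A 1 ord0 = 0 by rewrite -c0.
have -> : val A 1 (lift ord0 ord0) = 0.
  by rewrite -d0; congr (val A 1 _); apply/val_inj.
by rewrite !mul0r !addr0 eq_sym oner_eq0.
Qed.

Fact moebius_gt0 : 0 < moebius_fun.2.
Proof. by rewrite divr_gt0 ?h3_gt0 ?moebius_den_gt0. Qed.

Definition moebius : H3 := MkH3 moebius_gt0.

End Action.

Definition psl2_act (x : PSL2 R) (p : H3) : H3 := moebius (psl2_repr x) p.

Fact sqmodN w : sqmod (- w) = sqmod w.
Proof. by case: w => x y; rewrite /sqmod /= !sqrrN. Qed.

Fact moebius_opp A p : moebius (sl2_opp A) p = moebius A p.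
Proof.
apply: val_inj => /=; rewrite /moebius_fun /moebius_den /= !mxE.
have cN (w : R[i]) : conjc (- w) = - conjc w by case: w.
by rewrite !mulNr -!opprD !cN !mulrN !mulNr !opprK !sqmodN.
Qed.

Fact psl2_act_of A p : psl2_act (psl2_of A) p = moebius A p.
Proof.
by rewrite /psl2_act; case: (psl2_repr_of A) => ->; rewrite ?moebius_opp.
Qed.

(* The boundary at infinity is C \cup {oo}; it is glued to H^3 inside the
   3-sphere (C x R) \cup {oo}. *)
Definition bdH3 := option R[i].

Definition S3 := one_point_compactification (R[i]^o * R)%type.

Definition h3_in_S3 (p : H3) : S3 := Some (h3_val p).

Definition bd_in_S3 (xi : bdH3) : S3 :=
  if xi is Some z then Some (z : R[i]^o, 0 : R) else None.

Definition geodesic_line (gam : R -> H3) (xi eta : bdH3) :=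
  [/\ (forall s t, hdist (gam s) (gam t) = `|s - t|),
      h3_in_S3 (gam t) @[t --> -oo] --> bd_in_S3 xi
    & h3_in_S3 (gam t) @[t --> +oo] --> bd_in_S3 eta].

(* r lies on the geodesic segment [p, q] iff d(p, r) + d(r, q) = d(p, q). *)
Definition hconvex (C : set H3) := forall p q r, C p -> C q ->
  hdist p r + hdist r q = hdist p q -> C r.

(* For closed Lam this is the trace on H^3 of the convex hull of Lam in the
   closed ball; it is closed in H^3. *)
Definition convex_hull (Lam : set bdH3) : set H3 :=
  \bigcap_(C in [set C | hconvex C /\ forall gam xi eta, Lam xi -> Lam eta ->
                   geodesic_line gam xi eta -> range gam `<=` C]) C.

(* The limit does not depend on the base point; (0, 1) is used. *)
Definition h3_base : H3 := @MkH3 (0, 1) ltr01.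

Definition translation_length (x : PSL2 R) : R :=
  limn (fun k => hdist h3_base (psl2_act (x ^+ k)%g h3_base) / k%:R).

Definition max_of (S : set R) (M : R) := S M /\ ubound S M.

End H3.

(** * Representations *)

Section Representations.
Variables (R : realType) (G : groupType).
Implicit Types rho : {multiplicative G -> PSL2 R}.

Definition limit_set rho : set (bdH3 R) := [set xi | exists p : H3 R,
  closure (range (fun g => h3_in_S3 (psl2_act (rho g) p))) (bd_in_S3 xi)].

Definition limit_hull rho : set (H3 R) := convex_hull (limit_set rho).

Definition discrete_image rho :=
  forall g, \forall y \near rho g, range rho y -> y = rho g.

Definition cocompact_on rho (Y : set (H3 R)) := exists C : set (H3 R),
  [/\ compact C, C `<=` Y
    & forall p, Y p -> exists g, exists2 q, C q & p = psl2_act (rho g) q].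

Definition convex_cocompact rho :=
  [/\ injective rho, discrete_image rho & cocompact_on rho (limit_hull rho)].

Definition cobounded_on rho (Y : set (H3 R)) (D : R) :=
  forall p q, Y p -> Y q -> exists g, hdist (psl2_act (rho g) p) q <= D.

(* A class function of g: its values on G are those of the length function on
   conjugacy classes. *)
Definition len rho (g : G) : R := translation_length (rho g).

Definition non_torsion : set G :=
  [set g | forall n, (0 < n)%N -> (g ^+ n <> 1)%g].

Definition Dil (rho' rho : {multiplicative G -> PSL2 R}) : \bar R :=
  ereal_sup [set (len rho' g / len rho g)%:E | g in non_torsion].

End Representations.

(* Main.v *)
Require Import Defs.
From HB Require Import structures.
From mathcomp Require Import all_boot all_order all_algebra.
From mathcomp Require Import all_classical all_reals all_analysis.
From mathcomp Require Import complex ring lra.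
From Stdlib Require Import Relation_Operators.

Import Order.TTheory GRing.Theory Num.Theory.
Import numFieldNormedType.Exports.
Import Normc.
Local Open Scope classical_set_scope.
Local Open Scope ring_scope.
Local Open Scope complex_scope.
Set Implicit Arguments.
Unset Strict Implicit.
Unset Printing Implicit Defensive.
Local Arguments conjc : simpl never.
Local Notation "z ^c" := (conjc z) : ring_scope.

(** The constant is K = 5. The bound is first obtained with 4 D and 4 ln 31 in
    place of 6 D and 10 ln 4 ([error_term_bound]).

    Growth of products. Let u_1, ..., u_m be elements of PSL_2(C) such that
    every u_i has translation length at most M and every u_i u_j at most 2 M.
    Then u_1 ... u_m has translation length at most m (M + 2 ln 31)
    ([tl_prod_bound]). Indeed the translation length is 2 ln |l| for the top
    eigenvalue l ([translation_lengthE]), so it is controlled by the traces of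
    powers; the traceless parts of the u_i are combinations, with coefficients
    of modulus at most 1, of three traceless matrices, which satisfy Clifford
    relations u v + v u = c 1 with bounded c, so that every word in the u_i
    reduces to eight monomials whose coefficients grow at most by a factor 31
    with each letter.

    Comparison. Let g be loxodromic for rho. Its axis lies in the convex hull of
    the limit set ([loxodromic_axis]). Cut a period of the axis of g ^+ j into m
    steps of length at most L / 2 - 2 D and approximate the division points by
    translates of one of them, at the cost of D at either end. This writes
    g ^+ j as a product of m elements of displacement at most L / 2 ([walk]).
    They and their pairwise products have rho-length at most L, so their
    rho_star-length is at most M L / 2 and M L, where M is the maximal ratio.
    The growth of products bounds the rho_star-length of g ^+ j by
    m (M L / 2 + 2 ln 31), and letting j tend to infinity gives the bound
    (M L + 4 ln 31) / (L - 4 D) on the ratio ([length_comparison]).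

    The maximum. It is over finitely many conjugacy classes, because a point on
    the axis can be moved near a fixed point of the hull and a discrete group
    meets bounded sets in finite sets ([finitely_many_short]). It is over a
    nonempty set by the same subdivision of an axis: a nonzero homomorphism to
    the integers does not vanish on some loxodromic g ([exists_loxodromic_hom]),
    hence not on some step u, which has infinite order and hence positive length, for a
    cobounded action excludes parabolic elements ([short_loxodromic],
    [len0_torsion]).

    Topology. Two properties of the surface group enter: it maps nontrivially to
    the integers, and it is not metabelian, whence there is a loxodromic
    element ([exists_loxodromic]). Both follow from [surface_hom]: for any
    elements h_0 and h_1 of any group there is a homomorphism to that group
    with conjugates of h_0 and h_1 among its values. It is the monodromy of the
    covering obtained by cutting the surface along two disjoint simple closed
    curves and gluing the sheets back by h_0 and h_1. *)

(** * Two by two matrices *)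

Section Mx2.
Variable F : fieldType.

Definition mx2 (a b c d : F) : 'M[F]_2 :=
  \matrix_(i, j) if i == 0 then if j == 0 then a else b
                 else if j == 0 then c else d.

Lemma ord2P (i : 'I_2) : i = 0 \/ i = 1.
Proof. by case: i => [[|[|//]] hi]; [left|right]; apply: val_inj. Qed.

Lemma mx2P (A B : 'M[F]_2) : A 0 0 = B 0 0 -> A 0 1 = B 0 1 ->
  A 1 0 = B 1 0 -> A 1 1 = B 1 1 -> A = B.
Proof.
move=> h00 h01 h10 h11; apply/matrixP => i j.
by case: (ord2P i) => ->; case: (ord2P j) => ->.
Qed.

Lemma mulmx2 (A B : 'M[F]_2) i j : (A *m B) i j = A i 0 * B 0 j + A i 1 * B 1 j.
Proof.
rewrite mxE big_ord_recl big_ord_recl big_ord0 addr0.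
by congr (_ + A i _ * B _ j); apply: val_inj.
Qed.

Lemma det2 (A : 'M[F]_2) : \det A = A 0 0 * A 1 1 - A 0 1 * A 1 0.
Proof.
rewrite (expand_det_row _ 0) !big_ord_recl big_ord0 addr0 /cofactor !det_mx11 !mxE /=.
rewrite expr0 expr1 mul1r mulN1r mulrN.
by congr (A _ _ * A _ _ - A _ _ * A _ _); apply: val_inj.
Qed.

Lemma trace2 (A : 'M[F]_2) : \tr A = A 0 0 + A 1 1.
Proof.
rewrite /mxtrace !big_ord_recl big_ord0 addr0.
by congr (_ + A _ _); apply: val_inj.
Qed.

(** The adjugate, the inverse on matrices of determinant 1. *)
Definition adj2 (A : 'M[F]_2) := mx2 (A 1 1) (- A 0 1) (- A 1 0) (A 0 0).

Lemma mul_adj2 (A : 'M[F]_2) : adj2 A *m A = (\det A)%:M.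
Proof. by apply: mx2P; rewrite mulmx2 det2 !mxE /=; ring. Qed.

Lemma mulmx_adj2 (A : 'M[F]_2) : A *m adj2 A = (\det A)%:M.
Proof. by apply: mx2P; rewrite mulmx2 det2 !mxE /=; ring. Qed.

Lemma adj2_mul (A B : 'M[F]_2) : adj2 (A *m B) = adj2 B *m adj2 A.
Proof. by apply: mx2P; rewrite !(mulmx2, mxE) /=; ring. Qed.

Lemma cayley_hamilton2 (A : 'M[F]_2) : A *m A = \tr A *: A - (\det A)%:M.
Proof. by apply: mx2P; rewrite det2 trace2 !(mulmx2, mxE) /=; ring. Qed.

End Mx2.

(** * The Hermitian model of hyperbolic space *)

Section Hermitian.
Variable R : realType.
Implicit Types (z w : R[i]) (A B : SL2 R) (p q : H3 R).

Lemma sqmodE z : (sqmod z)%:C = z * z^c.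
Proof.
by case: z => x y; rewrite /sqmod /=; apply/eqP; rewrite eq_complex /=;
  apply/andP; split; apply/eqP; ring.
Qed.

Lemma sqmod_normc z : sqmod z = normc z ^+ 2.
Proof. by case: z => x y; rewrite /sqmod /= sqr_sqrtr // addr_ge0 ?sqr_ge0. Qed.

(** Morphism laws for the inclusion of R in R[i] and for conjugation, with
    syntactic left-hand sides. *)
Lemma RC_M (x y : R) : (x * y)%:C = x%:C * y%:C. Proof. exact: rmorphM. Qed.
Lemma RC_D (x y : R) : (x + y)%:C = x%:C + y%:C. Proof. exact: rmorphD. Qed.
Lemma RC_B (x y : R) : (x - y)%:C = x%:C - y%:C. Proof. exact: rmorphB. Qed.
Lemma RC_X (x : R) n : (x ^+ n)%:C = x%:C ^+ n. Proof. exact: rmorphXn. Qed.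
Lemma RC_V (x : R) : (x^-1)%:C = x%:C^-1. Proof. exact: fmorphV. Qed.
Lemma RC_1 : (1 : R)%:C = 1. Proof. by []. Qed.
Lemma RC_n n : (n%:R : R)%:C = n%:R. Proof. exact: rmorph_nat. Qed.
Definition RC := (RC_M, RC_D, RC_B, RC_X, RC_V, RC_1, RC_n).

Lemma conjcM z w : (z * w)^c = z^c * w^c. Proof. exact: rmorphM. Qed.
Lemma conjcD z w : (z + w)^c = z^c + w^c. Proof. exact: rmorphD. Qed.
Lemma conjcB z w : (z - w)^c = z^c - w^c. Proof. exact: rmorphB. Qed.
Lemma conjcN z : (- z)^c = - z^c. Proof. exact: rmorphN. Qed.
Lemma conjcV z : (z^-1)^c = (z^c)^-1. Proof. exact: conjc_inv. Qed.
Lemma conjc_0 : (0 : R[i])^c = 0. Proof. exact: conjc0. Qed.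
Lemma conjc_1 : (1 : R[i])^c = 1. Proof. exact: conjc1. Qed.
Definition CJ := (conjc_0, conjc_1, conjcM, conjcD, conjcB, conjcN, conjcV, @conjcK R, @conjc_real R).

Definition ctr (A : 'M[R[i]]_2) : 'M[R[i]]_2 := (map_mx conjc A)^T.

Lemma ctr_mul (A B : 'M[R[i]]_2) : ctr (A *m B) = ctr B *m ctr A.
Proof. by rewrite /ctr map_mxM trmx_mul. Qed.

Lemma det_ctr (A : 'M[R[i]]_2) : \det (ctr A) = (\det A)^c.
Proof. by rewrite /ctr det_tr det_map_mx. Qed.

(** The point (z, t) corresponds to the positive Hermitian matrix B B^c of
    determinant 1, for any B in SL_2 that maps (0, 1) to (z, t). In this model
    A acts by X |-> A X A^c, so that the action law and the invariance of the
    distance become identities between products of matrices. *)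
Definition herm (p : H3 R) : 'M[R[i]]_2 :=
  let z := p.1 in let t := p.2%:C in
  mx2 ((z * z^c + t ^+ 2) / t) (z / t) (z^c / t) t^-1.

Lemma h3C_neq0 p : p.2%:C != 0 :> R[i].
Proof. by rewrite (inj_eq (@complexI R) _ 0) gt_eqF ?h3_gt0. Qed.

Lemma det_herm p : \det (herm p) = 1.
Proof. by rewrite det2 !mxE /=; field; exact: h3C_neq0. Qed.

(** The second column of herm (z, t) is (z / t, 1 / t). *)
Lemma herm_inj : injective herm.
Proof.
move=> p q h; apply: val_inj => /=.
have /(congr1 (fun M : 'M[R[i]]_2 => M 1 1)) := h; rewrite !mxE /= => /invr_inj ht.
have /(congr1 (fun M : 'M[R[i]]_2 => M 0 1)) := h; rewrite !mxE /= ht.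
move=> /(mulIf _) hz; move: ht => [] ht.
have {}hz : p.1 = q.1 by apply: hz; rewrite invr_eq0 h3C_neq0.
by case: (h3_pt p) (h3_pt q) ht hz => [z t] [w s] /= -> ->.
Qed.

Lemma sl2_det1 A : \det (sl2_val A) = 1. Proof. exact: eqP (valP A). Qed.

(** The entries of the last row and column agree by computation, and then the
    upper left ones do because both determinants are 1. *)
Lemma herm_moebius A p : herm (moebius A p) = sl2_val A *m herm p *m ctr (sl2_val A).
Proof.
have hN := moebius_den_gt0 A p.
have NE : (moebius_den A p)%:C = (sl2_val A 1 0 * p.1 + sl2_val A 1 1) *
   (sl2_val A 1 0 * p.1 + sl2_val A 1 1)^c + sl2_val A 1 0 * (sl2_val A 1 0)^c * p.2%:C ^+ 2.
  by rewrite /moebius_den !(sqmodE, RC).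
have N0 : (moebius_den A p)%:C != 0 :> R[i].
  by rewrite (inj_eq (@complexI R) _ 0) gt_eqF.
have t0 := h3C_neq0 p.
have d1 := sl2_det1 A; rewrite det2 in d1.
set M := herm _; set M' := _ *m _.
have e11 : M 1 1 = M' 1 1.
  rewrite !(mulmx2, mxE) /= /moebius_fun /=;
    move: (moebius_den A p) NE N0 => N NE N0;
rewrite !RC invf_div NE !CJ; field; exact: t0.
have e01 : M 0 1 = M' 0 1.
  rewrite !(mulmx2, mxE) /= /moebius_fun /=;
    move: (moebius_den A p) NE N0 => N NE N0;
    rewrite !RC !CJ; field.
  by rewrite t0 N0.
have e10 : M 1 0 = M' 1 0.
  rewrite !(mulmx2, mxE) /= /moebius_fun /=;
    move: (moebius_den A p) NE N0 => N NE N0;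
    rewrite !(RC, CJ); field.
  by rewrite t0 N0.
have dM : \det M = \det M'.
  by rewrite det_herm !det_mulmx det_herm det_ctr sl2_det1 conjc1 !mul1r.
apply: mx2P => //.
have m11 : M 1 1 != 0 by rewrite mxE; exact: (invr_neq0 (h3C_neq0 _)).
apply: (mulIf m11); move: dM; rewrite !det2 e01 e10 e11 => /(congr1 (+%R^~ (M' 0 1 * M' 1 0))).
by rewrite !subrK.
Qed.

Lemma moebius_mul A B p : moebius (sl2_mul A B) p = moebius A (moebius B p).
Proof. by apply: herm_inj; rewrite !herm_moebius /= ctr_mul !mulmxA. Qed.

Lemma moebius_one p : moebius (sl2_one R) p = p.
Proof.
apply: herm_inj; rewrite !herm_moebius /= mul1mx.
by rewrite /ctr map_mx1 trmx1 mulmx1.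
Qed.

Definition hcosh p q : R :=
  1 + (sqmod (p.1 - q.1) + (p.2 - q.2) ^+ 2) / (2 * p.2 * q.2).

Lemma hdistE p q : hdist p q = arcosh (hcosh p q). Proof. by []. Qed.

Lemma hcosh_herm p q :
  (2 * hcosh p q)%:C = \tr (herm p *m adj2 (herm q)).
Proof.
rewrite /hcosh !(sqmodE, RC) !CJ trace2 !(mulmx2, mxE) /=; field.
by rewrite (h3C_neq0 p) (h3C_neq0 q).
Qed.

Lemma hcosh_moebius A p q : hcosh (moebius A p) (moebius A q) = hcosh p q.
Proof.
apply: (@mulfI _ (2 : R)); first by rewrite pnatr_eq0.
apply: (@complexI R); rewrite !hcosh_herm !herm_moebius !adj2_mul.
rewrite !mulmxA -(mulmxA _ (ctr A) (adj2 (ctr A))) mulmx_adj2 det_ctr sl2_det1.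
rewrite conjc1 mulmx1 -!mulmxA mxtrace_mulC -!mulmxA mul_adj2 sl2_det1.
by rewrite mulmx1.
Qed.

Lemma hdist_moebius A p q : hdist (moebius A p) (moebius A q) = hdist p q.
Proof. by rewrite !hdistE hcosh_moebius. Qed.

Lemma hcosh_ge1 p q : 1 <= hcosh p q.
Proof.
rewrite /hcosh lerDl divr_ge0 //; first by rewrite addr_ge0 ?sqmod_ge0 ?sqr_ge0.
by rewrite !mulr_ge0 // ltW ?h3_gt0.
Qed.

Lemma hcoshC p q : hcosh p q = hcosh q p.
Proof.
by rewrite /hcosh -(sqmodN (_ - _)) opprB -(sqrrN (_ - _)) opprB (mulrAC 2).
Qed.

Lemma hdistC p q : hdist p q = hdist q p.
Proof. by rewrite !hdistE hcoshC. Qed.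

(** Half the square of the Frobenius norm is the hyperbolic cosine of the
    displacement of the base point. *)
Definition frob (A : 'M[R[i]]_2) : R :=
  sqmod (A 0 0) + sqmod (A 0 1) + sqmod (A 1 0) + sqmod (A 1 1).

Lemma herm_base : herm (h3_base R) = 1%:M.
Proof.
rewrite /herm -[(h3_base R : R[i] * R).1]/(0 : R[i]).
rewrite -[(h3_base R : R[i] * R).2]/(1 : R) conjc0 RC_1.
by apply: mx2P; rewrite !mxE /= ?mul0r ?add0r ?expr1n ?invr1 ?mulr1.
Qed.

Lemma hcosh_base A : hcosh (h3_base R) (moebius A (h3_base R)) = frob A / 2.
Proof.
apply: (@mulfI _ (2 : R)); first by rewrite pnatr_eq0.
apply: (@complexI R); rewrite hcoshC hcosh_herm herm_moebius herm_base.
have -> : adj2 (1%:M : 'M[R[i]]_2) = 1%:M by apply: mx2P; rewrite !mxE ?oppr0.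
rewrite !mulmx1 trace2 !(mulmx2, mxE) /= mulrCA divff ?pnatr_eq0 // mulr1 /frob.
by rewrite !(sqmodE, RC_D) !addrA.
Qed.

(** The point (z, t) is the image of (0, 1) under (s, z / s; 0, 1 / s) with
    s ^ 2 = t. *)
Lemma transitive_base p : exists A, p = moebius A (h3_base R).
Proof.
have t0 := h3C_neq0 p; have tp := h3_gt0 p.
have [s [s0 ss sC]] : exists s : R[i],
    [/\ s != 0, s * s = p.2%:C & s^c = s].
  exists (Num.sqrt p.2)%:C; have ss : (Num.sqrt p.2)%:C ^+ 2 = p.2%:C.
    by rewrite -RC_X sqr_sqrtr // ltW.
  rewrite -expr2 conjc_real; split=> //.
  by apply: contra_neq t0 => s0; rewrite -ss s0 expr0n.
have dA : \det (mx2 s (p.1 / s) 0 s^-1) == 1.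
  by rewrite det2 !mxE /=; apply/eqP; field.
exists (MkSL2 dA); apply: herm_inj; rewrite herm_moebius herm_base mulmx1.
by apply: mx2P; rewrite !(mulmx2, mxE) /= !CJ ?sC -ss; field.
Qed.

End Hermitian.

Section Arcosh.
Variable R : realType.
Implicit Types x y r : R.

Lemma sqrt_sub1K x : 1 <= x -> Num.sqrt (x ^+ 2 - 1) ^+ 2 = x ^+ 2 - 1.
Proof. by move=> x1; rewrite sqr_sqrtr // subr_ge0 -(expr1n _ 2) ler_pXn2r ?nnegrE ?(le_trans ler01). Qed.

Lemma arcosh_le x y : 1 <= x -> x <= y -> arcosh x <= arcosh y.
Proof.
move=> x1 xy; have x0 : 0 < x := lt_le_trans ltr01 x1.
rewrite ler_ln ?posrE; last 2 first.
- by rewrite ltr_pwDl ?sqrtr_ge0.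
- by rewrite ltr_pwDl ?sqrtr_ge0 // (lt_le_trans x0).
rewrite lerD // ler_sqrt; last by rewrite -sqrt_sub1K ?sqr_ge0 // (le_trans x1).
by rewrite lerB // ler_pXn2r ?nnegrE ?(ltW x0) ?(le_trans (ltW x0)).
Qed.

Lemma arcoshD x y : 1 <= x -> 1 <= y ->
  arcosh x + arcosh y =
  arcosh (x * y + Num.sqrt (x ^+ 2 - 1) * Num.sqrt (y ^+ 2 - 1)).
Proof.
move=> x1 y1; have hx := sqrt_sub1K x1; have hy := sqrt_sub1K y1.
have sx := sqrtr_ge0 (x ^+ 2 - 1); have sy := sqrtr_ge0 (y ^+ 2 - 1).
rewrite /arcosh; set s := Num.sqrt _ in hx sx *.
set t := Num.sqrt (y ^+ 2 - 1) in hy sy *.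
have -> : (x * y + s * t) ^+ 2 - 1 = (x * t + y * s) ^+ 2 by ring: hx hy.
have x0 := lt_le_trans ltr01 x1; have y0 := lt_le_trans ltr01 y1.
rewrite sqrtr_sqr ger0_norm; last by rewrite addr_ge0 // mulr_ge0 // ltW.
rewrite -lnM ?posrE ?ltr_pwDl //; congr ln; ring.
Qed.

Lemma arcosh_half r : 1 <= r -> arcosh ((r + r^-1) / 2) = ln r.
Proof.
move=> r1; have r0 := lt_le_trans ltr01 r1.
have e : ((r + r^-1) / 2) ^+ 2 - 1 = ((r - r^-1) / 2) ^+ 2.
  by field; rewrite gt_eqF.
rewrite /arcosh e sqrtr_sqr ger0_norm; last first.
  by rewrite divr_ge0 // subr_ge0 (le_trans _ r1) // invf_le1.
by congr ln; field; rewrite gt_eqF.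
Qed.

Lemma arcosh_bounds x : 1 <= x -> ln x <= arcosh x <= ln (2 * x).
Proof.
move=> x1; have x0 := lt_le_trans ltr01 x1.
have sx := sqrtr_ge0 (x ^+ 2 - 1); have hx := sqrt_sub1K x1.
rewrite !ler_ln ?posrE ?mulr_gt0 ?ltr_pwDl // lerDl sqrtr_ge0 /=.
rewrite mulr_natl mulr2n lerD2l -(ler_pXn2r (n := 2)) ?nnegrE ?(ltW x0) //.
by rewrite hx gerBl ler01.
Qed.

End Arcosh.

Section Metric.
Variable R : realType.
Implicit Types (p q r : H3 R) (A B : SL2 R).

(** In Minkowski coordinates the distances from the base point are x0 and y0,
    and the claim is the Cauchy-Schwarz inequality for the space parts. *)
Lemma hcosh_triangle_base p q (o := h3_base R) :
  hcosh p q <= hcosh p o * hcosh o q +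
    Num.sqrt (hcosh p o ^+ 2 - 1) * Num.sqrt (hcosh o q ^+ 2 - 1).
Proof.
have tp := h3_gt0 p; have tq := h3_gt0 q.
have [p1 q1] : 1 <= hcosh p o /\ 1 <= hcosh o q by rewrite !hcosh_ge1.
rewrite -sqrtrM; last by rewrite -sqrt_sub1K ?sqr_ge0.
set c := hcosh p q; set x0 := hcosh p o; set y0 := hcosh o q.
pose f (p : H3 R) := (sqmod p.1 + p.2 ^+ 2 - 1) / (2 * p.2).
pose g (p : H3 R) := complex.Re p.1 / p.2.
pose h (p : H3 R) := complex.Im p.1 / p.2.
have [tp0 tq0] : p.2 != 0 /\ q.2 != 0 by rewrite !gt_eqF.
have ex : x0 ^+ 2 - 1 = f p ^+ 2 + g p ^+ 2 + h p ^+ 2.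
  rewrite /x0 /hcosh /f /g /h /o /=; case: (p.1) => a b; rewrite /sqmod /=.
  by field.
have ey : y0 ^+ 2 - 1 = f q ^+ 2 + g q ^+ 2 + h q ^+ 2.
  rewrite /y0 /hcosh /f /g /h /o /=; case: (q.1) => a b; rewrite /sqmod /=.
  by field.
have ec : c = x0 * y0 - (f p * f q + g p * g q + h p * h q).
  rewrite /c /x0 /y0 /hcosh /f /g /h /o /=.
  case: (p.1) => a b; case: (q.1) => a' b'; rewrite /sqmod /=.
  by field; rewrite ?tp0 ?tq0.
rewrite ec ex ey lerD2l.
apply: le_trans (ler_norm _) _; rewrite normrN -sqrtr_sqr ler_sqrt; last first.
  by rewrite mulr_ge0 ?addr_ge0 ?sqr_ge0.
rewrite -subr_ge0; set d := _ - _.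
have -> : d = (f p * g q - g p * f q) ^+ 2 + (f p * h q - h p * f q) ^+ 2 +
  (g p * h q - h p * g q) ^+ 2 by rewrite /d; ring.
by rewrite !addr_ge0 ?sqr_ge0.
Qed.

(** By homogeneity the middle point is the base point, and the addition formula
    for arcosh turns the claim into an inequality for hyperbolic cosines. *)
Lemma hdist_triangle q p r : hdist p r <= hdist p q + hdist q r.
Proof.
have [A ->] := transitive_base q.
have [A' AA'] : exists A', forall p : H3 R, moebius A (moebius A' p) = p.
  by exists (sl2_inv A) => p'; rewrite -moebius_mul sl2_Vmul moebius_one.
rewrite -(AA' p) -(AA' r); move: (moebius A' p) (moebius A' r) => {}p {}r.
rewrite !hdist_moebius !hdistE arcoshD ?hcosh_ge1 //.
by rewrite arcosh_le ?hcosh_ge1 ?hcosh_triangle_base.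
Qed.

(** The geodesic from 0 to infinity, parametrized by arc length. *)
Definition vertical (s : R) : H3 R := @MkH3 R (0, expR s) (expR_gt0 s).

Lemma vertical0 : vertical 0 = h3_base R.
Proof. by apply: val_inj; rewrite /= expR0. Qed.

Lemma hdist_vertical s t : hdist (vertical s) (vertical t) = `|s - t|.
Proof.
wlog st : s t / t <= s.
  move=> h; have [|/ltW] := leP t s; first exact: h.
  by rewrite hdistC distrC; exact: h.
rewrite ger0_norm ?subr_ge0 // -[RHS]expRK -arcosh_half; last first.
  by rewrite -expR0 ler_expR subr_ge0.
rewrite hdistE /hcosh /= subrr /sqmod /= expr0n /= !add0r expRB.
by congr arcosh; field; rewrite ?gt_eqF ?expR_gt0.
Qed.

End Metric.

(** * Translation length and eigenvalues *)

Section Spectrum.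
Variable R : realType.
Implicit Types (z w l : R[i]) (A B : SL2 R) (p q : H3 R) (x y : PSL2 R).

Lemma normc_ge0 z : 0 <= normc z.
Proof. by case: z => a b; rewrite /= sqrtr_ge0. Qed.

Lemma normcX z k : normc (z ^+ k) = normc z ^+ k.
Proof.
by elim: k => [|k IH]; rewrite ?expr0 ?normc1 // !exprS normcM IH.
Qed.

Lemma normc_eq0 z : (normc z == 0) = (z == 0).
Proof. by apply/eqP/eqP => [/eq0_normc|->]; rewrite ?normc0. Qed.

Lemma ler_normcB z w : normc (z - w) <= normc z + normc w.
Proof. by rewrite -(normcN w) le_normcD. Qed.

Lemma normc_nat n : normc (n%:R : R[i]) = n%:R.
Proof. by rewrite -(RC_n R n) /= expr0n addr0 sqrtr_sqr ger0_norm. Qed.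

Lemma normcD_sqr z w : normc (z + w) ^+ 2 <= 2 * (normc z ^+ 2 + normc w ^+ 2).
Proof.
rewrite -!sqmod_normc; case: z w => [a b] [c d]; rewrite /sqmod /=.
rewrite -subr_ge0; set u := _ - _.
have -> : u = (a - c) ^+ 2 + (b - d) ^+ 2 by rewrite /u; ring.
by rewrite addr_ge0 ?sqr_ge0.
Qed.

Lemma normc_parallelogram z w :
  normc (z + w) ^+ 2 + normc (z - w) ^+ 2 = 2 * (normc z ^+ 2 + normc w ^+ 2).
Proof.
by rewrite -!sqmod_normc; case: z w => [a b] [c d]; rewrite /sqmod /=; ring.
Qed.

Lemma frobE (A : 'M[R[i]]_2) : frob A = normc (A 0 0) ^+ 2 +
  normc (A 0 1) ^+ 2 + normc (A 1 0) ^+ 2 + normc (A 1 1) ^+ 2.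
Proof. by rewrite /frob !sqmod_normc. Qed.

(** For A of determinant 1: l is an eigenvalue of A of maximal modulus. *)
Definition top_eigenvalue (A : 'M[R[i]]_2) l :=
  [/\ l != 0, l + l^-1 = \tr A & 1 <= normc l].

Lemma top_eigenvalue_ex (A : 'M[R[i]]_2) : exists l, top_eigenvalue A l.
Proof.
set t := \tr A; pose s := sqrtc (t ^+ 2 - 4).
have ss : s ^+ 2 = t ^+ 2 - 4 by rewrite sqr_sqrtc.
pose l := (t + s) / 2; pose m := (t - s) / 2.
have lm : l * m = 1 by rewrite /l /m; field: ss.
have l0 : l != 0 by apply/eqP => e; move: lm; rewrite e mul0r => /esym/eqP; rewrite oner_eq0.
have m0 : m != 0 by apply/eqP => e; move: lm; rewrite e mulr0 => /esym/eqP; rewrite oner_eq0.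
have mE : m = l^-1 by apply: (mulfI l0); rewrite lm divff.
have tE : l + m = t by rewrite /l /m; field.
have [l1|l1] := leP 1 (normc l); first by exists l; split=> //; rewrite -mE.
exists m; split=> //; first by rewrite {2}mE invrK addrC.
by rewrite mE normcV invf_ge1 ?(ltW l1) // lt_def normc_eq0 l0 normc_ge0.
Qed.

Lemma top_eigenvalue_gt0 A l : top_eigenvalue A l -> 0 < normc l.
Proof. by case=> _ _; apply: lt_le_trans. Qed.

(** Schur's inequality between the eigenvalues and the Frobenius norm. *)
Lemma schur A l : top_eigenvalue A l ->
  normc l ^+ 2 + (normc l ^+ 2)^-1 <= frob A.
Proof.
move=> [l0 lt l1].
have e : (l - l^-1) ^+ 2 =
    (A 0 0 - A 1 1) ^+ 2 + 4 * (A 0 1 * A 1 0).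
  have d := sl2_det1 A; rewrite det2 in d; rewrite trace2 in lt.
  have -> : (l - l^-1) ^+ 2 = (l + l^-1) ^+ 2 - 4 by field.
  have {}d : A 0 0 * A 1 1 = 1 + A 0 1 * A 1 0 by rewrite -d subrK.
  by rewrite lt; ring: d.
have h : normc (l - l^-1) ^+ 2 <= normc (A 0 0 - A 1 1) ^+ 2 +
    2 * (normc (A 0 1) ^+ 2 + normc (A 1 0) ^+ 2).
  rewrite -normcX e (le_trans (le_normcD _ _)) // normcX !normcM lerD2l.
  rewrite normc_nat -subr_ge0; set u := _ - _.
  have -> : u = 2 * (normc (A 0 1) - normc (A 1 0)) ^+ 2 by rewrite /u; ring.
  by rewrite mulr_ge0 ?sqr_ge0.
have h1 := normc_parallelogram l l^-1.
have h2 := normc_parallelogram (A 0 0) (A 1 1).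
rewrite -exprVn -normcV frobE; move: h1 h2; rewrite lt trace2.
move: h; lra.
Qed.

(** Powers of A are combinations of A and 1 whose coefficients are the
    Chebyshev polynomials of the second kind at the trace. *)
Fixpoint chebU l k : R[i] := if k is k.+1 then l * chebU l k + l^-1 ^+ k else 0.

Lemma val_sl2X A k : sl2_val (A ^+ k.+1)%g = sl2_val A *m sl2_val (A ^+ k)%g.
Proof. by rewrite expgS. Qed.

Lemma chebUE A l k : top_eigenvalue A l ->
  sl2_val (A ^+ k.+1)%g = chebU l k.+1 *: sl2_val A - (chebU l k)%:M.
Proof.
case=> l0 lt _.
have rec k' : l^-1 * chebU l k'.+1 = chebU l k' + l^-1 ^+ k'.+1.
  by rewrite /= mulrDr mulKf // exprS.
elim: k => [|k IH].
  by rewrite expg1 /= mulr0 add0r expr0 scale1r raddf0 subr0.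
rewrite val_sl2X IH mulmxBr -scalemxAr cayley_hamilton2 sl2_det1 -lt.
rewrite mul_mx_scalar scalerBr scalerA scale_scalar_mx mulr1.
rewrite addrAC -scalerBl; congr (_ *: _ - _).
by rewrite mulrDr [_ * l^-1]mulrC rec -[chebU l k.+2]/(l * chebU l k.+1 + l^-1 ^+ k.+1);
  ring.
Qed.

Lemma chebU_bound A l k : top_eigenvalue A l ->
  normc (chebU l k) <= k%:R * normc l ^+ k.
Proof.
case=> l0 _ l1; elim: k => [|k IH]; first by rewrite normc0 mul0r.
rewrite /= (le_trans (le_normcD _ _)) // normcM -natr1 mulrDl mul1r lerD //.
  by rewrite exprS mulrCA ler_wpM2l ?normc_ge0.
rewrite normcX normcV; apply: le_trans (_ : 1 <= _); last exact: exprn_ege1.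
by rewrite exprn_ile1 // ?invr_ge0 ?normc_ge0 ?invf_le1 // (lt_le_trans ltr01).
Qed.

Lemma trace_sl2X A l k : top_eigenvalue A l ->
  \tr (sl2_val (A ^+ k)%g) = l ^+ k + l^-1 ^+ k.
Proof.
move=> lA; have [l0 lt _] := lA.
have t1 : \tr (1%:M : 'M[R[i]]_2) = 2 by rewrite mxtrace1.
case: k => [|k]; first by rewrite expg0 !expr0 /= t1.
rewrite (chebUE k lA) raddfB /= mxtraceZ mxtrace_scalar -lt.
elim: k => [|k IH]; first by rewrite /= expr0; ring.
have : (l * chebU l k.+1 + l^-1 ^+ k.+1) * (l + l^-1) - chebU l k.+1 *+ 2 =
  l * (chebU l k.+1 * (l + l^-1) - chebU l k *+ 2) + (l^-1 ^+ k.+2 - l * l^-1 ^+ k.+1).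
  have -> : chebU l k.+1 = l * chebU l k + l^-1 ^+ k by [].
  rewrite !exprS; field. exact: l0.
move=> ->; have -> : chebU l k.+1 * (l + l^-1) - chebU l k *+ 2 =
  l ^+ k.+1 + l^-1 ^+ k.+1 by [].
by rewrite !exprS; field.
Qed.

Lemma psl2_ofM A B : psl2_of (A * B)%g = (psl2_of A * psl2_of B)%g.
Proof. by rewrite [RHS]psl2_mulE. Qed.

Lemma psl2_ofX A k : psl2_of (A ^+ k)%g = (psl2_of A ^+ k)%g.
Proof. by elim: k => [|k IH]; rewrite ?expg0 // !expgS psl2_ofM IH. Qed.

Lemma psl2_ofV A : psl2_of (A^-1)%g = ((psl2_of A)^-1)%g.
Proof.
by apply: (mulgI (psl2_of A)); rewrite -psl2_ofM !mulgV.
Qed.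

Lemma frob_lin (M : 'M[R[i]]_2) z w :
  frob (z *: M - w%:M) <= 2 * (normc z ^+ 2 * frob M + 2 * normc w ^+ 2).
Proof.
have h (a b : R[i]) : normc (z * a - b) ^+ 2 <=
    2 * (normc z ^+ 2 * normc a ^+ 2 + normc b ^+ 2).
  by rewrite -exprMn -normcM -(normcN b) normcD_sqr.
rewrite !frobE !mxE /= !mulr1n !mulr0n.
have := h (M 0 0) w; have := h (M 0 1) 0; have := h (M 1 0) 0; have := h (M 1 1) w.
rewrite normc0 expr0n /=; lra.
Qed.

(** A bound that makes (ln k) / k tend to 0. *)
Lemma ln_le_sqrt (n : nat) : ln (n.+1%:R : R) <= 2 * Num.sqrt n.+1%:R.
Proof.
have n0 : 0 < Num.sqrt (n.+1%:R : R) by rewrite sqrtr_gt0.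
have {1}-> : (n.+1%:R : R) = Num.sqrt n.+1%:R ^+ 2 by rewrite sqr_sqrtr.
by rewrite lnXn // mulr2n mulr_natl mulr2n lerD // ltW // ln_sublinear.
Qed.

Lemma cvg_inv_sqrt : (Num.sqrt (k.+1%:R : R))^-1 @[k --> \oo] --> 0.
Proof.
have h : Num.sqrt (@harmonic R k) @[k --> \oo] --> Num.sqrt (0 : R).
  by apply: continuous_cvg cvg_harmonic; exact: sqrt_continuous.
rewrite -(sqrtr0 R); apply: cvg_trans h; apply: near_eq_cvg; near=> k.
by rewrite /harmonic /= sqrtrV.
Unshelve. all: by end_near. Qed.

(** The displacement of the base point by A^k is governed by the norm of A^k.
    Schur's inequality bounds that norm from below; from above it is bounded by
    the expression of A^k in A and 1, whose coefficients are at most k |l|^k. *)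
Lemma hdist_pow_bounds A l k : top_eigenvalue A l ->
  k.+1%:R * (2 * ln (normc l)) <=
    hdist (h3_base R) (moebius (A ^+ k.+1)%g (h3_base R)) <=
  k.+1%:R * (2 * ln (normc l)) + 2 * ln k.+1%:R + ln (2 * (frob A + 2)).
Proof.
move=> lA; have [l0 lt l1] := lA; have r0 := top_eigenvalue_gt0 lA.
have lAk : top_eigenvalue (A ^+ k.+1)%g (l ^+ k.+1).
  by split; rewrite ?expf_neq0 ?(trace_sl2X _ lA) ?exprVn ?normcX ?exprn_ege1.
have := schur lAk; have := hcosh_ge1 (h3_base R) (moebius (A ^+ k.+1)%g (h3_base R)).
rewrite hdistE hcosh_base; set F := frob _ => F1 hF.
have rk : 1 <= (normc l ^+ k.+1) ^+ 2 by rewrite !exprn_ege1.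
have lnr : ln ((normc l ^+ k.+1) ^+ 2) = k.+1%:R * (2 * ln (normc l)).
  rewrite lnXn ?exprn_gt0 //; rewrite lnXn //; ring.
apply/andP; split.
  rewrite -lnr -arcosh_half //; apply: arcosh_le.
    rewrite ler_pdivlMr // mul1r.
    set u := _ ^+ 2 in rk *; have u0 : 0 < u := lt_le_trans ltr01 rk.
    rewrite -subr_ge0; set v := _ - _.
    have -> : v = (u - 1) ^+ 2 / u by rewrite /v; field; rewrite gt_eqF.
    by rewrite divr_ge0 ?sqr_ge0 // ltW.
  by rewrite ler_pM2r ?invr_gt0 // -normcX.
have /andP[_ h] := arcosh_bounds F1; apply: le_trans h _.
have F0 : 0 < F by move: F1; rewrite ler_pdivlMr // mul1r; apply: lt_le_trans.
have A0 : 0 <= frob A by rewrite frobE !addr_ge0 ?sqr_ge0.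
have k0 : 0 < k.+1%:R :> R by rewrite ltr0n.
rewrite -lnr mulrCA divff ?pnatr_eq0 // mulr1.
have -> : 2 * ln (k.+1%:R : R) = ln (k.+1%:R ^+ 2) by rewrite lnXn // mulr_natl.
have p1 : 0 < (normc l ^+ k.+1) ^+ 2 by rewrite !exprn_gt0.
have p2 : 0 < (k.+1%:R : R) ^+ 2 by rewrite exprn_gt0.
have p3 : 0 < 2 * (frob A + 2) by rewrite mulr_gt0 ?ltr_wpDl.
rewrite -lnM ?posrE // -lnM ?posrE //; last by rewrite mulr_gt0.
rewrite ler_ln ?posrE //; last exact: mulr_gt0 (mulr_gt0 p1 p2) p3.
clear p1 p2 p3.
rewrite /F (chebUE k lA); apply: le_trans (frob_lin _ _ _) _.
set r := normc l in r0 l1 *.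
have b1 : normc (chebU l k.+1) ^+ 2 <= k.+1%:R ^+ 2 * (r ^+ k.+1) ^+ 2.
  rewrite -exprMn ler_pXn2r ?nnegrE ?normc_ge0 ?mulr_ge0 ?exprn_ge0 ?(ltW r0) //.
  exact: chebU_bound lA.
have b2 : normc (chebU l k) ^+ 2 <= k.+1%:R ^+ 2 * (r ^+ k.+1) ^+ 2.
  rewrite -exprMn ler_pXn2r ?nnegrE ?normc_ge0 ?mulr_ge0 ?exprn_ge0 ?(ltW r0) //.
  apply: le_trans (chebU_bound _ lA) _; rewrite ler_pM ?exprn_ge0 ?(ltW r0) ?ler_nat //.
  by rewrite ler_weXn2l.
set Q := k.+1%:R ^+ 2 * _ in b1 b2.
have -> : (r ^+ k.+1) ^+ 2 * k.+1%:R ^+ 2 * (2 * (frob A + 2)) =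
  2 * (Q * frob A + 2 * Q) by rewrite /Q; ring.
by rewrite ler_pM2l // lerD // ?ler_pM2l // ler_wpM2r.
Qed.

Lemma psl2_act_base x k p A : x = psl2_of A ->
  psl2_act (x ^+ k)%g p = moebius (A ^+ k)%g p.
Proof. by move=> ->; rewrite -psl2_ofX psl2_act_of. Qed.

Theorem translation_lengthE A l : top_eigenvalue A l ->
  translation_length (psl2_of A) = 2 * ln (normc l).
Proof.
move=> lA; set c := 2 * _; apply/cvg_lim => //.
rewrite -(cvg_shiftS _) /=.
pose C := ln (2 * (frob A + 2)).
apply: (@squeeze_cvgr _ _ _ _ (fun=> c) (fun k => c + (4 * (Num.sqrt (k.+1%:R : R))^-1 + C * harmonic k))).
- near=> k; have := hdist_pow_bounds k lA.
  rewrite (psl2_act_base _ _ erefl) -/c -/C; move: (hdist _ _) => d /andP[h1 h2].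
  have k0 : 0 < k.+1%:R :> R by rewrite ltr0n.
  rewrite ler_pdivlMr // ler_pdivrMr // mulrC h1 /=; apply: le_trans h2 _.
  rewrite -addrA [leRHS]mulrDl lerD //; first by rewrite mulrC.
  rewrite [leRHS]mulrDl lerD //.
    have -> : 4 / Num.sqrt k.+1%:R * k.+1%:R = 4 * Num.sqrt k.+1%:R :> R.
      rewrite -[X in _ * X](@sqr_sqrtr _ (k.+1%:R : R)) ?ltW //.
      by field; rewrite gt_eqF ?sqrtr_gt0.
    by have := ln_le_sqrt k; lra.
  by rewrite /harmonic /= -mulrA mulVf ?gt_eqF // mulr1.
- exact: cvg_cst.
- have h : c + (4 * (Num.sqrt (k.+1%:R : R))^-1 + C * harmonic k) @[k --> \oo]
      --> c + (4 * 0 + C * 0).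
    apply: cvgD; first exact: cvg_cst.
    apply: cvgD; apply: cvgMl_tmp; [exact: cvg_inv_sqrt|exact: cvg_harmonic].
  by move: h; rewrite !mulr0 !addr0.
Unshelve. all: by end_near. Qed.

End Spectrum.

Section TranslationLength.
Variable R : realType.
Implicit Types (z w l : R[i]) (A B : SL2 R) (p q : H3 R) (x y : PSL2 R).

Lemma psl2_actM x y p : psl2_act (x * y)%g p = psl2_act x (psl2_act y p).
Proof.
rewrite -(psl2_reprK x) -(psl2_reprK y) -psl2_ofM !psl2_act_of.
exact: moebius_mul.
Qed.

Lemma psl2_act1 p : psl2_act 1%g p = p.
Proof. by rewrite -[1%g]/(psl2_of (sl2_one R)) psl2_act_of moebius_one. Qed.

Lemma psl2_actK x p : psl2_act (x^-1)%g (psl2_act x p) = p.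
Proof. by rewrite -psl2_actM mulVg psl2_act1. Qed.

Lemma hdist_psl2 x p q : hdist (psl2_act x p) (psl2_act x q) = hdist p q.
Proof. by rewrite -(psl2_reprK x) !psl2_act_of hdist_moebius. Qed.

Lemma tl_ge0 x : 0 <= translation_length x.
Proof.
have [l lA] := top_eigenvalue_ex (psl2_repr x).
rewrite -(psl2_reprK x) (translation_lengthE lA) mulr_ge0 // ln_ge0 //.
by case: lA.
Qed.

Lemma tl_X x k : translation_length (x ^+ k)%g = k%:R * translation_length x.
Proof.
have [l lA] := top_eigenvalue_ex (psl2_repr x); have [l0 lt l1] := lA.
rewrite -(psl2_reprK x) -psl2_ofX (translation_lengthE lA).
have lAk : top_eigenvalue (psl2_repr x ^+ k)%g (l ^+ k).
  by split; rewrite ?expf_neq0 ?(trace_sl2X _ lA) ?exprVn ?normcX ?exprn_ege1.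
rewrite (translation_lengthE lAk) normcX lnXn ?(top_eigenvalue_gt0 lA) //.
by rewrite -(mulr_natl (ln _)) mulrCA.
Qed.

Lemma expR_tl A l : top_eigenvalue A l ->
  expR (translation_length (psl2_of A) / 2) = normc l.
Proof.
move=> lA; rewrite (translation_lengthE lA) mulrC mulKf ?pnatr_eq0 // lnK //.
by rewrite posrE (top_eigenvalue_gt0 lA).
Qed.

Lemma trace_le_tl A :
  normc (\tr (sl2_val A)) <= 2 * expR (translation_length (psl2_of A) / 2).
Proof.
have [l lA] := top_eigenvalue_ex A; rewrite (expR_tl lA); case: lA => l0 <- l1.
rewrite (le_trans (le_normcD _ _)) // mulr2n mulrDl mul1r lerD2l normcV.
by rewrite (le_trans _ l1) // invf_le1 // (lt_le_trans ltr01).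
Qed.

Lemma tl_le_hdist_base A :
  translation_length (psl2_of A) <= hdist (h3_base R) (moebius A (h3_base R)).
Proof.
have [l lA] := top_eigenvalue_ex A; rewrite (translation_lengthE lA).
by have /andP[] := hdist_pow_bounds 0 lA; rewrite mul1r expg1.
Qed.

Lemma tl_trace A B : \tr (sl2_val A) = \tr (sl2_val B) ->
  translation_length (psl2_of A) = translation_length (psl2_of B).
Proof.
move=> h; have [l lA] := top_eigenvalue_ex A.
have lB : top_eigenvalue B l by case: lA => *; split; rewrite -?h.
by rewrite (translation_lengthE lA) (translation_lengthE lB).
Qed.

Lemma sl2_valM A B : sl2_val (A * B)%g = sl2_val A *m sl2_val B.
Proof. by []. Qed.

Lemma tl_conj x y : translation_length (x ^ y)%g = translation_length x.
Proof.
have -> : (x ^ y)%g = psl2_of ((psl2_repr y)^-1 * (psl2_repr x * psl2_repr y))%g.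
  by rewrite conjgE !psl2_ofM psl2_ofV !psl2_reprK.
rewrite -{2}(psl2_reprK x); apply: tl_trace.
by rewrite sl2_valM mxtrace_mulC -sl2_valM mulgK.
Qed.

(** Conjugation moves p to the base point without changing the translation
    length. *)
Lemma tl_le_hdist x p : translation_length x <= hdist p (psl2_act x p).
Proof.
have [B ->] := transitive_base p.
rewrite -psl2_act_of -(tl_conj x (psl2_of B)) -(hdist_psl2 ((psl2_of B)^-1)%g).
have e : psl2_act ((psl2_of B)^-1)%g (psl2_act x (psl2_act (psl2_of B) (h3_base R)))
  = psl2_act (x ^ psl2_of B)%g (h3_base R) by rewrite conjgE !psl2_actM.
rewrite psl2_actK e -(psl2_reprK (_ ^ _)%g) psl2_act_of.
exact: tl_le_hdist_base.
Qed.

Lemma bernoulli (a : R) k : 0 <= a -> 1 + k%:R * (a - 1) <= a ^+ k.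
Proof.
move=> a0; elim: k => [|k IH]; first by rewrite mul0r addr0 expr0.
rewrite exprS -natr1; apply: le_trans (_ : a * (1 + k%:R * (a - 1)) <= _).
  rewrite -subr_ge0; set u := _ - _.
  have -> : u = k%:R * (a - 1) ^+ 2 by rewrite /u; ring.
  by rewrite mulr_ge0 ?sqr_ge0.
by rewrite ler_wpM2l.
Qed.

Lemma expr_bounded_le1 (a C : R) : 0 <= a -> (forall k, a ^+ k <= C) -> a <= 1.
Proof.
move=> a0 h; rewrite leNgt; apply/negP => a1.
have a10 : 0 < a - 1 by rewrite subr_gt0.
have := archi_boundP (_ : 0 <= `|C| / (a - 1)).
rewrite divr_ge0 ?(ltW a10) // => /(_ isT); set n := Num.bound _ => hn.
have := le_trans (bernoulli n a0) (h n); rewrite leNgt => /negP; apply.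
rewrite (le_lt_trans (ler_norm _)) // ltr_wpDl //.
by rewrite -ltr_pdivrMr.
Qed.

(** The trace of A^k is l^k + l^-k, so its growth determines |l|. *)
Lemma tl_of_growth A (C c : R) : 1 <= c ->
  (forall k, normc (\tr (sl2_val (A ^+ k)%g)) <= C * c ^+ k) ->
  translation_length (psl2_of A) <= 2 * ln c.
Proof.
move=> c1 h; have c0 : 0 < c := lt_le_trans ltr01 c1.
have [l lA] := top_eigenvalue_ex A; have [l0 lt l1] := lA.
have r0 := top_eigenvalue_gt0 lA.
rewrite (translation_lengthE lA) ler_pM2l // ler_ln ?posrE //.
suff : normc l / c <= 1 by rewrite ler_pdivrMr // mul1r.
apply: (@expr_bounded_le1 _ (C + 1)); first by rewrite divr_ge0 ?ltW.
move=> k; rewrite expr_div_n ler_pdivrMr ?exprn_gt0 // mulrDl mul1r.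
rewrite -lerBlDr; apply: le_trans (h k); rewrite (trace_sl2X _ lA) lerBlDr.
have -> : normc l ^+ k = normc ((l ^+ k + l^-1 ^+ k) - l^-1 ^+ k) by rewrite addrK normcX.
rewrite (le_trans (ler_normcB _ _)) // lerD2l normcX normcV.
apply: le_trans (_ : 1 <= _); last exact: exprn_ege1.
by rewrite exprn_ile1 // ?invr_ge0 ?invf_le1 // ltW.
Qed.

End TranslationLength.

(** * Growth of products of two by two matrices *)

Section Clifford.
Variable R : realType.
Local Notation C := R[i].
Local Notation vec := (C * C * C)%type.

(** The traceless matrix with the given entries, so that vec stands for the
    three-dimensional space of traceless matrices. *)
Definition tless (v : vec) : 'M[C]_2 := mx2 v.1.1 v.1.2 v.2 (- v.1.1).

(** The bilinear form tr (X Y) on traceless matrices. *)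
Definition trform (v w : vec) : C :=
  2 * (v.1.1 * w.1.1) + v.1.2 * w.2 + v.2 * w.1.2.

Definition det3 (u v w : vec) : C :=
  u.1.1 * (v.1.2 * w.2 - v.2 * w.1.2) - u.1.2 * (v.1.1 * w.2 - v.2 * w.1.1)
  + u.2 * (v.1.1 * w.1.2 - v.1.2 * w.1.1).

Definition lin3 (c : vec) (u v w : vec) : vec :=
  (c.1.1 * u.1.1 + c.1.2 * v.1.1 + c.2 * w.1.1,
   c.1.1 * u.1.2 + c.1.2 * v.1.2 + c.2 * w.1.2,
   c.1.1 * u.2 + c.1.2 * v.2 + c.2 * w.2).

Lemma cramer3 (x u v w : vec) : det3 u v w != 0 ->
  x = lin3 (det3 x v w / det3 u v w, det3 u x w / det3 u v w,
            det3 u v x / det3 u v w) u v w.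
Proof.
case: x u v w => [[x1 x2] x3] [[u1 u2] u3] [[v1 v2] v3] [[w1 w2] w3].
rewrite /lin3 /det3 /= => d0.
by congr (_, _, _); field.
Qed.

(** Three vectors of T of maximal determinant: by Cramer's rule the coordinates
    of any other vector of T are quotients of determinants by the maximal one. *)
Lemma bounded_basis_nondeg (T : seq vec) (u0 v0 w0 : vec) :
  u0 \in T -> v0 \in T -> w0 \in T -> det3 u0 v0 w0 != 0 ->
  exists u v w, [/\ u \in T, v \in T, w \in T & forall x, x \in T -> exists c,
    [/\ normc c.1.1 <= 1, normc c.1.2 <= 1, normc c.2 <= 1 &
      x = lin3 c u v w]].
Proof.
move=> uT vT wT d0; pose n := size T.
pose I := ('I_n * 'I_n * 'I_n)%type; pose e (i : 'I_n) := nth 0 T i.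
have iT x (xT : x \in T) : (index x T < n)%N by rewrite index_mem.
pose i0 : I := (Ordinal (iT _ uT), Ordinal (iT _ vT), Ordinal (iT _ wT)).
pose F (i : I) : R := normc (det3 (e i.1.1) (e i.1.2) (e i.2)).
have [i _ imax] := @Order.TotalTheory.arg_maxP _ _ _ i0 xpredT F isT.
have F0 : 0 < F i.
  apply: lt_le_trans (imax i0 isT); rewrite /F /e /= !nth_index //.
  by rewrite lt_def normc_eq0 d0 normc_ge0.
exists (e i.1.1), (e i.1.2), (e i.2); split; rewrite ?mem_nth // => x xT.
have D0 : det3 (e i.1.1) (e i.1.2) (e i.2) != 0 by rewrite -normc_eq0 gt_eqF.
have hx j : F j <= F i by apply: imax.
have xE : e (Ordinal (iT _ xT)) = x by rewrite /e /= nth_index.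
have h d : normc d <= F i -> normc (d / det3 (e i.1.1) (e i.1.2) (e i.2)) <= 1.
  by move=> hd; rewrite normcM normcV ler_pdivrMr ?mul1r.
eexists; split; last exact: cramer3 D0.
- by apply: h; have := hx (Ordinal (iT _ xT), i.1.2, i.2); rewrite /F /= xE.
- by apply: h; have := hx (i.1.1, Ordinal (iT _ xT), i.2); rewrite /F /= xE.
- by apply: h; have := hx (i.1.1, i.1.2, Ordinal (iT _ xT)); rewrite /F /= xE.
Qed.

Lemma bounded_seq (T : seq vec) : exists2 B : R, 1 <= B &
  forall x, x \in T ->
    [/\ normc x.1.1 <= B, normc x.1.2 <= B & normc x.2 <= B].
Proof.
elim: T => [|y T [B B1 hB]]; first by exists 1.
exists (B + (normc y.1.1 + normc y.1.2 + normc y.2)).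
  by rewrite (le_trans B1) // lerDl !addr_ge0 ?normc_ge0.
have [y1 y2 y3] := And3 (normc_ge0 y.1.1) (normc_ge0 y.1.2) (normc_ge0 y.2).
move=> x; rewrite inE => /orP[/eqP->|/hB[h1 h2 h3]]; split; lra.
Qed.

(** The vectors of T may be linearly dependent. Adding to T small multiples of
    the standard basis makes some determinant nonzero, and keeps the form
    bounded if the factor is the inverse of a bound for the entries of T. *)
Lemma bounded_basis (T : seq vec) :
  (forall x y, x \in T -> y \in T -> normc (trform x y) <= 4) ->
  exists u v w : vec,
    (forall x y, x \in [:: u; v; w] -> y \in [:: u; v; w] ->
       normc (trform x y) <= 4) /\
    forall x, x \in T -> exists c,
    [/\ normc c.1.1 <= 1, normc c.1.2 <= 1, normc c.2 <= 1 &
      x = lin3 c u v w].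
Proof.
move=> hT; have [B B1 hB] := bounded_seq T.
have B0 : 0 < B := lt_le_trans ltr01 B1.
have [e ne] : exists e : C, normc e = B^-1.
  by exists (B^-1%:C); rewrite /= expr0n addr0 sqrtr_sqr ger0_norm // invr_ge0 ltW.
have e0 : e != 0 by rewrite -normc_eq0 ne invr_eq0 gt_eqF.
have e1 : normc e <= 1 by rewrite ne invf_le1.
pose e1' : vec := (e, 0, 0); pose e2' : vec := (0, e, 0).
pose e3' : vec := (0, 0, e).
pose T' := [:: e1', e2', e3' & T].
have d0 : det3 e1' e2' e3' != 0.
  have -> : det3 e1' e2' e3' = e ^+ 3 by rewrite /det3 /=; ring.
  by rewrite expf_neq0.
have symf x y : trform x y = trform y x by rewrite /trform; ring.
have n2 : normc (2 : C) = 2 by rewrite normc_nat.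
have bE x y : normc x <= B -> normc (y * x * e) <= normc y.
  move=> hx; rewrite !normcM ne -mulrA ler_piMr ?normc_ge0 //.
  by rewrite ler_pdivrMr ?mul1r.
have hE x k : x \in T -> k \in [:: e1'; e2'; e3'] -> normc (trform x k) <= 4.
  move=> /hB[h1 h2 h3]; rewrite !inE => /or3P[]/eqP->; rewrite /trform /=.
  - have -> : 2 * (x.1.1 * e) + x.1.2 * 0 + x.2 * 0 = 2 * x.1.1 * e by ring.
    by rewrite (le_trans (bE _ _ h1)) // n2 ler_nat.
  - have -> : 2 * (x.1.1 * 0) + x.1.2 * 0 + x.2 * e = 1 * x.2 * e by ring.
    by rewrite (le_trans (bE _ _ h3)) // normc1 (ler_nat _ 1 4).
  - have -> : 2 * (x.1.1 * 0) + x.1.2 * e + x.2 * 0 = 1 * x.1.2 * e by ring.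
    by rewrite (le_trans (bE _ _ h2)) // normc1 (ler_nat _ 1 4).
have eB : normc e <= B by rewrite (le_trans e1).
have hEE x y : x \in [:: e1'; e2'; e3'] -> y \in [:: e1'; e2'; e3'] ->
    normc (trform x y) <= 4.
  have h0 : normc (0 : C) <= 4 by rewrite normc0.
  have he : normc (e * e) <= 4.
    rewrite -[e * e]mul1r mulrA (le_trans (bE _ _ eB)) // normc1.
    by rewrite (ler_nat _ 1 4).
  have he2 : normc (2 * (e * e)) <= 4.
    by rewrite mulrA (le_trans (bE _ _ eB)) // n2 ler_nat.
  rewrite !inE => /or3P[]/eqP-> /or3P[]/eqP->;
    by rewrite /trform /= !(mulr0, mul0r, add0r, addr0).
have hT' x y : x \in T' -> y \in T' -> normc (trform x y) <= 4.
  have split x' : x' \in T' -> x' \in [:: e1'; e2'; e3'] \/ x' \in T.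
    by rewrite -[T']/([:: e1'; e2'; e3'] ++ T) mem_cat => /orP.
  move=> /split[hx|hx] /split[hy|hy]; [exact: hEE| |exact: hE|exact: hT].
  by rewrite symf; exact: hE.
have m1 : e1' \in T' by rewrite !inE eqxx.
have m2 : e2' \in T' by rewrite !inE eqxx ?orbT.
have m3 : e3' \in T' by rewrite !inE eqxx ?orbT.
have [u [v [w [uT vT wT h]]]] := bounded_basis_nondeg m1 m2 m3 d0.
exists u, v, w; split=> [x y|x xT]; last by apply: h; rewrite !inE xT !orbT.
have sub x' : x' \in [:: u; v; w] -> x' \in T'.
  by rewrite in_cons mem_seq2 => /or3P[]/eqP->.
by move=> /sub hx /sub hy; exact: hT'.
Qed.

Lemma tless_sq u : tless u *m tless u = (trform u u / 2)%:M.
Proof. by apply: mx2P; rewrite mulmx2 !mxE /= /trform; field. Qed.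

Lemma tless_anti u v :
  tless v *m tless u = (trform u v)%:M - tless u *m tless v.
Proof.
by apply: mx2P; rewrite !(mulmx2, mxE) /= ?(mulmx2, mxE) /= /trform; ring.
Qed.

(** The eight ordered monomials in U, V and W span the algebra that these
    generate when they anticommute up to scalars; k bounds the coefficients. *)
Definition cliff (U V W : 'M[C]_2) (k : R) (X : 'M[C]_2) :=
  exists a : C * C * C * C * (C * C * C * C),
  let: (a0, a1, a2, a3, (b1, b2, b3, b0)) := a in
  normc a0 + normc a1 + normc a2 + normc a3 +
    (normc b1 + normc b2 + normc b3 + normc b0) <= k /\
  X = a0%:M + a1 *: U + a2 *: V + a3 *: W +
    (b1 *: (U *m V) + b2 *: (U *m W) +
     b3 *: (V *m W) + b0 *: (U *m V *m W)).

Lemma le_normcM_bound (m : R) (q a : C) :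
  normc q <= m -> normc (q * a) <= m * normc a.
Proof. by move=> h; rewrite normcM ler_wpM2r ?normc_ge0. Qed.

Section Multiplication.
Variables (U V W : 'M[C]_2).

(** In the next three lemmas the new factor is moved to its place in the ordered
    monomials. Every exchange costs a scalar of modulus at most 4, and a square
    one of modulus at most 2, so the coefficients grow at most by 10. *)
Lemma cliff_mul1 p k X : U *m U = p%:M -> normc p <= 2 ->
  cliff U V W k X -> cliff U V W (10 * k) (U *m X).
Proof.
move=> uu hp [[[[[a0 a1] a2] a3] [[[b1 b2] b3] b0]] [ha ->]].
exists (p * a1, a0, p * b1, p * b2, (a2, a3, p * b0, b3)); split.
  move: ha; have := le_normcM_bound a1 hp; have := le_normcM_bound b1 hp.
  have := le_normcM_bound b2 hp; have := le_normcM_bound b0 hp.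
  have := normc_ge0 a0; have := normc_ge0 a1; have := normc_ge0 a2.
  have := normc_ge0 a3; have := normc_ge0 b1; have := normc_ge0 b2.
  have := normc_ge0 b3; have := normc_ge0 b0; lra.
rewrite !mulmxDr -!scalemxAr !mulmxA uu !mul_scalar_mx mul_mx_scalar -scalemxAl.
move: (U *m V *m W) (U *m V) (U *m W) (V *m W) => m0 m1 m2 m3.
by apply/matrixP => i j; rewrite !mxE; ring.
Qed.

Lemma cliff_mul2 p q k X : V *m V = p%:M -> V *m U = q%:M - U *m V ->
  normc p <= 2 -> normc q <= 4 ->
  cliff U V W k X -> cliff U V W (10 * k) (V *m X).
Proof.
move=> vv vu hp hq [[[[[a0 a1] a2] a3] [[[b1 b2] b3] b0]] [ha ->]].
exists (q * a1 + p * a2, - (p * b1), a0 + q * b1, q * b2 + p * b3,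
  (- a1, - (p * b0), a3 + q * b0, - b2)); split.
  move: ha; have := le_normcM_bound a2 hp; have := le_normcM_bound b1 hp.
  have := le_normcM_bound b3 hp; have := le_normcM_bound b0 hp.
  have := le_normcM_bound a1 hq; have := le_normcM_bound b1 hq.
  have := le_normcM_bound b2 hq; have := le_normcM_bound b0 hq; rewrite !normcN.
  have := le_normcD (q * a1) (p * a2); have := le_normcD a0 (q * b1).
  have := le_normcD (q * b2) (p * b3); have := le_normcD a3 (q * b0).
  have := normc_ge0 a0; have := normc_ge0 a1; have := normc_ge0 a2.
  have := normc_ge0 a3; have := normc_ge0 b1; have := normc_ge0 b2.
  have := normc_ge0 b3; have := normc_ge0 b0; lra.
rewrite !mulmxDr -!scalemxAr !mulmxA vu !mulmxBl -(mulmxA _ _ V) vv.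
rewrite !mul_scalar_mx !mul_mx_scalar -!scalemxAl.
move: (U *m V *m W) (U *m V) (U *m W) (V *m W) => m0 m1 m2 m3.
by apply/matrixP => i j; rewrite !mxE; ring.
Qed.

Lemma cliff_mul3 p q r k X : W *m W = p%:M -> W *m U = q%:M - U *m W ->
  W *m V = r%:M - V *m W -> normc p <= 2 -> normc q <= 4 -> normc r <= 4 ->
  cliff U V W k X -> cliff U V W (10 * k) (W *m X).
Proof.
move=> ww wu wv hp hq hr [[[[[a0 a1] a2] a3] [[[b1 b2] b3] b0]] [ha ->]].
exists (q * a1 + r * a2 + p * a3, - (r * b1) - p * b2, q * b1 - p * b3,
  a0 + q * b2 + r * b3, (p * b0, - a1 - r * b0, - a2 + q * b0, b1)); split.
  move: ha; have := le_normcM_bound a3 hp; have := le_normcM_bound b2 hp.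
  have := le_normcM_bound b3 hp; have := le_normcM_bound b0 hp.
  have := le_normcM_bound a1 hq; have := le_normcM_bound b1 hq.
  have := le_normcM_bound b2 hq; have := le_normcM_bound b0 hq.
  have := le_normcM_bound a2 hr; have := le_normcM_bound b1 hr.
  have := le_normcM_bound b3 hr; have := le_normcM_bound b0 hr.
  have := le_normcD (q * a1 + r * a2) (p * a3).
  have := le_normcD (q * a1) (r * a2).
  have := le_normcD (- (r * b1)) (- (p * b2)).
  have := le_normcD (q * b1) (- (p * b3)).
  have := le_normcD (a0 + q * b2) (r * b3).
  have := le_normcD a0 (q * b2).
  have := le_normcD (- a1) (- (r * b0)); have := le_normcD (- a2) (q * b0).
  rewrite !normcN.
  have := normc_ge0 a0; have := normc_ge0 a1; have := normc_ge0 a2.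
  have := normc_ge0 a3; have := normc_ge0 b1; have := normc_ge0 b2.
  have := normc_ge0 b3; have := normc_ge0 b0; lra.
have wuv : W *m U *m V = q *: V - r *: U + U *m V *m W.
  rewrite wu mulmxBl mul_scalar_mx -(mulmxA U W V) wv mulmxBr mul_mx_scalar.
  by rewrite opprB addrA mulmxA addrAC.
have wuw : W *m U *m W = q *: W - p *: U.
  by rewrite wu mulmxBl mul_scalar_mx -(mulmxA U W W) ww mul_mx_scalar.
have wvw : W *m V *m W = r *: W - p *: V.
  by rewrite wv mulmxBl mul_scalar_mx -(mulmxA V W W) ww mul_mx_scalar.
rewrite !mulmxDr -!scalemxAr !mulmxA wuv wuw wvw ww wu wv.
rewrite !mulmxDl mulNmx -!scalemxAl -(mulmxA (U *m V)) ww !mul_mx_scalar.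
move: (U *m V *m W) (U *m V) (U *m W) (V *m W) => m0 m1 m2 m3.
by apply/matrixP => i j; rewrite !mxE; ring.
Qed.

Lemma cliffD k l X Y : cliff U V W k X -> cliff U V W l Y ->
  cliff U V W (k + l) (X + Y).
Proof.
move=> [[[[[a0 a1] a2] a3] [[[b1 b2] b3] b0]] [ha ->]].
move=> [[[[[c0 c1] c2] c3] [[[d1 d2] d3] d0]] [hc ->]].
exists (a0 + c0, a1 + c1, a2 + c2, a3 + c3,
  (b1 + d1, b2 + d2, b3 + d3, b0 + d0)); split.
  have := le_normcD a0 c0; have := le_normcD a1 c1; have := le_normcD a2 c2.
  have := le_normcD a3 c3; have := le_normcD b1 d1; have := le_normcD b2 d2.
  have := le_normcD b3 d3; have := le_normcD b0 d0; lra.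
move: (U *m V *m W) (U *m V) (U *m W) (V *m W) => m0 m1 m2 m3.
by apply/matrixP => i j; rewrite !mxE; ring.
Qed.

Lemma cliffZ c k X : normc c <= 1 -> cliff U V W k X -> cliff U V W k (c *: X).
Proof.
move=> hn [[[[[a0 a1] a2] a3] [[[b1 b2] b3] b0]] [ha ->]].
exists (c * a0, c * a1, c * a2, c * a3, (c * b1, c * b2, c * b3, c * b0)); split.
  have := le_normcM_bound a0 hn; have := le_normcM_bound a1 hn.
  have := le_normcM_bound a2 hn; have := le_normcM_bound a3 hn.
  have := le_normcM_bound b1 hn; have := le_normcM_bound b2 hn.
  have := le_normcM_bound b3 hn; have := le_normcM_bound b0 hn; lra.
move: (U *m V *m W) (U *m V) (U *m W) (V *m W) => m0 m1 m2 m3.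
by apply/matrixP => i j; rewrite !mxE; ring.
Qed.

Lemma cliff1 : cliff U V W 1 1%:M.
Proof.
exists (1, 0, 0, 0, (0, 0, 0, 0)); split; first by rewrite normc1 normc0 !addr0.
by rewrite !scale0r !addr0.
Qed.

End Multiplication.

End Clifford.

Section WordGrowth.
Variable R : realType.
Local Notation C := R[i].
Local Notation vec := (C * C * C)%type.

Lemma cliff_trace (U V W : 'M[C]_2) : exists m : R, forall k X, cliff U V W k X ->
  normc (\tr X) <= m * k.
Proof.
pose m := (2 + normc (\tr U) + normc (\tr V) + normc (\tr W) + (normc (\tr (U *m V)) +
  normc (\tr (U *m W)) + normc (\tr (V *m W)) + normc (\tr (U *m V *m W)))).
exists m => k X [[[[[a0 a1] a2] a3] [[[b1 b2] b3] b0]] [ha ->]].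
rewrite !mxtraceD !mxtraceZ mxtrace_scalar -mulr_natr.
have h (a t : C) : normc t <= m -> normc (a * t) <= m * normc a.
  by move=> ht; rewrite mulrC le_normcM_bound.
have t0 : normc (2 : C) <= m /\ [/\ normc (\tr U) <= m, normc (\tr V) <= m, normc (\tr W) <= m &
  [/\ normc (\tr (U *m V)) <= m, normc (\tr (U *m W)) <= m, normc (\tr (V *m W)) <= m &
   normc (\tr (U *m V *m W)) <= m]].
  rewrite /m normc_nat.
  have := normc_ge0 (\tr U); have := normc_ge0 (\tr V); have := normc_ge0 (\tr W).
  have := normc_ge0 (\tr (U *m V)); have := normc_ge0 (\tr (U *m W)).
  have := normc_ge0 (\tr (V *m W)); have := normc_ge0 (\tr (U *m V *m W)).
  move: (normc (\tr U)) (normc (\tr V)) (normc (\tr W)) (normc (\tr (U *m V)))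
    (normc (\tr (U *m W))) (normc (\tr (V *m W))) (normc (\tr (U *m V *m W))).
  by move=> *; split; [|split; [| | |split]]; lra.
have [t00 [t1 t2 t3 [t4 t5 t6 t7]]] := t0; have {t0} m0 : 0 <= m.
  exact: le_trans (normc_ge0 _) t1.
have := h a0 _ t00; have := h a1 _ t1; have := h a2 _ t2; have := h a3 _ t3.
have := h b1 _ t4; have := h b2 _ t5; have := h b3 _ t6; have := h b0 _ t7.
have := ler_wpM2l m0 ha; rewrite [X in X <= _ -> _]mulrDr.
rewrite ![X in X + _ <= _ -> _]mulrDr ![X in _ + X <= _ -> _]mulrDr.
move: (\tr U) (\tr V) (\tr W) (\tr (U *m V)) (\tr (U *m W)) (\tr (V *m W))
  (\tr (U *m V *m W)) => s1 s2 s3 s4 s5 s6 s7.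
have := le_normcD (a0 * 2 + a1 * s1 + a2 * s2 + a3 * s3) (b1 * s4 + b2 * s5 + b3 * s6 + b0 * s7).
have := le_normcD (a0 * 2 + a1 * s1 + a2 * s2) (a3 * s3).
have := le_normcD (a0 * 2 + a1 * s1) (a2 * s2).
have := le_normcD (a0 * 2) (a1 * s1).
have := le_normcD (b1 * s4 + b2 * s5 + b3 * s6) (b0 * s7).
have := le_normcD (b1 * s4 + b2 * s5) (b3 * s6).
have := le_normcD (b1 * s4) (b2 * s5).
lra.
Qed.

Lemma normc_half : normc (2^-1 : C) = 2^-1.
Proof. by rewrite normcV normc_nat. Qed.

(** Each letter is x = (tr x / 2) 1 + x0 with x0 traceless, hence a combination
    with coefficients of modulus at most 1 of 1 and three traceless matrices
    u, v, w. These satisfy u v + v u = tr (u v) 1, so that words in them reduce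
    to eight monomials, and each letter contributes a factor 1 + 3 * 10. *)
Lemma trace_word_growth (s : seq 'M[C]_2) :
  (forall X, X \in s -> normc (\tr X) <= 2) ->
  (forall X Y, X \in s -> Y \in s -> normc (\tr (X *m Y)) <= 2) ->
  exists m : R, forall t : seq 'M[C]_2, {subset t <= s} ->
    normc (\tr (foldr mulmx 1%:M t)) <= m * 31 ^+ size t.
Proof.
move=> h1 h2.
pose red (X : 'M[C]_2) : vec := ((X 0 0 - X 1 1) / 2, X 0 1, X 1 0).
have redE X : X = (\tr X / 2)%:M + tless (red X).
  by apply: mx2P; rewrite !mxE /= trace2; field.
have tfE X Y : trform (red X) (red Y) = \tr (X *m Y) - \tr X * \tr Y / 2.
  by rewrite /trform /= !trace2 !mulmx2; field.
have T4 x y : x \in map red s -> y \in map red s -> normc (trform x y) <= 4.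
  move=> /mapP[X Xs ->] /mapP[Y Ys ->]; rewrite tfE.
  rewrite (le_trans (ler_normcB _ _)) // !normcM normc_half.
  have := h2 _ _ Xs Ys; have := ler_pM (normc_ge0 _) (normc_ge0 _) (h1 _ Xs) (h1 _ Ys).
  lra.
have [u [v [w [uvw hc]]]] := bounded_basis T4.
have [U V W] := And3 (tless_sq u) (tless_sq v) (tless_sq w).
have [vu wu wv] := And3 (tless_anti u v) (tless_anti u w) (tless_anti v w).
have half (x : vec) : normc (trform x x) <= 4 -> normc (trform x x / 2) <= 2.
  by rewrite normcM normc_half; lra.
have [uu vv ww] : [/\ normc (trform u u) <= 4, normc (trform v v) <= 4
    & normc (trform w w) <= 4].
  by split; apply: uvw; rewrite !inE eqxx ?orbT.
have [quv quw qvw] : [/\ normc (trform u v) <= 4, normc (trform u w) <= 4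
    & normc (trform v w) <= 4].
  by split; apply: uvw; rewrite !inE eqxx ?orbT.
have [m hm] := cliff_trace (tless u) (tless v) (tless w).
exists m => t ts; apply: hm; elim: t ts => [|X t IH] ts /=; first exact: cliff1.
have {}IH : cliff (tless u) (tless v) (tless w) (31 ^+ size t) (foldr mulmx 1%:M t).
  by apply: IH => Y Yt; apply: ts; rewrite inE Yt orbT.
have Xs : X \in s by apply: ts; rewrite inE eqxx.
have [|c [c1 c2 c3 cE]] := hc (red X); first by rewrite map_f.
have lin : tless (red X) = c.1.1 *: tless u + c.1.2 *: tless v + c.2 *: tless w.
  by rewrite cE; apply: mx2P; rewrite !mxE /=; ring.
rewrite (redE X) lin; set P := foldr _ _ _ in IH *; set k := 31 ^+ size t in IH *.
rewrite !mulmxDl mul_scalar_mx -!scalemxAl exprS -/k.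
have -> : 31 * k = k + (10 * k + 10 * k + 10 * k) by ring.
apply: cliffD; first by apply: cliffZ => //; rewrite normcM normc_half ler_pdivrMr // mul1r h1.
apply: cliffD; first apply: cliffD; apply: cliffZ => //.
- exact: cliff_mul1 U (half _ uu) IH.
- exact: cliff_mul2 V vu (half _ vv) quv IH.
- exact: cliff_mul3 W wu wv (half _ ww) quw qvw IH.
Qed.

Section ProductTranslation.

Definition prodg (G : groupType) (s : seq G) : G := foldr (fun u v => (u * v)%g) 1%g s.

Lemma prodg_cat (G : groupType) (s t : seq G) :
  prodg (s ++ t) = (prodg s * prodg t)%g.
Proof. by elim: s => [|u s IH] /=; rewrite ?mul1g // IH mulgA. Qed.

(** After division of the letters by e^(M / 2) their traces are at most 2, and
    so are the traces of products of two. The growth estimate is applied to the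
    powers of the product, which are again words in these letters. *)
Lemma tl_prod_bound (s : seq (SL2 R)) (M : R) : 0 <= M ->
  (forall u, u \in s -> translation_length (psl2_of u) <= M) ->
  (forall u v, u \in s -> v \in s ->
     translation_length (psl2_of (u * v)%g) <= 2 * M) ->
  translation_length (psl2_of (prodg s)) <=
  (size s)%:R * (M + 2 * ln 31).
Proof.
move=> M0 h1 h2; pose L : R := expR (M / 2).
have L0 : 0 < L := expR_gt0 _.
have L1 : 1 <= L by rewrite -expR0 ler_expR divr_ge0.
have L2 : L ^+ 2 = expR M by rewrite /L -expRM_natl; congr expR; field.
pose e : C := (L^-1)%:C.
have ne : normc e = L^-1.
  by rewrite /e /= expr0n addr0 sqrtr_sqr ger0_norm // invr_ge0 ltW.
pose sc (u : SL2 R) : 'M[C]_2 := e *: sl2_val u.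
have trsc u : \tr (sc u) = e * \tr (sl2_val u) by rewrite mxtraceZ.
have [||m hm] := @trace_word_growth (map sc s).
- move=> X /mapP[u us ->]; rewrite trsc normcM ne ler_pdivrMl // mulrC.
  apply: le_trans (trace_le_tl _) _; rewrite ler_pM2l // ler_expR.
  by rewrite ler_pM2r ?invr_gt0 // h1.
- move=> X Y /mapP[u us ->] /mapP[v vs ->].
  rewrite -scalemxAl -scalemxAr scalerA mxtraceZ !normcM ne -invfM -expr2.
  rewrite ler_pdivrMl ?exprn_gt0 // mulrC L2 -sl2_valM.
  apply: le_trans (trace_le_tl _) _; rewrite ler_pM2l // ler_expR.
  by have := h2 _ _ us vs; lra.
set P := prodg s; pose n := size s.
have cn1 : 1 <= (31 * L) ^+ n by rewrite exprn_ege1 // mulr_ege1 // ler1n.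
have fE t : foldr mulmx 1%:M (map sc t) =
    e ^+ size t *: sl2_val (prodg t).
  elim: t => [|u t IH] /=; first by rewrite expr0 scale1r.
  by rewrite IH -scalemxAl -scalemxAr scalerA -exprS.
have PX k : (P ^+ k)%g = prodg (flatten (nseq k s)).
  by elim: k => [|k IH]; rewrite ?expg0 // expgS IH /= prodg_cat.
have sz k : size (flatten (nseq k s)) = (n * k)%N.
  by rewrite size_flatten /shape map_nseq sumn_nseq.
have -> : n%:R * (M + 2 * ln 31) = 2 * ln ((31 * L) ^+ n) :> R.
  by rewrite lnXn ?mulr_gt0 // lnM ?posrE // expRK -mulr_natl; field.
apply: (@tl_of_growth _ _ m) => // k.
have := hm (map sc (flatten (nseq k s))).
rewrite fE -PX sz size_map sz mxtraceZ normcM normcX ne => h.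
rewrite -exprM exprMn mulrA -ler_pdivrMr ?exprn_gt0 // mulrC -exprVn.
by apply: h => X /mapP[u /flattenP[t]]; rewrite mem_nseq => /andP[_ /eqP->] us ->;
  rewrite map_f.
Qed.

End ProductTranslation.

End WordGrowth.

(** * Boundary points and the axis of a loxodromic element *)

Section Boundary.
Variable R : realType.
Implicit Types (z w l : R[i]) (A B : SL2 R) (p q : H3 R).

(** The image of infinity under A. *)
Definition bdpt A : bdH3 R :=
  if sl2_val A 1 0 == 0 then None else Some (sl2_val A 0 0 / sl2_val A 1 0).

Definition hsize (w : R[i] * R) : R := sqmod w.1 + w.2 ^+ 2.

Lemma sqmodM z w : sqmod (z * w) = sqmod z * sqmod w.
Proof. by rewrite !sqmod_normc normcM exprMn. Qed.

Lemma sqmodV z : sqmod z^-1 = (sqmod z)^-1.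
Proof. by rewrite !sqmod_normc normcV exprVn. Qed.

Lemma sqmodJ z : sqmod z^c = sqmod z.
Proof. by case: z => x y; rewrite /sqmod /= sqrrN. Qed.

Lemma sqmodR (x : R) : sqmod x%:C = x ^+ 2.
Proof. by rewrite /sqmod /= expr0n addr0. Qed.

Lemma sqmodD_le z w : sqmod (z + w) <= 2 * (sqmod z + sqmod w).
Proof. by rewrite !sqmod_normc normcD_sqr. Qed.

Lemma sqmod_gt0 z : (0 < sqmod z) = (z != 0).
Proof.
rewrite lt_def sqmod_ge0 andbT; congr (~~ _).
by apply/eqP/eqP => [/sqmod_eq0|->]; rewrite // /sqmod /= expr0n addr0.
Qed.

Lemma moebius_den_lower A q :
  sqmod (sl2_val A 1 0) * hsize q / 2 - sqmod (sl2_val A 1 1) <= moebius_den A q.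
Proof.
rewrite /moebius_den /hsize; set c := sl2_val A 1 0; set d := sl2_val A 1 1.
have := sqmodD_le (c * q.1 + d) (- d); rewrite addrK sqmodN sqmodM.
have := mulr_ge0 (sqmod_ge0 c) (sqr_ge0 q.2); lra.
Qed.

(** Let N = |c z + d|^2 + |c|^2 t^2 be the denominator in the action of A on
    q = (z, t). Then a / c - (A q).1 = (c z + d)^c / (c N) and (A q).2 = t / N,
    where |c z + d|^2 and |c|^2 t^2 are at most N. *)
Lemma moebius_far A q : sl2_val A 1 0 != 0 ->
  sqmod (sl2_val A 0 0 / sl2_val A 1 0 - (moebius A q).1) <=
    (sqmod (sl2_val A 1 0) * moebius_den A q)^-1 /\
  (moebius A q).2 ^+ 2 <= (sqmod (sl2_val A 1 0) * moebius_den A q)^-1.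
Proof.
move=> c0; have N0 := moebius_den_gt0 A q.
have NE : moebius_den A q = sqmod (sl2_val A 1 0 * q.1 + sl2_val A 1 1) +
  sqmod (sl2_val A 1 0) * q.2 ^+ 2 by [].
have sc : 0 < sqmod (sl2_val A 1 0) by rewrite sqmod_gt0.
have d := sl2_det1 A; rewrite det2 in d.
have -> : sl2_val A 0 0 / sl2_val A 1 0 - (moebius A q).1 =
   (sl2_val A 1 0 * q.1 + sl2_val A 1 1)^c / (sl2_val A 1 0 * (moebius_den A q)%:C).
  rewrite /= /moebius_fun /=; have := congr1 (real_complex R) NE.
  have : (moebius_den A q)%:C != 0 :> R[i].
    by rewrite (inj_eq (@complexI R) _ 0) gt_eqF.
  move: (moebius_den A q) => N hN; rewrite RC_D RC_M RC_X !sqmodE => hNE.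
  have b : sl2_val A 0 0 * q.1 + sl2_val A 0 1 = (sl2_val A 0 0 *
    (sl2_val A 1 0 * q.1 + sl2_val A 1 1) - 1) / sl2_val A 1 0.
    by apply: (mulIf c0); rewrite divfK // -d; ring.
  rewrite b; set w := _ + sl2_val A 1 1 in hNE *.
  apply: (mulIf c0); apply: (mulIf hN); rewrite mulrBl.
  rewrite divfK // mulrAC [X in _ = X]mulrAC.
  have -> : w^c / (sl2_val A 1 0 * N%:C) * N%:C * sl2_val A 1 0 = w^c.
    by field; rewrite c0 hN.
  rewrite mulrBl; set Y := (X in (_ - X) = _).
  have -> : Y = (sl2_val A 0 0 * w - 1) * w^c + sl2_val A 0 0 * (sl2_val A 1 0 * (sl2_val A 1 0)^c * q.2%:C ^+ 2).
    by rewrite /Y; field; rewrite c0 hN.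
  by rewrite hNE; ring.
have sN : sqmod (sl2_val A 1 0 * q.1 + sl2_val A 1 1) <= moebius_den A q.
  by rewrite NE lerDl mulr_ge0 ?sqmod_ge0 ?sqr_ge0.
have tN : sqmod (sl2_val A 1 0) * q.2 ^+ 2 <= moebius_den A q.
  by rewrite NE lerDr sqmod_ge0.
split.
  rewrite sqmodM sqmodV sqmodM sqmodJ sqmodR ler_pdivrMr ?mulr_gt0 ?exprn_gt0 //.
  apply: le_trans sN _; rewrite invfM; set s := sqmod _ in sc *; set N := moebius_den _ _ in N0 *.
  have -> : s^-1 / N * (s * N ^+ 2) = N by field; rewrite !gt_eqF.
  by [].
rewrite /= /moebius_fun /= expr_div_n ler_pdivrMr ?exprn_gt0 //.
set s := sqmod _ in sc tN *; set N := moebius_den _ _ in N0 tN *.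
have -> : (s * N)^-1 * N ^+ 2 = s^-1 * N by field; rewrite !gt_eqF.
by rewrite ler_pdivlMl.
Qed.

(** An upper triangular matrix acts on C x R by an affine map, hence preserves
    divergence to infinity. *)
Lemma moebius_size A q : sl2_val A 1 0 = 0 ->
  (hsize q / sqmod (sl2_val A 1 1) / 2 - sqmod (sl2_val A 0 1)) / sqmod (sl2_val A 1 1)
    <= hsize (moebius A q).
Proof.
move=> c0; have d := sl2_det1 A; rewrite det2 c0 mulr0 subr0 in d.
set a := sl2_val A 0 0 in d *; set b := sl2_val A 0 1; set e := sl2_val A 1 1 in d *.
have e0 : e != 0 by apply: contra_eq_neq d => ->; rewrite mulr0 eq_sym oner_eq0.
have s0 : 0 < sqmod e by rewrite sqmod_gt0.
have NE : moebius_den A q = sqmod e.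
  by rewrite /moebius_den c0 mul0r add0r {2}/sqmod /= expr0n addr0 mul0r addr0.
rewrite /hsize /= /moebius_fun /= NE -/a -/b -/e c0 mul0r add0r.
rewrite conjc_0 mulr0 mul0r addr0 !sqmodM sqmodV sqmodR sqmodJ.
have sa : sqmod a = (sqmod e)^-1.
  by apply: (mulIf (lt0r_neq0 s0)); rewrite mulVf ?lt0r_neq0 // -sqmodM d /sqmod /= expr1n expr0n addr0.
have := sqmodD_le (a * q.1 + b) (- b); rewrite addrK sqmodN sqmodM sa.
set X := sqmod (_ + _); set Y := sqmod q.1; set B := sqmod b; set s := sqmod e in s0 *.
move=> h.
have -> : X * s / s ^+ 2 = X / s by field; rewrite gt_eqF.
have -> : X / s + (q.2 / s) ^+ 2 = (X + s^-1 * q.2 ^+ 2) / s.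
  by field; rewrite gt_eqF.
rewrite ler_pM2r ?invr_gt0 // (mulrC (_ + _)) mulrDr.
have := mulr_ge0 (ltW (_ : 0 < s^-1)) (sqr_ge0 q.2); rewrite invr_gt0 => /(_ s0); lra.
Qed.

(** The neighbourhoods of infinity in S3 are the complements of compact sets;
    this lets hsize detect convergence to infinity. *)
Lemma compact_hsize (W : set (R[i]^o * R)) : compact W ->
  exists B : R, forall w : R[i] * R, W w -> hsize w <= B.
Proof.
move=> /compact_near_coveringP/(_ R (pinfty_nbhs R)) h.
have [|B [_ hB]] := h (fun (B : R) (w : R[i] * R) => hsize w <= B) _.
  move=> w _.
  have h1 : \forall w' \near w, sqmod (w'.1 - w.1) <= 1.
    have : w.1 @[w --> w] --> (w.1 : R[i]^o) by apply: cvg_fst.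
    move=> /cvgrPdist_lt/(_ 1 ltr01); apply: filterS => w'.
    rewrite normc_def -[1]/((1 : R)%:C) ltcR => hlt.
    rewrite -sqmodN opprB -(expr1n _ 2) -[X in X <= _](@sqr_sqrtr R) ?sqmod_ge0 //.
    by rewrite ler_pXn2r ?nnegrE ?sqrtr_ge0 // ltW.
  have h2 : \forall w' \near w, `|w'.2 - w.2| <= 1.
    have : w.2 @[w --> w] --> w.2 by apply: cvg_snd.
    move=> /cvgrPdist_lt/(_ 1 ltr01); apply: filterS => w'.
    by rewrite distrC => /ltW.
  near=> w' B; rewrite /hsize /=.
  have k1 : sqmod (w'.1 - w.1) <= 1 by near: w'.
  have k2 : `|w'.2 - w.2| <= 1 by near: w'.
  have k3 : 2 * (1 + sqmod w.1) + 2 * (1 + w.2 ^+ 2) <= B by near: B; apply: nbhs_pinfty_ge; rewrite num_real.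
  apply: le_trans k3; rewrite lerD //.
    by have := sqmodD_le (w'.1 - w.1) w.1; rewrite subrK; lra.
  have k4 : (w'.2 - w.2) ^+ 2 <= 1.
    by move: k2; rewrite ler_norml => /andP[]; nra.
  have := sqr_ge0 (w'.2 - w.2 - w.2); lra.
by exists (B + 1); apply: hB; rewrite ltrDl.
Unshelve. all: by end_near. Qed.

End Boundary.

Section BoundaryLimits.
Variable R : realType.
Implicit Types (z w l : R[i]) (A B : SL2 R) (p q : H3 R).

(** Points of size tending to infinity converge to infinity, hence their images
    under A converge to A(oo). *)
Lemma cvg_bdpt (T : Type) (F : set_system T) (FF : Filter F) (q : T -> H3 R) A :
  hsize (q x) @[x --> F] --> +oo ->
  h3_in_S3 (moebius A (q x)) @[x --> F] --> bd_in_S3 (bdpt A).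
Proof.
move=> /cvgryPge hq; rewrite /bdpt; case: eqP => [c0|/eqP c0].
  have d0 : 0 < sqmod (sl2_val A 1 1).
    rewrite sqmod_gt0; apply/eqP => d0; have := sl2_det1 A.
    by rewrite det2 c0 d0 !mulr0 subr0 => /esym/eqP; rewrite oner_eq0.
  move=> U [W [cW _] WU]; have [B hB] := compact_hsize cW.
  set d := sqmod (sl2_val A 1 1) in d0.
  pose K := (`|B| + 1) * d + sqmod (sl2_val A 0 1).
  have := hq (2 * d * K); apply: filterS => x hx; apply: WU; left.
  exists (h3_val (moebius A (q x))) => // /hB; apply/negP; rewrite -ltNge.
  apply: lt_le_trans (moebius_size _ c0); rewrite -/d ltr_pdivlMr //.
  rewrite ltrBrDr; apply: (@lt_le_trans _ _ K).
    by rewrite ltrD2r ltr_pM2r // (le_lt_trans (ler_norm _)) // ltrDl.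
  rewrite ler_pdivlMr // ler_pdivlMr //; apply: le_trans hx.
  by rewrite [leRHS]mulrC mulrA.
have s0 : 0 < sqmod (sl2_val A 1 0) by rewrite sqmod_gt0.
have small (e : R) : 0 < e ->
    \forall x \near F, (sqmod (sl2_val A 1 0) * moebius_den A (q x))^-1 < e ^+ 2.
  move=> e0; set s := sqmod _ in s0.
  pose K := ((s * e ^+ 2)^-1 + sqmod (sl2_val A 1 1) + 1) * 2 / s.
  have := hq K; apply: filterS => x hx.
  have N0 := moebius_den_gt0 A (q x); have := moebius_den_lower A (q x).
  rewrite -/s; set N := moebius_den _ _ in N0 *; set m := sqmod _ => hN.
  have h : (s * e ^+ 2)^-1 < N.
    apply: lt_le_trans hN; rewrite ltrBrDr.
    apply: (@lt_le_trans _ _ (s * K / 2)); last first.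
      by rewrite ler_pM2r ?invr_gt0 // ler_pM2l.
    have -> : s * K / 2 = (s * e ^+ 2)^-1 + m + 1.
      by rewrite /K -/m; field; rewrite !gt_eqF ?exprn_gt0.
    by rewrite ltrDl.
  rewrite invf_plt ?posrE ?mulr_gt0 ?exprn_gt0 // -ltr_pdivrMl //.
  by rewrite -invfM.
have h1 : ((moebius A (q x)).1 : R[i]^o) @[x --> F] -->
    (sl2_val A 0 0 / sl2_val A 1 0 : R[i]^o).
  apply/cvgrPdist_lt => -[e e']; rewrite ltcE /= => /andP[/eqP-> e0].
  apply: filterS (small _ e0) => x hx; rewrite normc_def ltcR.
  have [h1 _] := moebius_far (q x) c0; have := le_lt_trans h1 hx.
  rewrite -[X in X < _](@sqr_sqrtr R) ?sqmod_ge0 //.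
  by rewrite ltr_pXn2r ?nnegrE ?sqrtr_ge0 ?ltW.
have h2 : (moebius A (q x)).2 @[x --> F] --> (0 : R).
  apply/cvgr0Pnorm_lt => e e0; apply: filterS (small _ e0) => x hx.
  have [_ h2] := moebius_far (q x) c0; have := le_lt_trans h2 hx.
  rewrite -(ger0_norm (ltW e0)) -[X in X < _](real_normK (num_real _)).
  by rewrite -[X in _ < X](real_normK (num_real _)) normr_id ltr_pXn2r ?nnegrE.
have h : h3_val (moebius A (q x)) @[x --> F] -->
    ((sl2_val A 0 0 / sl2_val A 1 0, 0) : R[i]^o * R).
  have -> : (fun x => h3_val (moebius A (q x))) =
      (fun x => ((moebius A (q x)).1 : R[i]^o, (moebius A (q x)).2)).
    by apply/funext => x; rewrite /h3_val; case: (h3_pt _).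
  exact: (cvg_pair h1 h2).
by move=> U hU; exact: (h (Some @^-1` U) hU).
Qed.

(** The half-turn exchanging 0 and infinity. *)
Lemma det_flip : \det (mx2 0 (-1) 1 0 : 'M[R[i]]_2) == 1.
Proof. by apply/eqP; rewrite det2 !mxE /=; ring. Qed.
Definition flip : SL2 R := MkSL2 det_flip.

Lemma vertical_flip (t : R) : vertical (- t) = moebius flip (vertical t).
Proof.
apply: val_inj; rewrite /= /moebius_fun /moebius_den /= !mxE /=.
have -> : 1 * 0 + 0 = 0 :> R[i] by rewrite mulr0 addr0.
rewrite conjc_0 mulr0 !mul0r addr0 mul0r; congr (_, _).
rewrite expRN /sqmod /= !expr0n /= expr1n !addr0 add0r mul1r.
by field; rewrite gt_eqF ?expR_gt0.
Qed.

Lemma hsize_vertical (t : R) : hsize (vertical t) = expR (2 * t).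
Proof. by rewrite /hsize /sqmod /= expr0n addr0 add0r -expRM_natl. Qed.

Lemma cvg_hsize_vertical : hsize (vertical (t : R)) @[t --> +oo] --> +oo.
Proof.
apply/cvgryPge => K; near=> t; rewrite hsize_vertical.
have t0 : `|K| <= t by near: t; apply: nbhs_pinfty_ge; rewrite num_real.
have := expR_ge1Dx (2 * t); have := ler_norm K; have := normr_ge0 K; lra.
Unshelve. all: by end_near. Qed.

Lemma geodesic_moebius A :
  geodesic_line (fun t : R => moebius A (vertical t)) (bdpt (sl2_mul A flip)) (bdpt A).
Proof.
split=> [s t||]; first by rewrite hdist_moebius hdist_vertical.
  apply/num_normedtype.cvgNy_compNP.
  have -> : (fun t : R => h3_in_S3 (moebius A (vertical t))) \o -%R =
      (fun t => h3_in_S3 (moebius (sl2_mul A flip) (vertical t))).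
    by apply/funext => t /=; rewrite moebius_mul -vertical_flip.
  exact: cvg_bdpt cvg_hsize_vertical.
exact: cvg_bdpt cvg_hsize_vertical.
Unshelve. all: by end_near. Qed.

Lemma hull_line (G : groupType) (rho : {multiplicative G -> PSL2 R}) A (t : R) :
  limit_set rho (bdpt A) -> limit_set rho (bdpt (sl2_mul A flip)) ->
  limit_hull rho (moebius A (vertical t)).
Proof.
move=> h1 h2 C [_ hC]; apply: (hC _ _ _ h2 h1 (geodesic_moebius A)).
by exists t.
Qed.

Lemma limit_set_bdpt (G : groupType) (rho : {multiplicative G -> PSL2 R}) A p
    (g : nat -> G) (q : nat -> H3 R) :
  (forall n, psl2_act (rho (g n)) p = moebius A (q n)) ->
  hsize (q n) @[n --> \oo] --> +oo -> limit_set rho (bdpt A).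
Proof.
move=> gq hq; exists p => U hU.
have : \forall n \near \oo, U (h3_in_S3 (moebius A (q n))).
  exact: (@cvg_bdpt _ _ _ q A hq _ hU).
move=> /filter_ex[n hn].
by exists (h3_in_S3 (moebius A (q n))); split=> //; exists (g n); rewrite // gq.
Qed.

End BoundaryLimits.

Section Triangular.
Variable R : realType.
Implicit Types (z w l : R[i]) (A B M T : SL2 R) (p q : H3 R).

Lemma sl2_valV A : sl2_val (A^-1)%g = adj2 (sl2_val A).
Proof.
have h : adj2 (sl2_val A) *m sl2_val A = 1%:M by rewrite mul_adj2 sl2_det1.
rewrite -[LHS]mul1mx -h -mulmxA -sl2_valM mulgV.
exact: mulmx1.
Qed.

Lemma psl2_actE A p : psl2_act (psl2_of A) p = moebius A p.
Proof. exact: psl2_act_of. Qed.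

Lemma psl2_ofJ M A : psl2_of (M ^ A)%g = (psl2_of M ^ psl2_of A)%g.
Proof. by rewrite !conjgE psl2_ofM psl2_ofM psl2_ofV. Qed.

Lemma moebiusM A B p : moebius (A * B)%g p = moebius A (moebius B p).
Proof. exact: moebius_mul. Qed.

Lemma moebiusVK A p : moebius (A^-1)%g (moebius A p) = p.
Proof. by rewrite -moebiusM mulVg; exact: moebius_one. Qed.

Lemma sl2_col (x y : R[i]) : (x != 0) || (y != 0) ->
  exists A, sl2_val A 0 0 = x /\ sl2_val A 1 0 = y.
Proof.
have [->|x0 _] := eqVneq x 0.
  move=> /= y0.
  have d : \det (mx2 0 (- y^-1) y 0) == 1.
    by apply/eqP; rewrite det2 !mxE /=; field.
  by exists (MkSL2 d); rewrite !mxE.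
have d : \det (mx2 x 0 y x^-1) == 1 by apply/eqP; rewrite det2 !mxE /=; field.
by exists (MkSL2 d); rewrite !mxE.
Qed.

Lemma eigenvector M l : l != 0 -> l + l^-1 = \tr (sl2_val M) ->
  exists x y, (x != 0) || (y != 0) /\
    sl2_val M 0 0 * x + sl2_val M 0 1 * y = l * x /\
    sl2_val M 1 0 * x + sl2_val M 1 1 * y = l * y.
Proof.
move=> l0; have := sl2_det1 M; rewrite det2 trace2.
set a := sl2_val M 0 0; set b := sl2_val M 0 1; set c := sl2_val M 1 0.
set d := sl2_val M 1 1 => dM lE.
have ch : l * l = (a + d) * l - (a * d - b * c).
  by rewrite -lE dM mulrDl mulVf // addrK.
have [h|] := boolP ((l - d != 0) || (c != 0)).
  exists (l - d), c; split=> //; split; last by ring.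
  have -> : l * (l - d) = l * l - l * d by ring.
  by rewrite ch; ring.
rewrite negb_or !negbK subr_eq0 => /andP[/eqP ld /eqP c0].
have [h|] := boolP ((b != 0) || (l - a != 0)).
  exists b, (l - a); split=> //; split; first by ring.
  by rewrite c0 ld; ring.
rewrite negb_or !negbK subr_eq0 => /andP[/eqP b0 /eqP la].
by exists 1, 0; rewrite oner_eq0 b0 c0 -la; split=> //; split; ring.
Qed.

(** The conjugate of M by A is upper triangular as soon as the first column
    of A is an eigenvector of M. *)
Lemma conj_upper M A l :
  sl2_val M 0 0 * sl2_val A 0 0 + sl2_val M 0 1 * sl2_val A 1 0 = l * sl2_val A 0 0 ->
  sl2_val M 1 0 * sl2_val A 0 0 + sl2_val M 1 1 * sl2_val A 1 0 = l * sl2_val A 1 0 ->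
  sl2_val (M ^ A)%g 1 0 = 0 /\ sl2_val (M ^ A)%g 0 0 = l.
Proof.
move=> h1 h2; rewrite conjgE !sl2_valM sl2_valV !mulmx2 h1 h2 !mxE /=.
split; first by ring.
have := sl2_det1 A; rewrite det2 => d.
by rewrite -[RHS]mul1r -d; ring.
Qed.

Lemma triangularize M l : l != 0 -> l + l^-1 = \tr (sl2_val M) ->
  exists A, sl2_val (M ^ A)%g 1 0 = 0 /\ sl2_val (M ^ A)%g 0 0 = l.
Proof.
move=> l0 lE; have [x [y [xy [h1 h2]]]] := eigenvector l0 lE.
have [A [A0 A1]] := sl2_col xy; exists A.
by apply: conj_upper; rewrite A0 A1.
Qed.

Lemma upper_diag T : sl2_val T 1 0 = 0 ->
  sl2_val T 0 0 != 0 /\ sl2_val T 1 1 = (sl2_val T 0 0)^-1.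
Proof.
move=> c0; have := sl2_det1 T; rewrite det2 c0 mulr0 subr0 => d.
have a0 : sl2_val T 0 0 != 0.
  by apply: contra_eq_neq d => ->; rewrite mul0r eq_sym oner_eq0.
by split=> //; apply: (mulfI a0); rewrite divff.
Qed.

Lemma upper_pow T k : sl2_val T 1 0 = 0 ->
  sl2_val (T ^+ k)%g 1 0 = 0 /\ sl2_val (T ^+ k)%g 0 0 = sl2_val T 0 0 ^+ k.
Proof.
move=> c0; elim: k => [|k [IH1 IH2]]; first by rewrite expg0 !mxE.
by rewrite expgS sl2_valM !mulmx2 IH1 IH2 c0 !(mulr0, mul0r, addr0) -exprS.
Qed.

Lemma upper_height T p : sl2_val T 1 0 = 0 ->
  (moebius T p).2 = sqmod (sl2_val T 0 0) * p.2.
Proof.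
move=> c0; have [a0 dE] := upper_diag c0.
rewrite /= /moebius_fun /= /moebius_den c0 mul0r add0r dE sqmodV.
rewrite {2}/sqmod /= expr0n addr0 mul0r addr0.
by field; rewrite gt_eqF ?sqmod_gt0.
Qed.

Section Limit.
Variables (G : groupType) (rho : {multiplicative G -> PSL2 R}).

Lemma rho_1 : rho 1%g = 1%g.
Proof. by apply: (mulgI (rho 1%g)); rewrite -gmulfM !mulg1. Qed.

Lemma rho_X g n : rho (g ^+ n)%g = (rho g ^+ n)%g.
Proof.
by elim: n => [|n IH]; rewrite ?expg0 ?rho_1 // !expgS gmulfM IH.
Qed.

Lemma rho_V g : rho (g^-1)%g = ((rho g)^-1)%g.
Proof. by apply: (mulgI (rho g)); rewrite -gmulfM !mulgV rho_1. Qed.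

(** The image of g ^+ n is A T^n A^-1, so the orbit of A o under the powers of g
    consists of the points A (T^n o), for o the base point. *)
Lemma limit_set_upper g A T : psl2_of T = (rho g ^ psl2_of A)%g ->
  (forall C : R, \forall n \near \oo, C <= hsize (moebius (T ^+ n)%g (h3_base R))) ->
  limit_set rho (bdpt A).
Proof.
move=> TE hT.
apply: (@limit_set_bdpt _ _ _ A (moebius A (h3_base R)) (fun n => (g ^+ n)%g)
  (fun n => moebius (T ^+ n)%g (h3_base R))); last exact/cvgryPge.
move=> n; have -> : rho (g ^+ n)%g = psl2_of (A * T ^+ n * A^-1)%g.
  rewrite rho_X !psl2_ofM psl2_ofX psl2_ofV TE -conjXg conjgE.
  by rewrite !mulgA mulgV mul1g mulgK.
by rewrite psl2_actE !moebiusM moebiusVK.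
Qed.

(** The heights of the points T^n o are |a|^(2 n). *)
Lemma limit_set_loxodromic g A T : psl2_of T = (rho g ^ psl2_of A)%g ->
  sl2_val T 1 0 = 0 -> 1 < normc (sl2_val T 0 0) -> limit_set rho (bdpt A).
Proof.
move=> TE c0 l1; apply: (limit_set_upper TE) => C.
set a := normc _ in l1; have a1 : 0 < a - 1 by rewrite subr_gt0.
near=> n; have n1 : `|C| / (a - 1) <= n%:R.
  by near: n; exact: nbhs_infty_ger.
have [h1 h2] := upper_pow n c0.
have e : (moebius (T ^+ n)%g (h3_base R)).2 = a ^+ n ^+ 2.
  by rewrite upper_height // h2 sqmod_normc normcX /= mulr1.
rewrite /hsize e.
apply: le_trans (_ : a ^+ n <= _); last first.
  apply: le_trans (_ : (a ^+ n ^+ 2) ^+ 2 <= _); last by rewrite lerDr sqmod_ge0.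
  set b := a ^+ n; have b1 : 1 <= b by rewrite exprn_ege1 // ltW.
  by rewrite -exprM -[leLHS]expr1 ler_weXn2l.
apply: le_trans (bernoulli _ _); last exact: le_trans (ltW l1).
rewrite ler_pdivrMr // in n1; have := ler_norm C; lra.
Unshelve. all: by end_near. Qed.

Lemma diag_vertical T (t : R) : sl2_val T 1 0 = 0 -> sl2_val T 0 1 = 0 ->
  moebius T (vertical t) = vertical (t + 2 * ln (normc (sl2_val T 0 0))).
Proof.
move=> c0 b0; have [a0 dE] := upper_diag c0; apply: val_inj.
apply/eqP; rewrite -[_ == _]/((_ == _) && (_ == _)); apply/andP; split; apply/eqP.
  by rewrite /= c0 b0 !(mulr0, mul0r, add0r, addr0, conjc_0).
rewrite upper_height //= mulrC expRD sqmod_normc; congr (_ * _).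
by rewrite expRM_natl lnK // posrE lt_def normc_eq0 a0 normc_ge0.
Qed.

(** The eigenvalues l and 1 / l are distinct, so after triangularization a
    unipotent matrix removes the remaining entry. *)
Lemma loxodromic_diag (x : PSL2 R) : 0 < translation_length x ->
  exists A D, psl2_of D = (x ^ psl2_of A)%g /\
    [/\ sl2_val D 0 1 = 0, sl2_val D 1 0 = 0, 1 < normc (sl2_val D 0 0) &
      translation_length x = 2 * ln (normc (sl2_val D 0 0))].
Proof.
move=> h; pose M := psl2_repr x.
have ME : psl2_of M = x by exact: psl2_reprK.
have [l lM] := top_eigenvalue_ex M; have [l0 lE l1] := lM.
have tE := translation_lengthE lM; rewrite ME in tE.
have lgt1 : 1 < normc l.
  rewrite lt_def l1 andbT; apply: contraTneq h => h1.
  by rewrite tE h1 ln1 mulr0 ltxx.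
have [A1 [c0 a0]] := triangularize l0 lE.
have [_ dE] := upper_diag c0; rewrite a0 in dE.
set T := (M ^ A1)%g in c0 a0 dE.
have ll : l^-1 - l != 0.
  apply/eqP => e; move/eqP: e; rewrite subr_eq0 => /eqP e.
  by move: lgt1; rewrite -e normcV invf_gt1 ?(top_eigenvalue_gt0 lM) // ltNge l1.
pose s := sl2_val T 0 1 / (l^-1 - l).
have dN : \det (mx2 1 s 0 1) == 1 by apply/eqP; rewrite det2 !mxE /=; ring.
pose N : SL2 R := MkSL2 dN.
exists (A1 * N)%g, (T ^ N)%g; split.
  by rewrite !psl2_ofJ (psl2_ofM A1) conjgM ME.
have [d1 d2 d3] : [/\ sl2_val (T ^ N)%g 0 0 = l, sl2_val (T ^ N)%g 0 1 = 0 &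
    sl2_val (T ^ N)%g 1 0 = 0].
  clearbody T; rewrite conjgE !sl2_valM sl2_valV !mulmx2 c0 a0 dE !mxE /=.
  split; [by ring| |by ring].
  have hs : s * (l^-1 - l) = sl2_val T 0 1 by rewrite /s divfK.
  by rewrite -hs; ring.
by rewrite d1 d2 d3.
Qed.

(** In coordinates where g is diagonal the axis is the vertical geodesic. Its
    ends are the attracting points of g and of g^-1, hence limit points. *)
Theorem loxodromic_axis g : 0 < len rho g -> exists A,
  (forall t : R, limit_hull rho (moebius A (vertical t))) /\
  (forall t : R, psl2_act (rho g) (moebius A (vertical t)) =
     moebius A (vertical (t + len rho g))).
Proof.
rewrite /len => /loxodromic_diag[A [D [DR [d2 d3 lgt1 tE]]]].
exists A; split=> t; last first.
  have <- : moebius D (vertical t) = vertical (t + translation_length (rho g)).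
    by rewrite diag_vertical // tE.
  rewrite -!psl2_actE DR -!psl2_actM conjgE !mulgA mulgV mul1g.
  by [].
apply: hull_line; first exact: (limit_set_loxodromic DR).
have [d0 d4] := upper_diag d3.
pose D' := ((D^-1) ^ flip R)%g.
apply: (@limit_set_loxodromic (g^-1)%g (A * flip R)%g D').
- by rewrite /D' psl2_ofJ psl2_ofV DR (psl2_ofM A) conjgM rho_V !conjVg.
- by rewrite /D' conjgE !sl2_valM !sl2_valV !mulmx2 !mxE /= d2; ring.
rewrite /D' conjgE !sl2_valM !sl2_valV !mulmx2 !mxE /= d2 d3 d4.
by rewrite (_ : _ + _ = sl2_val D 0 0) //; ring.
Qed.

End Limit.

End Triangular.

(** * Discreteness *)

Section Discrete.
Variable R : realType.
Implicit Types (z w l : R[i]) (A B M T W : SL2 R) (p q : H3 R).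

Lemma frob_ge0 (X : 'M[R[i]]_2) : 0 <= frob X.
Proof. by rewrite frobE !addr_ge0 ?sqr_ge0. Qed.

Lemma frob_adj (X : 'M[R[i]]_2) : frob (adj2 X) = frob X.
Proof. by rewrite !frobE !mxE /= !normcN; ring. Qed.

Lemma normc_dot_sqr (a b c d : R[i]) : normc (a * b + c * d) ^+ 2 <=
  (normc a ^+ 2 + normc c ^+ 2) * (normc b ^+ 2 + normc d ^+ 2).
Proof.
apply: le_trans (_ : (normc a * normc b + normc c * normc d) ^+ 2 <= _).
  rewrite ler_pXn2r ?nnegrE ?normc_ge0 ?addr_ge0 ?mulr_ge0 ?normc_ge0 //.
  by rewrite (le_trans (le_normcD _ _)) // !normcM.
rewrite -subr_ge0; set u := _ - _.
have -> : u = (normc a * normc d - normc c * normc b) ^+ 2 by rewrite /u; ring.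
exact: sqr_ge0.
Qed.

Lemma frob_mul (X Y : 'M[R[i]]_2) : frob (X *m Y) <= frob X * frob Y.
Proof.
rewrite !frobE !mulmx2.
have := normc_dot_sqr (X 0 0) (Y 0 0) (X 0 1) (Y 1 0).
have := normc_dot_sqr (X 0 0) (Y 0 1) (X 0 1) (Y 1 1).
have := normc_dot_sqr (X 1 0) (Y 0 0) (X 1 1) (Y 1 0).
have := normc_dot_sqr (X 1 0) (Y 0 1) (X 1 1) (Y 1 1).
move: (normc _ ^+ 2) (normc _ ^+ 2) (normc _ ^+ 2) (normc _ ^+ 2).
move=> x1 x2 x3 x4; lra.
Qed.

Lemma frob_ge2 A : 2 <= frob (sl2_val A).
Proof.
have := hcosh_ge1 (h3_base R) (moebius A (h3_base R)); rewrite hcosh_base.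
by rewrite ler_pdivlMr // mul1r.
Qed.

Section Rho.
Variables (G : groupType) (rho : {multiplicative G -> PSL2 R}).
Hypotheses (rho_inj : injective rho) (rho_disc : discrete_image rho).

Lemma psl2_of_continuous : continuous (@psl2_of R).
Proof. exact: pi_continuous. Qed.

(** Neighbourhoods for the quotient topology of PSL_2 pull back to SL_2, where
    they contain balls for the Frobenius norm. *)
Lemma discrete_at_one : exists2 d : R, 0 < d & forall g W,
  psl2_of W = rho g -> frob (sl2_val W - 1%:M) < d -> g = 1%g.
Proof.
have := rho_disc 1%g; rewrite rho_1 => h.
have /= := psl2_of_continuous h.
case=> _ [[/= V oV <-] /= V1 VU].
have : nbhs (sl2_mx (sl2_one R)) V by rewrite nbhsE; exists V.
move=> /nbhs_ballP[[e e'] /=]; rewrite ltcE /= => /andP[/eqP e'0 e0] hb.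
exists (e ^+ 2) => [|g W WE hW]; first by rewrite exprn_gt0.
apply: rho_inj; rewrite rho_1 -WE; apply: VU; last by rewrite WE; exists g.
apply: hb; split; first by rewrite ltcE /= e'0 eqxx.
move=> i j; rewrite -ball_normE /= e'0 normc_def ltcR.
have hij : sqmod ((sl2_val W - 1%:M) i j) < e ^+ 2.
  apply: le_lt_trans hW; rewrite /frob.
  have := sqmod_ge0 ((sl2_val W - 1%:M) 0 0); have := sqmod_ge0 ((sl2_val W - 1%:M) 0 1).
  have := sqmod_ge0 ((sl2_val W - 1%:M) 1 0); have := sqmod_ge0 ((sl2_val W - 1%:M) 1 1).
  by case: (ord2P i) => ->; case: (ord2P j) => ->; lra.
have e1 : (sl2_val W - 1%:M) i j = - (sl2_mx (sl2_one R) i j - sl2_mx W i j).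
  by rewrite mxE [X in _ + X]mxE opprB.
rewrite e1 sqmodN in hij.
rewrite -(ltr_pXn2r (n := 2)) ?nnegrE ?sqrtr_ge0 ?(ltW e0) // sqr_sqrtr //.
by rewrite addr_ge0 ?sqr_ge0.
Qed.

Lemma frob_conj_le (X : 'M[R[i]]_2) A :
  frob X <= frob (sl2_val A) ^+ 2 * frob (adj2 (sl2_val A) *m X *m sl2_val A).
Proof.
have {1}-> : X = sl2_val A *m (adj2 (sl2_val A) *m X *m sl2_val A) *m adj2 (sl2_val A).
  by rewrite !mulmxA mulmx_adj2 sl2_det1 mul1mx -mulmxA mulmx_adj2 sl2_det1 mulmx1.
apply: le_trans (frob_mul _ _) _; rewrite frob_adj.
apply: le_trans (ler_wpM2r (frob_ge0 _) (frob_mul _ _)) _.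
by rewrite mulrAC expr2.
Qed.

(** Conjugation by A distorts the Frobenius norm by a bounded factor. *)
Lemma discrete_at_one_conj A : exists2 d : R, 0 < d & forall g W,
  psl2_of W = rho g -> frob (sl2_val (W ^ A)%g - 1%:M) < d -> g = 1%g.
Proof.
have [d d0 hd] := discrete_at_one; have A2 := frob_ge2 A.
have A0 : 0 < frob (sl2_val A) ^+ 2 by rewrite exprn_gt0 // (lt_le_trans _ A2).
exists (d / frob (sl2_val A) ^+ 2); first by rewrite divr_gt0.
move=> g W WE; rewrite ltr_pdivlMr // mulrC => h; apply: hd WE _.
apply: le_lt_trans (frob_conj_le _ A) _; apply: le_lt_trans h.
rewrite ler_pM2l // conjgE !sl2_valM sl2_valV mulmxBr mulmxBl mulmx1 mulmxA.
by rewrite mul_adj2 sl2_det1.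
Qed.

(** If W1 and W2 are close and W2 is bounded, then W1 W2^-1 is close to 1. *)
Lemma discrete_separated (r : R) : exists2 d : R, 0 < d & forall g1 g2 W1 W2,
  psl2_of W1 = rho g1 -> psl2_of W2 = rho g2 -> frob (sl2_val W2) <= r ->
  frob (sl2_val W1 - sl2_val W2) < d -> g1 = g2.
Proof.
have [d d0 hd] := discrete_at_one; pose s := `|r| + 1.
have s0 : 0 < s by rewrite ltr_wpDl.
exists (d / s) => [|g1 g2 W1 W2 E1 E2 hr]; first by rewrite divr_gt0.
rewrite ltr_pdivlMr // => h; suff : (g1 * g2^-1)%g = 1%g.
  by move=> e; rewrite -[g1](mulgVK g2) e mul1g.
apply: (hd _ (W1 * W2^-1)%g); first by rewrite psl2_ofM psl2_ofV E1 E2 gmulfM rho_V.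
have -> : sl2_val (W1 * W2^-1)%g - 1%:M = (sl2_val W1 - sl2_val W2) *m adj2 (sl2_val W2).
  by rewrite sl2_valM sl2_valV mulmxBl mulmx_adj2 sl2_det1.
apply: le_lt_trans (frob_mul _ _) _; apply: le_lt_trans h; rewrite frob_adj.
rewrite ler_wpM2l ?frob_ge0 // (le_trans hr) // (le_trans (ler_norm _)) //.
by rewrite lerDl.
Qed.

(** Matrix space is cut into cubes so small that each of them contains at most
    one element; boundedly many cubes meet the ball. *)
Lemma discrete_finite_ball (r : R) : exists s : seq G, forall g,
  frob (sl2_val (psl2_repr (rho g))) <= r -> g \in s.
Proof.
have [d d0 hd] := discrete_separated r.
pose b := Num.max r 1; have b1 : 1 <= b by rewrite le_max lexx orbT.
have b0 : 0 < b := lt_le_trans ltr01 b1.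
(* The squared norm of a difference is a sum of eight squares of coordinates,
   each of them less than e ^ 2 <= e for two elements of the same cube. *)
pose e := Num.min 1 (d / 16); have e0 : 0 < e by rewrite lt_min ltr01 divr_gt0.
have e1 : e <= 1 by rewrite ge_min lexx.
have e16 : 16 * e <= d by rewrite mulrC -ler_pdivlMr // ge_min lexx orbT.
pose N := Num.truncn (2 * b / e).
pose co (k : 'I_2 * 'I_2 * bool) (g : G) : R :=
  let z := sl2_val (psl2_repr (rho g)) k.1.1 k.1.2 in
  if k.2 then complex.Re z else complex.Im z.
pose code (g : G) : {ffun 'I_2 * 'I_2 * bool -> 'I_N.+1} :=
  [ffun k => inord (Num.truncn ((co k g + b) / e))].
pose S := [set g : G | frob (sl2_val (psl2_repr (rho g))) <= r].
have coS k g : S g -> `|co k g| <= b.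
  rewrite /S /= => hg; have h1 : co k g ^+ 2 <= frob (sl2_val (psl2_repr (rho g))).
    rewrite /frob /co; case: k => [[i j] c] /=; set W := sl2_val _.
    have sq (z : R[i]) : (if c then complex.Re z else complex.Im z) ^+ 2 <= sqmod z.
      by rewrite /sqmod; case: c; rewrite ?lerDl ?lerDr sqr_ge0.
    have := sqmod_ge0 (W 0 0); have := sqmod_ge0 (W 0 1).
    have := sqmod_ge0 (W 1 0); have := sqmod_ge0 (W 1 1).
    have := sq (W i j).
    by case: (ord2P i) => ->; case: (ord2P j) => ->; lra.
  rewrite -(ler_pXn2r (n := 2)) ?nnegrE ?(ltW b0) // real_normK ?num_real //.
  apply: le_trans h1 _; apply: (le_trans hg); apply: (@le_trans _ _ b).
    by rewrite le_max lexx.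
  by rewrite expr2 ler_peMl // ltW.
have coT k g : S g -> (Num.truncn ((co k g + b) / e)%R < N.+1)%N.
  move=> /(coS k); rewrite ler_norml => /andP[h1 h2].
  rewrite ltnS; apply: le_truncn; rewrite ler_pM2r ?invr_gt0 //; lra.
have code_inj g1 g2 : S g1 -> S g2 -> code g1 = code g2 -> g1 = g2.
  move=> S1 S2 h; apply: (hd _ _ _ _ (psl2_reprK _) (psl2_reprK _)) => //.
  have hk k : (co k g1 - co k g2) ^+ 2 < e ^+ 2.
    have := congr1 (fun f : {ffun _ -> 'I_N.+1} => val (f k)) h.
    rewrite /code !ffunE /= !inordK ?coT // => ht.
    have [p1 p2] : 0 <= (co k g1 + b) / e /\ 0 <= (co k g2 + b) / e.
      have := coS k _ S1; have := coS k _ S2; rewrite !ler_norml.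
      move=> /andP[u1 _] /andP[u2 _].
      by split; rewrite divr_ge0 ?(ltW e0) // -(opprK b) subr_ge0.
    have := truncn_itv p1; have := truncn_itv p2; rewrite ht.
    move: (Num.truncn _) => m /andP[a1 a2] /andP[a3 a4].
    have : `|(co k g1 + b) / e - (co k g2 + b) / e| < 1.
      by rewrite ltr_norml; rewrite -natr1 in a2 a4; lra.
    rewrite -mulrBl (_ : co k g1 + b - (co k g2 + b) = co k g1 - co k g2); last by ring.
    rewrite normrM (@gtr0_norm _ e^-1) ?invr_gt0 // ltr_pdivrMr // mul1r.
    by move=> hlt; rewrite -(real_normK (num_real (_ - _))) ltr_pXn2r ?nnegrE ?(ltW e0).
  have ee : e ^+ 2 <= e by rewrite expr2 ler_piMl // ltW.
  rewrite /frob /sqmod.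
  have hc i j c := hk (i, j, c); rewrite /co /= in hc.
  have := hc 0 0 true; have := hc 0 1 true; have := hc 1 0 true; have := hc 1 1 true.
  have := hc 0 0 false; have := hc 0 1 false; have := hc 1 0 false; have := hc 1 1 false.
  rewrite !mxE /=.
  have ReB (z w : R[i]) : complex.Re (z - w) = complex.Re z - complex.Re w.
    by case: z w => [? ?] [].
  have ImB (z w : R[i]) : complex.Im (z - w) = complex.Im z - complex.Im w.
    by case: z w => [? ?] [].
  rewrite !ReB !ImB; lra.
(* One element for each cube, with 1 as the value for the empty ones. *)
exists [seq xget 1%g [set g | S g /\ code g = t] | t <- enum {: {ffun 'I_2 * 'I_2 * bool -> 'I_N.+1}}].
move=> g Sg; apply/mapP; exists (code g); first by rewrite mem_enum.
have [g' [Sg' cg']] : exists g', [set g | S g /\ code g = code g] g' by exists g.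
case: xgetP => [g2 _ [S2 c2]|/(_ g)[]//]; exact: code_inj.
Qed.

(** Two of the powers coincide, since they lie in a finite set. *)
Lemma bounded_powers_torsion g (r : R) :
  (forall n, frob (sl2_val (psl2_repr (rho (g ^+ n)%g))) <= r) ->
  exists2 n, (0 < n)%N & (g ^+ n = 1)%g.
Proof.
move=> h; have [s hs] := discrete_finite_ball r.
pose t := [seq (g ^+ n)%g | n <- iota 0 (size s).+1].
have nu : ~~ uniq t.
  apply: contraL (ltnSn (size s)) => u; rewrite -leqNgt.
  rewrite -[X in (X <= _)%N](size_iota 0) -(size_map (fun n => (g ^+ n)%g)).
  by apply: uniq_leq_size u _ => x /mapP[n _ ->]; exact: hs.
have [i [j []]] := uniqPn 1%g nu; rewrite size_map size_iota => ij js.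
rewrite !(nth_map 0%N) ?size_iota ?(ltn_trans ij) // !nth_iota ?(ltn_trans ij) //.
rewrite !add0n => e; exists (j - i)%N; first by rewrite subn_gt0.
by apply: (mulgI (g ^+ i)%g); rewrite -expgnDr subnKC ?mulg1 // ltnW.
Qed.

End Rho.
End Discrete.

(** * Elements of length zero *)

Section Torsion.
Variable R : realType.
Implicit Types (z w l : R[i]) (A B M T W : SL2 R) (p q : H3 R).

Lemma frob_repr W (x : PSL2 R) : psl2_of W = x ->
  frob (sl2_val (psl2_repr x)) = frob (sl2_val W).
Proof.
by move=> <-; case: (psl2_repr_of W) => -> //=; rewrite !frobE !mxE !normcN.
Qed.

Lemma chebU_geom l k : l != 0 -> chebU l k * (l - l^-1) = l ^+ k - l^-1 ^+ k.
Proof.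
move=> l0; elim: k => [|k IH]; first by rewrite mul0r !expr0 subrr.
by rewrite /= mulrDl -mulrA IH !exprS; ring.
Qed.

(** The coefficients of M^n in M and 1 are quotients of l^n - l^-n by l - l^-1,
    hence bounded when |l| = 1. *)
Lemma elliptic_bounded M l : top_eigenvalue (sl2_val M) l -> normc l = 1 ->
  l != l^-1 -> exists r : R, forall n, frob (sl2_val (M ^+ n)%g) <= r.
Proof.
move=> lM l1 ll; have [l0 _ _] := lM.
have ld : 0 < normc (l - l^-1) by rewrite lt_def normc_eq0 subr_eq0 ll normc_ge0.
pose c := 2 / normc (l - l^-1).
have cb n : normc (chebU l n) ^+ 2 <= c ^+ 2.
  rewrite ler_pXn2r ?nnegrE ?normc_ge0 ?divr_ge0 ?normc_ge0 //.
  rewrite ler_pdivlMr // -normcM chebU_geom //.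
  rewrite (le_trans (ler_normcB _ _)) // !normcX normcV l1 invr1 !expr1n.
  exact: lexx.
exists (2 * (c ^+ 2 * frob (sl2_val M) + 2 * c ^+ 2) + 2) => -[|k].
  rewrite expg0 frobE !mxE normc1 normc0 expr1n expr0n /=.
  have := mulr_ge0 (sqr_ge0 c) (frob_ge0 (sl2_val M)); have := sqr_ge0 c; lra.
rewrite (chebUE k lM) (le_trans (frob_lin _ _ _)) // ler_wpDr //.
rewrite ler_pM2l // lerD ?ler_pM2l // ler_wpM2r ?frob_ge0 //.
Qed.

Section Rho.
Variables (G : groupType) (rho : {multiplicative G -> PSL2 R}).
Hypotheses (rho_inj : injective rho) (rho_disc : discrete_image rho).

(** Elements of length zero are elliptic or parabolic. An elliptic one has
    bounded powers, hence finite order. *)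
Lemma len0_unipotent g : len rho g = 0 -> non_torsion g ->
  exists2 W, psl2_of W = rho g & \tr (sl2_val W) = 2.
Proof.
move=> h gt; pose M := psl2_repr (rho g).
have ME : psl2_of M = rho g by exact: psl2_reprK.
have [l lM] := top_eigenvalue_ex M; have [l0 lE l1] := lM.
have l1' : normc l = 1.
  move: h; rewrite /len -ME (translation_lengthE lM) => /eqP.
  rewrite mulf_eq0 pnatr_eq0 /= ln_eq0 ?(top_eigenvalue_gt0 lM) //.
  by move/eqP.
have [ll|ll] := eqVneq l l^-1; last first.
  have [r hr] := elliptic_bounded lM l1' ll.
  have [|n n0 gn] := bounded_powers_torsion rho_inj rho_disc (g := g) (r := r).
    by move=> n; rewrite rho_X -ME -psl2_ofX (frob_repr erefl).
  by case: (gt n n0 gn).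
have : l ^+ 2 == 1 by rewrite expr2 {2}ll divff.
rewrite sqrf_eq1 => /orP[]/eqP le.
  by exists M => //; rewrite -lE le invr1; ring.
exists (sl2_opp M); first by rewrite psl2_of_opp.
by rewrite /= raddfN /= -lE le invrN invr1; ring.
Qed.

Lemma limit_set_fixed g A T : psl2_of T = (rho g ^ psl2_of A)%g ->
  sl2_val T 1 0 = 0 -> normc (sl2_val T 0 0) != 1 -> limit_set rho (bdpt A).
Proof.
move=> TE c0 l1; have [a0 dE] := upper_diag c0.
have [l_gt|l_le] := ltP 1 (normc (sl2_val T 0 0)).
  exact: limit_set_loxodromic TE c0 l_gt.
apply: (@limit_set_loxodromic _ _ _ (g^-1)%g A (T^-1)%g).
- by rewrite psl2_ofV TE rho_V conjVg.
- by rewrite sl2_valV !mxE /= c0 oppr0.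
rewrite sl2_valV !mxE /= dE normcV invf_gt1.
  by rewrite lt_neqAle l1.
by rewrite lt_def normc_eq0 a0 normc_ge0.
Qed.

Lemma unipotent_pow T n : sl2_val T 1 0 = 0 -> sl2_val T 0 0 = 1 ->
  [/\ sl2_val (T ^+ n)%g 0 0 = 1, sl2_val (T ^+ n)%g 0 1 = n%:R * sl2_val T 0 1,
    sl2_val (T ^+ n)%g 1 0 = 0 & sl2_val (T ^+ n)%g 1 1 = 1].
Proof.
move=> c0 a1; have [_ d1] := upper_diag c0; rewrite a1 invr1 in d1.
elim: n => [|n [h1 h2 h3 h4]]; first by rewrite expg0 !mxE mul0r.
rewrite expgS sl2_valM !mulmx2 h1 h2 h3 h4 c0 a1 d1 -natr1.
by split; ring.
Qed.

Lemma trace_unipotent_mul T W n : sl2_val T 1 0 = 0 -> sl2_val T 0 0 = 1 ->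
  \tr (sl2_val (T ^+ n * W)%g) =
    \tr (sl2_val W) + n%:R * (sl2_val T 0 1 * sl2_val W 1 0).
Proof.
move=> c0 a1; have [h1 h2 h3 h4] := unipotent_pow n c0 a1.
by rewrite sl2_valM !trace2 !mulmx2 h1 h2 h3 h4; ring.
Qed.

(** The points T^n o have first coordinate n b. *)
Lemma limit_set_parabolic g A T : psl2_of T = (rho g ^ psl2_of A)%g ->
  sl2_val T 1 0 = 0 -> sl2_val T 0 0 = 1 -> sl2_val T 0 1 != 0 ->
  limit_set rho (bdpt A).
Proof.
move=> TE c0 a1 b0; apply: (limit_set_upper TE) => C.
have Tn n := unipotent_pow n c0 a1.
have s0 : 0 < sqmod (sl2_val T 0 1) by rewrite sqmod_gt0.
near=> n; have n1 : `|C| / sqmod (sl2_val T 0 1) <= n%:R.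
  by near: n; exact: nbhs_infty_ger.
have n2 : (1 : R) <= n%:R by near: n; exact: nbhs_infty_ger.
have [h1 h2 h3 h4] := Tn n.
have e : (moebius (T ^+ n)%g (h3_base R)).1 = n%:R * sl2_val T 0 1.
  rewrite /= /moebius_fun /moebius_den /= h1 h2 h3 h4 mul0r add0r mulr0 add0r.
  rewrite conjc_0 conjc_1 mulr0 mul0r addr0 mulr1.
  have -> : sqmod (1 : R[i]) = 1 by rewrite /sqmod /= expr1n expr0n addr0.
  have -> : sqmod (0 : R[i]) = 0 by rewrite /sqmod /= expr0n addr0.
  by rewrite mul0r addr0 divr1.
rewrite /hsize e; apply: le_trans (_ : sqmod (n%:R * sl2_val T 0 1) <= _).
  rewrite sqmodM; have -> : sqmod (n%:R : R[i]) = n%:R ^+ 2.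
    by rewrite sqmod_normc normc_nat.
  rewrite ler_pdivrMr // in n1; have := ler_norm C; set s := sqmod _ in s0 n1 *.
  have : n%:R * s <= n%:R ^+ 2 * s by rewrite ler_pM2r // expr2 ler_peMl // ler0n.
  lra.
by rewrite lerDl sqr_ge0.
Unshelve. all: by end_near. Qed.

(** A loxodromic matrix has two fixed points on the boundary, so one of them is
    finite; z is that point and m its eigenvalue. *)
Lemma fixed_point_finite M l : top_eigenvalue (sl2_val M) l -> 1 < normc l ->
  exists z m, normc m != 1 /\
    sl2_val M 0 0 * z + sl2_val M 0 1 = m * z /\ sl2_val M 1 0 * z + sl2_val M 1 1 = m.
Proof.
move=> lM l1; have [l0 lE _] := lM.
have [x [y [xy [h1 h2]]]] := eigenvector l0 lE.
have [y0|y0] := eqVneq y 0; last first.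
  exists (x / y), l; split; first by rewrite gt_eqF.
  split; apply: (mulIf y0); rewrite mulrDl -mulrA divfK //.
  by rewrite h1 -mulrA divfK.
move: xy h1 h2; rewrite y0 eqxx orbF !mulr0 !addr0 => x0 /(mulIf x0) a /eqP.
rewrite mulf_eq0 (negPf x0) orbF => /eqP c0; have [_ d] := upper_diag c0.
have ll : l^-1 - l != 0.
  apply/eqP => e; move/eqP: e; rewrite subr_eq0 => /eqP e.
  have l1' := ltW l1; move: l1.
  by rewrite -e normcV invf_gt1 ?(top_eigenvalue_gt0 lM) // ltNge l1'.
exists (sl2_val M 0 1 / (l^-1 - l)), l^-1; split.
  by rewrite normcV invr_eq1 gt_eqF.
rewrite c0 mul0r add0r d a; split=> //.
have hs : sl2_val M 0 1 / (l^-1 - l) * (l^-1 - l) = sl2_val M 0 1 by rewrite divfK.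
by move: (_ / _) hs => s <-; ring.
Qed.

Lemma hcosh_le_expR p q (D : R) : hdist p q <= D -> hcosh p q <= expR D.
Proof.
move=> h; have c1 := hcosh_ge1 p q; have /andP[h1 _] := arcosh_bounds c1.
have c0 : 0 < hcosh p q := lt_le_trans ltr01 c1.
by rewrite -(lnK c0) ler_expR (le_trans h1).
Qed.

Lemma moebiusKV A p : moebius A (moebius (A^-1)%g p) = p.
Proof. by rewrite -moebiusM mulgV; exact: moebius_one. Qed.

Lemma sl2_conj_sub1 T B : adj2 (sl2_val B) *m (sl2_val T - 1%:M) *m sl2_val B =
  sl2_val (T ^ B)%g - 1%:M.
Proof.
rewrite conjgE !sl2_valM sl2_valV mulmxBr mulmxBl mulmx1 mul_adj2 sl2_det1.
by rewrite mulmxA.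
Qed.

Lemma unipotent_conj_diag T V (x y : R) : sl2_val T 1 0 = 0 -> sl2_val T 0 0 = 1 ->
  sl2_val T 1 1 = 1 -> sl2_val V 0 0 = y%:C -> sl2_val V 0 1 = 0 ->
  sl2_val V 1 0 = 0 -> sl2_val V 1 1 = x%:C ->
  frob (sl2_val (T ^ V)%g - 1%:M) = sqmod (sl2_val T 0 1) * x ^+ 4.
Proof.
move=> c0 a1 d1 v1 v2 v3 v4; have := sl2_det1 V; rewrite det2 v1 v2 v3 v4 mul0r subr0 => yx.
have -> : sl2_val (T ^ V)%g - 1%:M = mx2 0 (sl2_val T 0 1 * x%:C ^+ 2) 0 0.
  apply: mx2P; rewrite mxE [X in _ + X]mxE conjgE !sl2_valM sl2_valV !mulmx2;
    by rewrite !mxE /= !(c0, a1, d1, v1, v2, v3, v4); ring: yx.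
rewrite /frob !mxE /= sqmodM -RC_X sqmodR -exprM /sqmod /= expr0n /=.
by rewrite !addr0 add0r.
Qed.

(** A loxodromic g0 provides a limit point other than the fixed point of the
    parabolic u. On the geodesic between them the displacement of u tends to
    zero, and by coboundedness translates of a single point follow this
    geodesic, so that conjugates of u would approach the identity. *)
Lemma no_parabolic (D : R) g0 u W : 0 < len rho g0 ->
  cobounded_on rho (limit_hull rho) D ->
  psl2_of W = rho u -> \tr (sl2_val W) = 2 -> u = 1%g.
Proof.
move=> g0len cob WE W2; apply: contrapT => u1.
have [||P [c0 a1]] := @triangularize _ W 1; first exact: oner_neq0.
  by rewrite invr1 W2; ring.
have [_ d1] := upper_diag c0; rewrite a1 invr1 in d1.
pose M := (psl2_repr (rho g0) ^ P)%g.
have [l lM] := top_eigenvalue_ex (sl2_val M).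
have ME : psl2_of M = (rho g0 ^ psl2_of P)%g by rewrite psl2_ofJ psl2_reprK.
have l1 : 1 < normc l.
  have [_ _ l1] := lM; rewrite lt_def l1 andbT; apply: contraTneq g0len => e.
  rewrite /len -(tl_conj _ (psl2_of P)) -ME (translation_lengthE lM) e ln1.
  by rewrite mulr0 ltxx.
have [z [m [m1 [hz1 hz2]]]] := fixed_point_finite lM l1.
have dN : \det (mx2 1 z 0 1) == 1 by apply/eqP; rewrite det2 !mxE /=; ring.
pose N : SL2 R := MkSL2 dN; pose A := (P * N)%g.
have [T10 T00 T01] : [/\ sl2_val (W ^ A)%g 1 0 = 0, sl2_val (W ^ A)%g 0 0 = 1 &
    sl2_val (W ^ A)%g 1 1 = 1].
  rewrite conjgM; move: (W ^ P)%g c0 a1 d1 => T c0 a1 d1.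
  rewrite conjgE !sl2_valM !sl2_valV !mulmx2 !mxE /= c0 a1 d1.
  by split; ring.
pose b := sl2_val (W ^ A)%g 0 1.
have b0 : b != 0.
  apply/eqP => b0; apply: u1; apply: rho_inj; rewrite rho_1 -WE.
  have : (W ^ A)%g = 1%g.
    by apply: val_inj; apply: mx2P; rewrite ?T00 ?T10 ?T01 -/b ?b0 !mxE.
  by move/eqP; rewrite conjg_eq1 => /eqP->.
have hull (t : R) : limit_hull rho (moebius A (vertical t)).
  apply: hull_line; first by apply: (@limit_set_parabolic u _ (W ^ A)%g) => //; rewrite psl2_ofJ WE.
  have [f1 f2] : sl2_val (M ^ (N * flip R))%g 1 0 = 0 /\ sl2_val (M ^ (N * flip R))%g 0 0 = m.
    have q0 : sl2_val (N * flip R)%g 0 0 = z.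
      by rewrite sl2_valM !mulmx2 !mxE /=; ring.
    have q1 : sl2_val (N * flip R)%g 1 0 = 1.
      by rewrite sl2_valM !mulmx2 !mxE /=; ring.
    by apply: conj_upper; rewrite q0 q1 !mulr1.
  apply: (@limit_set_fixed g0 (A * flip R)%g (M ^ (N * flip R))%g); rewrite ?f2 //.
  by rewrite psl2_ofJ ME -conjgM -psl2_ofM /A mulgA.
clearbody A.
have [d d0 hd] := discrete_at_one_conj rho_inj rho_disc A.
(* B below, which accounts for the bounded error of the translates, has
   frob B <= 2 expR D, and at parameter t the distance of u from the identity
   is sqmod b * expR (- t) ^+ 2; t makes the product less than d. *)
pose K := (2 * expR D) ^+ 2 * sqmod b + 1.
have Kge : 0 <= (2 * expR D) ^+ 2 * sqmod b by rewrite mulr_ge0 ?sqr_ge0 ?sqmod_ge0.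
have K0 : 0 < K by rewrite ltr_wpDl.
pose t := - (ln (d / K) / 2).
have et : expR (- t) ^+ 2 = d / K.
  rewrite -expRM_natl /t opprK mulrC divfK ?pnatr_eq0 // lnK // posrE.
  by rewrite divr_gt0.
have [h hh] := cob _ _ (hull 0) (hull t).
pose H := psl2_repr (rho h).
have HE : psl2_of H = rho h by exact: psl2_reprK.
apply: u1; suff : (u ^ h)%g = 1%g by move/eqP; rewrite conjg_eq1 => /eqP.
apply: (hd _ (W ^ H)%g).
  by rewrite psl2_ofJ WE HE !conjgE !gmulfM rho_V.
have dV : \det (mx2 (expR (t / 2))%:C 0 0 (expR (- (t / 2)))%:C) == 1.
  by apply/eqP; rewrite det2 !mxE /= mulr0 subr0 -RC_M -expRD subrr expR0.
pose V : SL2 R := MkSL2 dV.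
have Vo : moebius V (h3_base R) = vertical t.
  rewrite -vertical0 diag_vertical ?mxE //= add0r; congr vertical.
  rewrite expr0n addr0 sqrtr_sqr ger0_norm ?expR_ge0 // expRK.
  by rewrite mulrC divfK.
pose B := (A^-1 * (H^-1 * (A * V)))%g.
have fB : frob (sl2_val B) <= 2 * expR D.
  rewrite mulrC -ler_pdivrMr // -hcosh_base; apply: hcosh_le_expR.
  rewrite !moebiusM Vo; apply: le_trans hh; rewrite -HE psl2_actE vertical0.
  by rewrite -(hdist_moebius A) moebiusKV -(hdist_moebius H) moebiusKV.
have conjB : (((W ^ H) ^ A) ^ B = (W ^ A) ^ V)%g.
  rewrite -!conjgM; congr (W ^ _)%g.
  by rewrite /B !mulgA mulgK mulgV mul1g.
apply: le_lt_trans (frob_conj_le _ B) _.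
have -> : adj2 (sl2_val B) *m (sl2_val ((W ^ H) ^ A)%g - 1%:M) *m sl2_val B =
   sl2_val ((W ^ A) ^ V)%g - 1%:M.
  by rewrite -conjB sl2_conj_sub1.
have -> : frob (sl2_val ((W ^ A) ^ V)%g - 1%:M) = sqmod b * (d / K).
  have [v1 v2] : sl2_val V 0 0 = (expR (t / 2))%:C /\ sl2_val V 0 1 = 0.
    by rewrite !mxE.
  have [v3 v4] : sl2_val V 1 0 = 0 /\ sl2_val V 1 1 = (expR (- (t / 2)))%:C.
    by rewrite !mxE.
  rewrite (unipotent_conj_diag T10 T00 T01 v1 v2 v3 v4) -et -!expRM_natl.
  by congr (_ * expR _); field.
have fB2 : frob (sl2_val B) ^+ 2 <= (2 * expR D) ^+ 2.
  by rewrite ler_pXn2r ?nnegrE ?frob_ge0 ?mulr_ge0 ?expR_ge0.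
apply: le_lt_trans (ler_wpM2r _ fB2) _.
  by rewrite mulr_ge0 ?sqmod_ge0 // divr_ge0 // ltW.
have KQ : (2 * expR D) ^+ 2 * sqmod b < K by rewrite /K ltrDl.
have -> : (2 * expR D) ^+ 2 * (sqmod b * (d / K)) =
  d * ((2 * expR D) ^+ 2 * sqmod b / K) by ring.
by rewrite gtr_pMr // ltr_pdivrMr // mul1r.
Qed.

Lemma len0_torsion (D : R) g0 u : 0 < len rho g0 ->
  cobounded_on rho (limit_hull rho) D -> len rho u = 0 ->
  exists2 n, (0 < n)%N & (u ^+ n = 1)%g.
Proof.
move=> g0len cob u0; apply: contrapT => nt.
have ut : non_torsion u by move=> n n0 un; apply: nt; exists n.
have [W WE W2] := len0_unipotent u0 ut.
by apply: (ut 1%N) => //; rewrite expg1 (no_parabolic g0len cob WE W2).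
Qed.

Lemma trace_gt2 M : 2 < normc (\tr (sl2_val M)) ->
  0 < translation_length (psl2_of M).
Proof.
move=> h; rewrite lt_def tl_ge0 andbT; apply: contraTneq h => h.
by rewrite -leNgt (le_trans (trace_le_tl _)) // h mul0r expR0 mulr1.
Qed.

(** Commutators of upper triangular matrices are unipotent, and unipotent upper
    triangular matrices commute: double commutators vanish. *)
Lemma upper_comm A B : sl2_val A 1 0 = 0 -> sl2_val B 1 0 = 0 ->
  sl2_val [~ A, B]%g 1 0 = 0 /\ sl2_val [~ A, B]%g 0 0 = 1.
Proof.
move=> a0 b0; have [a1 da] := upper_diag a0; have [b1 db] := upper_diag b0.
rewrite !sl2_valM !sl2_valV !mulmx2 !mxE /= a0 b0 da db.
by split; field; rewrite ?a1 ?b1.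
Qed.

Lemma unipotent_comm A B : sl2_val A 1 0 = 0 -> sl2_val A 0 0 = 1 ->
  sl2_val B 1 0 = 0 -> sl2_val B 0 0 = 1 -> [~ A, B]%g = 1%g.
Proof.
move=> a0 a1 b0 b1; have [_ da] := upper_diag a0; have [_ db] := upper_diag b0.
rewrite a1 invr1 in da; rewrite b1 invr1 in db.
apply/eqP/commgP; apply: val_inj => /=; apply: mx2P;
  by rewrite !mulmx2 !(a0, b0, da, db, a1, b1); ring.
Qed.

(** If every element had length zero, an element of infinite order would be
    parabolic, M = (1 b; 0 1) in suitable coordinates, and the boundedness of
    tr (M^n W) = tr W + n b c would make every W = ( * * ; c * ) of the image
    upper triangular. *)
Lemma exists_loxodromic (g x y z t : G) : non_torsion g ->
  [~ [~ x, y], [~ z, t]]%g <> 1%g :> G -> exists g0, 0 < len rho g0.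
Proof.
move=> gt nab; apply: contrapT => nolox.
have len0 u : len rho u = 0.
  apply/eqP; rewrite eq_le tl_ge0 andbT leNgt; apply/negP => h.
  by apply: nolox; exists u.
have [M ME M2] := len0_unipotent (len0 g) gt.
have [||A [c0 a1]] := @triangularize _ M 1; first exact: oner_neq0.
  by rewrite invr1 M2; ring.
have [_ d1] := upper_diag c0; rewrite a1 invr1 in d1.
pose b := sl2_val (M ^ A)%g 0 1.
have b0 : b != 0.
  apply/eqP => b0; apply: (gt 1%N) => //; rewrite expg1.
  apply: rho_inj; rewrite rho_1 -ME.
  have : (M ^ A)%g = 1%g.
    by apply: val_inj; apply: mx2P; rewrite ?a1 ?c0 ?d1 -/b ?b0 !mxE.
  by move/eqP; rewrite conjg_eq1 => /eqP->.
pose W u := (psl2_repr (rho u) ^ A)%g.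
have WE u : psl2_of (W u) = (rho u ^ psl2_of A)%g by rewrite psl2_ofJ psl2_reprK.
have Wc u : sl2_val (W u) 1 0 = 0.
  apply/eqP; rewrite -normc_eq0 eq_le normc_ge0 andbT leNgt; apply/negP => cp.
  pose c := sl2_val (W u) 1 0.
  have bc0 : 0 < normc (b * c).
    by rewrite normcM mulr_gt0 // lt_def normc_eq0 b0 normc_ge0.
  have trn n : normc (\tr (sl2_val (W u)) + n%:R * (b * c)) <= 2.
    rewrite -(trace_unipotent_mul _ n c0 a1).
    rewrite leNgt; apply/negP => /trace_gt2; rewrite psl2_ofM psl2_ofX psl2_ofJ ME WE.
    rewrite -conjXg -conjMg tl_conj -rho_X -gmulfM.
    by have := len0 (g ^+ n * u)%g; rewrite /len => ->; rewrite ltxx.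
  have n0 := archi_boundP (_ : 0 <= 4 / normc (b * c)).
  have {n0} := n0 (divr_ge0 (ler0n _ 4) (ltW bc0)); set n := Num.bound _ => hn.
  have := trn n; have := trn 0%N; rewrite mul0r addr0.
  have := ler_normcB (\tr (sl2_val (W u)) + n%:R * (b * c)) (\tr (sl2_val (W u))).
  rewrite addrAC subrr add0r normcM normc_nat.
  by move: hn; rewrite ltr_pdivrMr //; lra.
clearbody W; apply: nab; apply: rho_inj; rewrite rho_1; apply: (@conjg_inj _ (psl2_of A)).
have com u v : rho [~ u, v]%g = [~ rho u, rho v]%g.
  by rewrite !gmulfM !rho_V.
rewrite conj1g !com !conjRg -!WE.
have comP (X Y : SL2 R) : psl2_of [~ X, Y]%g = [~ psl2_of X, psl2_of Y]%g.
  by rewrite !psl2_ofM !psl2_ofV.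
rewrite -(comP (W x) (W y)) -(comP (W z) (W t)) -(comP [~ W x, W y]%g).
have [p1 p2] := upper_comm (Wc x) (Wc y).
have [p3 p4] := upper_comm (Wc z) (Wc t).
by rewrite (unipotent_comm p1 p2 p3 p4).
Qed.

Lemma conj_flip T : [/\ sl2_val (T ^ flip R)%g 0 0 = sl2_val T 1 1,
  sl2_val (T ^ flip R)%g 0 1 = - sl2_val T 1 0 &
  sl2_val (T ^ flip R)%g 1 0 = - sl2_val T 0 1].
Proof.
by rewrite conjgE !sl2_valM !sl2_valV !mulmx2 !mxE /=; split; ring.
Qed.

(** Suppose that phi g0 = 1, and let w be the matrix of g in coordinates where
    g0 is diagonal with top entry l, |l| > 1. The elements g0 ^+ n * g have the
    same image as g and traces l^n w00 + l^-n w11, which grow unless w00 = 0.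
    Likewise for g0^-1 unless w11 = 0. If both vanish then g has order 2, and
    so does phi g. *)
Lemma exists_loxodromic_hom (H : groupType) (phi : G -> H) g0 g :
  (forall x y, phi (x * y)%g = (phi x * phi y)%g) ->
  (forall h : H, h <> 1%g -> (h ^+ 2)%g <> 1%g) ->
  0 < len rho g0 -> phi g <> 1%g -> exists2 g1, 0 < len rho g1 & phi g1 <> 1%g.
Proof.
move=> phiM tf g0l pg.
have phi1 : phi 1%g = 1%g by apply: (mulgI (phi 1%g)); rewrite -phiM !mulg1.
have [pg0|] := pselect (phi g0 = 1%g); last by exists g0.
have phiX n : phi (g0 ^+ n)%g = 1%g.
  by elim: n => [|n IH]; rewrite ?expg0 // expgS phiM IH pg0 mulg1.
have phiV : phi (g0^-1)%g = 1%g.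
  by apply: (mulgI (phi g0)); rewrite -phiM mulgV phi1 pg0 mulg1.
have phiXV n : phi ((g0^-1) ^+ n)%g = 1%g.
  by elim: n => [|n IH]; rewrite ?expg0 // expgS phiM IH phiV mulg1.
have [A [T [TE [b0 c0 l1 _]]]] := loxodromic_diag g0l.
pose W := (psl2_repr (rho g) ^ A)%g.
have WE : psl2_of W = (rho g ^ psl2_of A)%g by rewrite psl2_ofJ psl2_reprK.
clearbody W.
have grow (T' W' : SL2 R) : sl2_val T' 0 1 = 0 -> sl2_val T' 1 0 = 0 ->
    1 < normc (sl2_val T' 0 0) -> sl2_val W' 0 0 != 0 ->
    exists n, 2 < normc (\tr (sl2_val (T' ^+ n * W')%g)).
  move=> b0' c0' l1' w0; apply: contrapT => h.
  have [_ d] := upper_diag c0'; set l := sl2_val T' 0 0 in l1' d.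
  have Tn n : [/\ sl2_val (T' ^+ n)%g 0 0 = l ^+ n, sl2_val (T' ^+ n)%g 0 1 = 0,
      sl2_val (T' ^+ n)%g 1 0 = 0 & sl2_val (T' ^+ n)%g 1 1 = l^-1 ^+ n].
    elim: n => [|n [h1 h2 h3 h4]]; first by rewrite expg0 !mxE.
    rewrite expgS sl2_valM !mulmx2 h1 h2 h3 h4 b0' c0' d -/l !exprS.
    by split; ring.
  have w0' : 0 < normc (sl2_val W' 0 0) by rewrite lt_def normc_eq0 w0 normc_ge0.
  suff : normc l <= 1 by rewrite leNgt l1'.
  apply: (@expr_bounded_le1 R _ ((2 + normc (sl2_val W' 1 1)) / normc (sl2_val W' 0 0))).
    exact: normc_ge0.
  move=> n; rewrite ler_pdivlMr // -normcX -normcM.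
  have [h1 h2 h3 h4] := Tn n.
  have := h; move/forallNP/(_ n)/negP; rewrite -leNgt sl2_valM trace2 !mulmx2 h1 h2 h3 h4.
  rewrite !mul0r addr0 add0r => h5.
  have h6 := ler_normcB (l ^+ n * sl2_val W' 0 0 + l^-1 ^+ n * sl2_val W' 1 1)
     (l^-1 ^+ n * sl2_val W' 1 1).
  rewrite addrK in h6; apply: le_trans h6 _; rewrite lerD // normcM normcX normcV.
  apply: ler_piMl; first exact: normc_ge0.
  by rewrite exprn_ile1 // ?invr_ge0 ?normc_ge0 // invf_le1 ?ltW // (lt_trans ltr01).
have [w00|w0] := eqVneq (sl2_val W 0 0) 0; last first.
  have [n hn] := grow _ _ b0 c0 l1 w0.
  exists (g0 ^+ n * g)%g; last by rewrite phiM phiX mul1g.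
  have := trace_gt2 hn; rewrite psl2_ofM psl2_ofX TE WE -conjXg -conjMg tl_conj.
  by rewrite -rho_X -gmulfM.
have [w11|w1] := eqVneq (sl2_val W 1 1) 0; last first.
  pose T' := ((T^-1) ^ flip R)%g; pose W' := (W ^ flip R)%g.
  have [_ d] := upper_diag c0.
  have [n hn] : exists n, 2 < normc (\tr (sl2_val (T' ^+ n * W')%g)).
    have [f1 f2 f3] := conj_flip (T^-1)%g; have [f4 _ _] := conj_flip W.
    apply: grow; rewrite /T' /W' ?f1 ?f2 ?f3 ?f4 // sl2_valV !mxE /= ?b0 ?c0 ?oppr0 //.
  exists ((g0^-1) ^+ n * g)%g; last by rewrite phiM phiXV mul1g.
  have := trace_gt2 hn; rewrite psl2_ofM psl2_ofX /T' /W' (psl2_ofJ W) WE.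
  rewrite (psl2_ofJ (T^-1)%g) psl2_ofV TE.
  rewrite -!conjVg -!conjXg -!conjMg !tl_conj.
  by rewrite -rho_V -rho_X -gmulfM.
case: (tf _ pg); rewrite expg2 -phiM -[RHS]phi1; congr phi.
apply: rho_inj; rewrite rho_1 gmulfM; apply: (@conjg_inj _ (psl2_of A)).
rewrite conj1g conjMg -WE -psl2_ofM.
have -> : (W * W)%g = sl2_opp (sl2_one R).
  apply: val_inj => /=; have := sl2_det1 W; rewrite det2 w00 w11 mul0r sub0r => d.
  have d' : sl2_val W 0 1 * sl2_val W 1 0 = -1 by rewrite -d opprK.
  by apply: mx2P; rewrite mulmx2 !mxE /= ?w00 ?w11; ring: d'.
exact: psl2_of_opp.
Qed.

End Rho.
End Torsion.

(** * Comparison of length functions *)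

Section Comparison.
Variable R : realType.
Implicit Types (p q : H3 R) (D L M : R).

Section Walk.
Variables (G : groupType) (rho : {multiplicative G -> PSL2 R}).

Lemma len_ge0 g : 0 <= len rho g. Proof. exact: tl_ge0. Qed.

Lemma len_X g n : len rho (g ^+ n)%g = n%:R * len rho g.
Proof. by rewrite /len rho_X tl_X. Qed.

Lemma len_1 : len rho 1%g = 0.
Proof. by rewrite -(expg0 (1%g : G)) len_X mul0r. Qed.

Lemma len_conj g h : len rho (g ^ h)%g = len rho g.
Proof. by rewrite /len !conjgE !gmulfM rho_V -conjgE tl_conj. Qed.

Lemma len_torsion g n : (0 < n)%N -> (g ^+ n)%g = 1%g -> len rho g = 0.
Proof.
move=> n0 gn; have /eqP := len_X g n; rewrite gn len_1 eq_sym mulf_eq0.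
by rewrite pnatr_eq0 eqn0Ngt n0 => /eqP.
Qed.

Lemma len_le_hdist g p : len rho g <= hdist p (psl2_act (rho g) p).
Proof. exact: tl_le_hdist. Qed.

Lemma hdist_rho g p q :
  hdist (psl2_act (rho g) p) (psl2_act (rho g) q) = hdist p q.
Proof. exact: hdist_psl2. Qed.

Lemma hdist_refl p : hdist p p = 0.
Proof.
have /andP[_] := arcosh_bounds (hcosh_ge1 p p).
rewrite hdistE /hcosh !subrr /sqmod /= expr0n /= !addr0 mul0r addr0 mulr1.
move=> _; rewrite /arcosh expr1n subrr sqrtr0 addr0.
exact: ln1.
Qed.

Lemma prodg_telescope (h : nat -> G) k m :
  prodg [seq ((h i)^-1 * h i.+1)%g | i <- iota k m] = ((h k)^-1 * h (k + m)%N)%g.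
Proof.
elim: m k => [|m IH] k; first by rewrite addn0 mulVg.
by rewrite /= IH addSnnS mulgA mulgK.
Qed.

(** The period of the axis of g is divided into m steps, with division points
    y 0, ..., y m = g (y 0), and y i is approximated by a translate h i (y 0),
    where h 0 = 1 and h m = g. Then g is the product of the (h i)^-1 h (i + 1). *)
Lemma walk D g m : 0 <= D -> cobounded_on rho (limit_hull rho) D ->
  0 < len rho g -> (0 < m)%N -> exists p (us : seq G),
  [/\ limit_hull rho p, size us = m, prodg us = g & forall u, u \in us ->
      hdist p (psl2_act (rho u) p) <= 2 * D + len rho g / m%:R].
Proof.
move=> D0 cob gl m0; have [A [hull act]] := loxodromic_axis gl.
pose l := len rho g; pose y (i : nat) := moebius A (vertical (i%:R * (l / m%:R))).
have mR : m%:R != 0 :> R by rewrite pnatr_eq0 -lt0n.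
have y0 : y 0%N = moebius A (vertical 0) by rewrite /y mul0r.
have /choice[h hh] : forall i : nat, exists h : G,
    [/\ hdist (psl2_act (rho h) (y 0%N)) (y i) <= D, i = 0%N -> h = 1%g & i = m -> h = g].
  move=> i; have [->|i0] := eqVneq i 0%N.
    exists 1%g; split=> //; first by rewrite rho_1 psl2_act1 hdist_refl.
    by move=> e; rewrite -e in m0.
  have [->|im] := eqVneq i m.
    exists g; split=> //; last by move=> e; rewrite e in m0.
    by rewrite y0 act add0r /y mulrC divfK // hdist_refl.
  have [h hD] := cob _ _ (hull 0) (hull (i%:R * (l / m%:R))).
  exists h; split; first by rewrite y0.
    by move=> e; rewrite e eqxx in i0.
  by move=> e; rewrite e eqxx in im.
exists (y 0%N), [seq ((h i)^-1 * h i.+1)%g | i <- iota 0 m]; split.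
- by rewrite y0.
- by rewrite size_map size_iota.
- rewrite prodg_telescope add0n.
  have [_ -> // _] := hh 0%N; have [_ _ -> //] := hh m.
  by rewrite invg1 mul1g.
move=> u /mapP[i _ ->]; rewrite -(hdist_rho (h i)) -psl2_actM -gmulfM mulVKg.
have [h1 _ _] := hh i; have [h2 _ _] := hh i.+1.
apply: le_trans (hdist_triangle (y i) _ _) _.
apply: le_trans (lerD h1 (hdist_triangle (y i.+1) _ _)) _.
rewrite (hdistC (y i.+1)); apply: le_trans (lerD (lexx D) (lerD _ h2)) _.
  by rewrite /y hdist_moebius hdist_vertical.
have -> : i%:R * (l / m%:R) - i.+1%:R * (l / m%:R) = - (l / m%:R).
  by rewrite -natr1; ring.
rewrite normrN ger0_norm; last by rewrite divr_ge0 // ?ler0n // len_ge0.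
by rewrite -/l; lra.
Qed.

Lemma prodg_hom (H : groupType) (phi : G -> H) (us : seq G) :
  (forall x y, phi (x * y)%g = (phi x * phi y)%g) ->
  (forall u, u \in us -> phi u = 1%g) -> phi (prodg us) = 1%g.
Proof.
move=> phiM; have phi1 : phi 1%g = 1%g.
  by apply: (mulgI (phi 1%g)); rewrite -phiM !mulg1.
elim: us => [|u us IH] h //=; rewrite phiM h ?inE ?eqxx // mul1g; apply: IH.
by move=> v vus; apply: h; rewrite inE vus orbT.
Qed.

Hypotheses (rho_inj : injective rho) (rho_disc : discrete_image rho).

(** Some step of [walk] is loxodromic: otherwise all steps would have finite
    order, hence trivial image in the torsion-free group H. *)
Lemma short_loxodromic D L (H : groupType) (phi : G -> H) g :
  0 <= D -> 2 * D < L -> cobounded_on rho (limit_hull rho) D ->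
  (forall x y, phi (x * y)%g = (phi x * phi y)%g) ->
  (forall (h : H) n, (0 < n)%N -> h <> 1%g -> (h ^+ n)%g <> 1%g) ->
  0 < len rho g -> phi g <> 1%g -> exists u, 0 < len rho u <= L.
Proof.
move=> D0 DL cob phiM tf gl pg.
pose m := (Num.truncn (len rho g / (L - 2 * D))).+1.
have LD : 0 < L - 2 * D by rewrite subr_gt0.
have m1 : len rho g / m%:R <= L - 2 * D.
  rewrite ler_pdivrMr ?ltr0n // mulrC -ler_pdivrMr // ltW //.
  by have /andP[] := truncn_itv (divr_ge0 (len_ge0 g) (ltW LD)).
have [p [us [_ _ usg hus]]] := walk D0 cob gl (ltn0Sn _ : (0 < m)%N).
have [u uus pu] : exists2 u, u \in us & phi u <> 1%g.
  apply: contrapT => h; apply: pg; rewrite -usg; apply: prodg_hom => // u uus.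
  by apply: contrapT => pu; apply: h; exists u.
exists u; apply/andP; split; last first.
  apply: le_trans (len_le_hdist u p) _; apply: le_trans (hus u uus) _; lra.
rewrite lt_def len_ge0 andbT; apply/eqP => u0.
have [n n0 un] := len0_torsion rho_inj rho_disc gl cob u0.
apply: (tf (phi u) n n0 pu).
have phi1 : phi 1%g = 1%g by apply: (mulgI (phi 1%g)); rewrite -phiM !mulg1.
rewrite -phi1 -un; elim: (n) => [|k IH]; first by rewrite !expg0 phi1.
by rewrite !expgS phiM IH.
Qed.

(** Conjugation moves a point of the axis of g into the D-ball around p, and
    then the displacement of p is at most 2 D + L. *)
Lemma finitely_many_short D L p : 0 <= D -> cobounded_on rho (limit_hull rho) D ->
  limit_hull rho p -> exists s : seq G, forall g, 0 < len rho g <= L ->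
  exists2 g', g' \in s & exists h, g' = (g ^ h)%g.
Proof.
move=> D0 cob hp; have [B pE] := transitive_base p.
have [s hs] := discrete_finite_ball rho_inj rho_disc
  (frob (sl2_val B) ^+ 2 * (2 * expR (2 * D + L))).
exists s => g /andP[gl gL]; have [A [hull act]] := loxodromic_axis gl.
have [h hh] := cob _ _ hp (hull 0).
exists (g ^ h)%g; last by exists h.
apply: hs; set W := psl2_repr _.
apply: le_trans (frob_conj_le _ B) _.
rewrite ler_wpM2l ?sqr_ge0 //.
have -> : adj2 (sl2_val B) *m sl2_val W *m sl2_val B = sl2_val (W ^ B)%g.
  by rewrite conjgE !sl2_valM sl2_valV mulmxA.
rewrite mulrC -ler_pdivrMr // -hcosh_base; apply: hcosh_le_expR.
have -> : moebius (W ^ B)%g (h3_base R) = moebius (B^-1)%g (moebius W p).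
  by rewrite conjgE !moebiusM pE.
rewrite -(hdist_moebius B) moebiusKV -pE -psl2_actE psl2_reprK.
set x := moebius A (vertical 0) in hh.
rewrite conjgE !gmulfM rho_V !psl2_actM -(hdist_rho h) -psl2_actM mulgV psl2_act1.
apply: le_trans (hdist_triangle x _ _) _.
apply: le_trans (lerD hh (hdist_triangle (psl2_act (rho g) x) _ _)) _.
rewrite hdist_rho (hdistC x (psl2_act _ p)).
have -> : hdist x (psl2_act (rho g) x) = len rho g.
  by rewrite /x act hdist_moebius hdist_vertical distrC ?add0r subr0 ger0_norm // len_ge0.
by have := hh; lra.
Qed.

End Walk.

Lemma seq_max (s : seq R) x0 : x0 \in s ->
  exists2 m, m \in s & forall x, x \in s -> x <= m.
Proof.
elim: s x0 => // a s IH x0 _; case: s IH => [|b s] IH.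
  by exists a; rewrite ?inE // => x; rewrite inE => /eqP->.
have [m ms hm] := IH b (mem_head _ _).
exists (Num.max a m).
  by rewrite inE /Num.max; case: ifP => _; rewrite ?eqxx ?ms ?orbT.
by move=> x; rewrite inE le_max => /orP[/eqP->|/hm->]; rewrite ?lexx ?orbT.
Qed.

(** Passage from the powers of an element to the element itself. *)
Lemma archimedean_le (a b c : R) : (forall n : nat, n%:R * a <= n%:R * b + c) -> a <= b.
Proof.
move=> h; rewrite leNgt; apply/negP => ab.
have d0 : 0 < a - b by rewrite subr_gt0.
have := archi_boundP (divr_ge0 (normr_ge0 c) (ltW d0)).
set n := Num.bound _; rewrite ltr_pdivrMr // => hn.
by have := h n; have := ler_norm c; lra.
Qed.

Section TwoReps.
Variables (G : groupType) (rho rho' : {multiplicative G -> PSL2 R}).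

(** With steps of length at most s = L / 2 - 2 D, [walk] has displacements at
    most L / 2. The number m of steps for a power of g is its length over s
    rounded up; the rounding contributes one constant C, which is negligible
    for large powers. *)
Lemma length_comparison D L M g :
  0 <= D -> cobounded_on rho (limit_hull rho) D -> 4 * D < L -> 0 <= M ->
  (forall u, len rho u <= L -> len rho' u <= M * len rho u) ->
  0 < len rho g -> len rho' g <= len rho g * ((M * L + 4 * ln 31) / (L - 4 * D)).
Proof.
move=> D0 cob DL M0 hM gl.
pose s := L / 2 - 2 * D; have s0 : 0 < s by rewrite /s; lra.
pose C := M * (L / 2) + 2 * ln 31.
have C0 : 0 <= C.
  have L2 : 0 <= L / 2 by lra.
  have ln31 : 0 <= ln 31 :> R by rewrite ln_ge0 // ler1n.
  by rewrite /C; have := mulr_ge0 M0 L2; lra.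
have -> : (M * L + 4 * ln 31) / (L - 4 * D) = C / s.
  by rewrite /C /s; field; apply: lt0r_neq0; lra.
apply: (@archimedean_le _ _ C) => -[|j]; first by rewrite !mul0r add0r.
pose gj := (g ^+ j.+1)%g; rewrite -len_X -/gj mulrA -len_X -/gj.
have gjl : 0 < len rho gj by rewrite /gj len_X mulr_gt0 // ltr0n.
pose m := (Num.truncn (len rho gj / s)).+1.
have /andP[m1 m2] := truncn_itv (divr_ge0 (ltW gjl) (ltW s0)).
have [p [us [_ usm usg hus]]] := walk D0 cob gjl (ltn0Sn _ : (0 < m)%N).
have dus u : u \in us -> hdist p (psl2_act (rho u) p) <= L / 2.
  move=> /hus h; apply: le_trans h _.
  suff : len rho gj / m%:R <= s by rewrite /s; lra.
  by rewrite ler_pdivrMr ?ltr0n // mulrC -ler_pdivrMr // ltW.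
have lus u : u \in us -> len rho u <= L / 2.
  by move=> /dus; apply: le_trans; exact: len_le_hdist.
have luv u v : u \in us -> v \in us -> len rho (u * v)%g <= L.
  move=> uu vu; apply: le_trans (len_le_hdist _ _ p) _.
  rewrite gmulfM psl2_actM; apply: le_trans (hdist_triangle (psl2_act (rho u) p) _ _) _.
  by rewrite hdist_rho; have := dus _ uu; have := dus _ vu; lra.
pose f (u : G) := psl2_repr (rho' u).
have fE u : psl2_of (f u) = rho' u by exact: psl2_reprK.
have prodE t : psl2_of (prodg (map f t)) = rho' (prodg t).
  elim: t => [|u t IH] /=; first by rewrite rho_1.
  by rewrite psl2_ofM IH fE gmulfM.
have L0 : 0 < L by lra.
have := @tl_prod_bound R (map f us) (M * (L / 2)).
rewrite size_map usm prodE usg -/(len rho' gj) => h.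
apply: (@le_trans _ _ (m%:R * C)).
  apply: h; first by rewrite mulr_ge0 // divr_ge0 // ltW.
    move=> _ /mapP[u uu ->]; rewrite fE -/(len rho' u).
    have lu := lus _ uu; apply: le_trans (hM u _) _; first by lra.
    by rewrite ler_wpM2l.
  move=> _ _ /mapP[u uu ->] /mapP[v vu ->]; rewrite psl2_ofM !fE -gmulfM.
  rewrite -/(len rho' _); apply: le_trans (hM _ (luv _ _ uu vu)) _.
  have -> : 2 * (M * (L / 2)) = M * L by field.
  by rewrite ler_wpM2l // luv.
rewrite /m -natr1 mulrDl mul1r lerD2r mulrA mulrAC.
by rewrite ler_wpM2r.
Qed.

End TwoReps.

End Comparison.

(** * Monodromy of a flat jump function *)

Section Lifts.
Context {Y : topologicalType} {H : groupType}.
Implicit Types (s : Y -> Y -> H) (D : set Y) (K : Y -> H).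

(** Here s y z is the jump that is prescribed from y to a nearby point z; a lift
    integrates the jumps, as a section of a flat H-bundle. *)
Definition is_lift s D K :=
  forall y, D y -> \forall z \near y, D z -> K z = (K y * s y z)%g.

Lemma lift_sub s D D' K : D' `<=` D -> is_lift s D K -> is_lift s D' K.
Proof.
move=> sD h y /sD/h; apply: filterS => z hz /sD; exact: hz.
Qed.

Lemma lift_mull s D K k : is_lift s D K -> is_lift s D (fun y => k * K y)%g.
Proof.
by move=> h y /h; apply: filterS => z hz Dz; rewrite hz // mulgA.
Qed.

Lemma lift_ratio s D K K' : is_lift s D K -> is_lift s D K' ->
  forall y, D y ->
    \forall z \near y, D z -> (K z * (K' z)^-1 = K y * (K' y)^-1)%g.
Proof.
move=> h h' y Dy; have := h' y Dy; have := h y Dy; apply: filterS2 => z hz hz' Dz.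
by rewrite hz // hz' // invgM mulgA mulgK.
Qed.

Lemma lift_glue s D1 D2 K1 K2 : closed D1 -> closed D2 ->
  is_lift s D1 K1 -> is_lift s D2 K2 ->
  (forall y, D1 y -> D2 y -> K1 y = K2 y) ->
  is_lift s (D1 `|` D2) (fun y => if `[< D1 y >] then K1 y else K2 y).
Proof.
move=> c1 c2 l1 l2 e y D12.
have n1 : \forall z \near y, D1 z -> D1 y /\ K1 z = (K1 y * s y z)%g.
  have [Dy|Dy] := pselect (D1 y).
    by have := l1 y Dy; apply: filterS => z h /h ->.
  have : nbhs y (~` D1) by apply: open_nbhs_nbhs; split => //; exact: closed_openC.
  by apply: filterS => z.
have n2 : \forall z \near y, D2 z -> D2 y /\ K2 z = (K2 y * s y z)%g.
  have [Dy|Dy] := pselect (D2 y).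
    by have := l2 y Dy; apply: filterS => z h /h ->.
  have : nbhs y (~` D2) by apply: open_nbhs_nbhs; split => //; exact: closed_openC.
  by apply: filterS => z.
move: n1 n2; apply: filterS2 => z h1 h2 D12z.
case: asboolP => [/h1[D1y ->]|nD1]; first by rewrite asboolT.
case: D12z => // /h2[D2y ->]; case: asboolP => // D1y.
by rewrite e.
Qed.

End Lifts.

Section RealLifts.
Variable R : realType.

(** Real induction: the supremum of the endpoints reached from c can be passed
    unless it is d. *)
Lemma interval_induction (Q : R -> R -> Prop) c d : c <= d ->
  (forall y, c <= y <= d -> exists2 e, 0 < e &
     forall u v, c <= u -> u <= v -> v <= d -> y - e < u -> v < y + e -> Q u v) ->
  (forall u v w, u <= v -> v <= w -> Q u v -> Q v w -> Q u w) -> Q c d.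
Proof.
move=> cd loc glue; pose S := [set v | c <= v <= d /\ Q c v].
have Sc : S c.
  split; first by rewrite lexx.
  have [|e e0] := loc c; first by rewrite lexx.
  by apply; rewrite ?lexx //; lra.
have Sd : ubound S d by move=> v [/andP[]].
have hS : has_sup S by split; [exists c | exists d].
have m1 : c <= sup S by apply: ub_le_sup => //; exists d.
have m2 : sup S <= d by apply: ge_sup => //; exists c.
have [|e e0 he] := loc (sup S); first by rewrite m1.
have [v [/andP[cv vd] Qv] mv] := sup_adherent e0 hS.
have vm : v <= sup S by apply: ub_le_sup; [exists d | split; rewrite ?cv].
have [w [vw wd we wE]] : exists w, [/\ v <= w, w <= d, w < sup S + e &
    w = d \/ w = sup S + e / 2].
  have [h|h] := leP d (sup S + e / 2).
    by exists d; split => //; [lra|left].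
  by exists (sup S + e / 2); split => //; [lra|lra|lra|right].
have Qw : Q c w by apply: (glue _ v) => //; apply: he.
case: wE => [<- //|wE]; have : w <= sup S.
  by apply: ub_le_sup; [exists d | split=> //; rewrite (le_trans cv)].
by rewrite wE; lra.
Qed.

Lemma near_itvP (P : set R) (y : R) : (\forall z \near y, P z) ->
  exists2 e, 0 < e & forall z, y - e < z -> z < y + e -> P z.
Proof.
move=> /nbhs_ballP[e /= e0 he]; exists e => // z h1 h2; apply: he.
by rewrite /ball /= ltr_norml; apply/andP; split; lra.
Qed.

Lemma locally_constant (T : Type) (F : R -> T) a b : a <= b ->
  (forall y, a <= y <= b -> \forall z \near y, a <= z <= b -> F z = F y) ->
  forall y, a <= y <= b -> F y = F a.
Proof.
move=> ab loc y /andP[ay yb]; symmetry.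
apply: (@interval_induction (fun u v => F u = F v)) => // [x /andP[ax xb]|u v w _ _ -> //].
have [|e e0 he] := near_itvP (loc x _); first by rewrite ax; lra.
exists e => // u v h1 h2 h3 h4 h5.
by rewrite !he //; lra.
Qed.

Context {Y : topologicalType} {H : groupType}.
Implicit Types (s : Y -> Y -> H) (D : set Y) (K : Y -> H).

(** Two lifts differ by a left constant along the arc in which D1 and D2 meet,
    and left multiplication of one of them removes the difference. *)
Lemma lift_glue_arc s D1 D2 K1 K2 (g : R -> Y) a b :
  closed D1 -> closed D2 -> a <= b -> continuous g ->
  (forall x, a <= x <= b -> D1 (g x) /\ D2 (g x)) ->
  (forall y, D1 y -> D2 y -> exists2 x, a <= x <= b & y = g x) ->
  is_lift s D1 K1 -> is_lift s D2 K2 ->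
  exists K, is_lift s (D1 `|` D2) K.
Proof.
move=> c1 c2 ab cg gD Dg l1 l2.
pose F x := (K1 (g x) * (K2 (g x))^-1)%g.
have Fc := @locally_constant _ F a b ab.
eexists; apply: (lift_glue c1 c2 l1 (lift_mull (F a) l2)).
move=> y /Dg h /h{h}[x xab ->]; rewrite -(Fc _ x) // /F ?mulgVK //.
move=> {xab}x xab; have [D1x D2x] := gD x xab.
have : \forall z \near x, (D1 `&` D2) (g z) -> F z = F x.
  exact: cg x _ (lift_ratio (D := D1 `&` D2) (lift_sub (@subIsetl _ _ _) l1)
    (lift_sub (@subIsetr _ _ _) l2) (conj D1x D2x)).
by apply: filterS => z h zab; apply: h; apply: gD.
Qed.

End RealLifts.

Lemma continuous_pair (T U V : topologicalType) (f : T -> U) (g : T -> V) :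
  continuous f -> continuous g -> continuous (fun t => (f t, g t)).
Proof.
by move=> cf cg t; apply: (@cvg_pair _ _ _ (nbhs t) (nbhs _) (nbhs _));
  [exact: cf|exact: cg].
Qed.

Section Boxes.
Context {R : realType} {H : groupType}.
Implicit Types (s : R * R -> R * R -> H) (K : R * R -> H).

Definition box (a b c d : R) : set (R * R) :=
  [set p | a <= p.1 <= b /\ c <= p.2 <= d].

Lemma closed_box a b c d : closed (box a b c d).
Proof.
have -> : box a b c d = (fst @^-1` `[a, b]) `&` (snd @^-1` `[c, d]).
  by apply/seteqP; split => p; rewrite /box /= !in_itv.
apply: closedI; apply: closed_comp.
- by move=> p _; exact: cvg_fst.
- exact: itv_closed.
- by move=> p _; exact: cvg_snd.
- exact: itv_closed.
Qed.

Lemma near_boxP (P : set (R * R)) p : (\forall z \near p, P z) ->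
  exists2 e, 0 < e & forall z, p.1 - e <= z.1 <= p.1 + e ->
    p.2 - e <= z.2 <= p.2 + e -> P z.
Proof.
move=> /nbhs_ballP[e /= e0 he]; exists (e / 2); first lra.
move=> z /andP[h1 h2] /andP[h3 h4]; apply: he; split => /=;
by rewrite /ball /= ltr_norml; apply/andP; split; lra.
Qed.

(** A local lift exists near each point of a vertical segment, so real
    induction gives one around the segment; a second induction, over the
    abscissa, gives one on the box. *)
Theorem lift_box s a b c d : a <= b -> c <= d ->
  (forall y, box a b c d y -> exists K, \forall z \near y, box a b c d z ->
     \forall z' \near z, box a b c d z' -> K z' = (K z * s z z')%g) ->
  exists K, is_lift s (box a b c d) K.
Proof.
move=> ab cd flat.
pose near_box (x e u v : R) := box (Num.max a (x - e)) (Num.min b (x + e)) u v.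
have col x : a <= x <= b -> exists2 e, 0 < e &
    exists K, is_lift s (near_box x e c d) K.
  move=> /andP[ax xb].
  apply: (@interval_induction R (fun u v => exists2 e, 0 < e &
    exists K, is_lift s (near_box x e u v) K)) => //.
    move=> y /andP[cy yd].
    have [|K /near_boxP[e e0 he]] := flat (x, y); first by split; rewrite /= ?ax ?cy.
    exists e => // u v cu uv vd h1 h2; exists e => //; exists K => z [z1 z2].
    have zb : box a b c d z.
      move: z1 z2; rewrite ge_max le_min => /andP[/andP[? _] /andP[? _]] /andP[? ?].
      by split; apply/andP; split => //; lra.
    have := he z _ _ zb.
    move: z1 z2; rewrite ge_max le_min => /andP[/andP[? ?] /andP[? ?]] /andP[? ?].
    move=> h; have {}h := h ltac:(apply/andP; split => //) ltac:(apply/andP; split => /=; lra).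
    move: h; apply: filterS => z' h [z'1 z'2]; apply: h.
    move: z'1 z'2; rewrite ge_max le_min => /andP[/andP[? ?] /andP[? ?]] /andP[? ?].
    by split; apply/andP; split => //; lra.
  move=> u v w uv vw [e1 e10 [K1 l1]] [e2 e20 [K2 l2]].
  pose e := Num.min e1 e2.
  have e0 : 0 < e by rewrite lt_min e10.
  have sub f u' v' : e <= f -> near_box x e u' v' `<=` near_box x f u' v'.
    move=> ef z [/andP[z1 z2] z3]; split => //.
    move: z1 z2; rewrite !ge_max !le_min => /andP[? ?] /andP[? ?].
    by apply/andP; split; apply/andP; split => //; lra.
  exists e => //.
  have [||||||K lK] := @lift_glue_arc R _ _ s _ _ K1 K2 (fun t => (t, v))
    (Num.max a (x - e)) (Num.min b (x + e)) (@closed_box _ _ u v) (@closed_box _ _ v w)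
    _ _ _ _ (lift_sub (sub _ _ _ _) l1) (lift_sub (sub _ _ _ _) l2).
  - by rewrite ge_max !le_min; apply/andP; split; apply/andP; split; lra.
  - by apply: continuous_pair => t; [exact: cvg_id|exact: cvg_cst].
  - by move=> t tab; split; split; rewrite ?uv ?vw ?lexx.
  - move=> [p1 p2] [h1 /= /andP[? ?]] [_ /= /andP[? ?]]; exists p1 => //.
    by congr (_, _); apply/le_anti/andP.
  - by rewrite ge_min lexx.
  - by rewrite ge_min lexx orbT.
  exists K; apply: lift_sub lK => z [z1 /andP[z2 z3]].
  have [h|h] := leP z.2 v; [left|right]; split => //; first by rewrite z2.
  by rewrite z3 ltW.
apply: (@interval_induction R (fun u v => exists K, is_lift s (box u v c d) K)) => //.
  move=> x xab; have [e e0 [K lK]] := col x xab.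
  exists e => // u v au uv vb h1 h2; exists K; apply: lift_sub lK => z [/andP[? ?] ?].
  by split => //; rewrite ge_max le_min; apply/andP; split; apply/andP; split; lra.
move=> u v w uv vw [K1 l1] [K2 l2].
have [|||K lK] := @lift_glue_arc R _ _ s _ _ K1 K2 (fun t => (v, t))
  c d (@closed_box u v _ _) (@closed_box v w _ _) cd _ _ _ l1 l2.
- by apply: continuous_pair => t; [exact: cvg_cst|exact: cvg_id].
- by move=> t tab; split; split; rewrite /= ?uv ?vw ?lexx.
- move=> [p1 p2] [/= /andP[? ?] h1] [/= /andP[? ?] _]; exists p2 => //.
  by congr (_, _); apply/le_anti/andP.
exists K; apply: lift_sub lK => z [/andP[z2 z3] z1].
have [h|h] := leP z.1 v; [left|right]; split => //; first by rewrite z2.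
by rewrite z3 ltW.
Qed.

End Boxes.

Section Within.

Lemma within_continuousP (X Y : topologicalType) (A : set Y) (f : Y -> X) :
  {within A, continuous f} <->
  forall y, A y -> forall V, nbhs (f y) V -> \forall z \near y, A z -> V (f z).
Proof.
rewrite subspace_continuousP; split=> h y Ay V hV.
  exact: h y Ay V hV.
exact: h y Ay V hV.
Qed.

Lemma within_continuous_precomp (X Y Z : topologicalType) (A : set Y) (B : set Z)
    (f : Y -> X) (g : Z -> Y) : continuous g -> (forall z, B z -> A (g z)) ->
  {within A, continuous f} -> {within B, continuous (f \o g)}.
Proof.
move=> cg gB /within_continuousP cf; apply/within_continuousP => z Bz V hV.
have := cg z _ (cf _ (gB _ Bz) V hV).
by rewrite /nbhs /=; apply: filterS => w h /gB; exact: h.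
Qed.

Lemma within_continuous_eq (X Y : topologicalType) (A : set Y) (f g : Y -> X) :
  (forall y, A y -> f y = g y) ->
  {within A, continuous f} -> {within A, continuous g}.
Proof.
move=> e /within_continuousP cf; apply/within_continuousP => y Ay V.
by rewrite -e // => /(cf y Ay); apply: filterS => z h Az; rewrite -e //; exact: h.
Qed.

End Within.

Section Concat.
Context {R : realType} {X : topologicalType}.
Implicit Types f g : R -> X.

Lemma loop_concat_l f g x : x <= 2^-1 -> loop_concat f g x = f (2 * x).
Proof. by rewrite /loop_concat => ->. Qed.

Lemma loop_concat_r f g x : f 1 = g 0 -> 2^-1 <= x ->
  loop_concat f g x = g (2 * x - 1).
Proof.
rewrite /loop_concat => e xh; case: leP => // hx.
have -> : x = 2^-1 by apply/le_anti/andP.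
by rewrite mulfV ?subrr ?pnatr_eq0.
Qed.

Lemma itv01_halves : `[0, 1]%classic = `[0, 2^-1]%classic `|` `[2^-1, 1]%classic :> set R.
Proof.
apply/seteqP; split=> x; rewrite /= !in_itv /=.
  by move=> /andP[? ?]; have [h|h] := leP x 2^-1; [left|right]; apply/andP; split => //; lra.
by case=> /andP[? ?]; apply/andP; split; lra.
Qed.

Lemma continuous_affine (a b : R) : continuous (fun x => a * x + b).
Proof.
by move=> x; apply: cvgD; [apply: cvgM; [exact: cvg_cst|exact: cvg_id]|exact: cvg_cst].
Qed.

Lemma loop_concat_continuous f g : f 1 = g 0 ->
  {within `[0, 1], continuous f} -> {within `[0, 1], continuous g} ->
  {within `[0, 1], continuous (loop_concat f g)}.
Proof.
move=> e cf cg; rewrite itv01_halves; apply: withinU_continuous;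
  [exact: itv_closed|exact: itv_closed| |].
  apply: (@within_continuous_eq _ _ _ (f \o (fun x => 2 * x + 0))).
    by move=> x; rewrite /= in_itv /= => /andP[_ h]; rewrite loop_concat_l //= addr0.
  apply: within_continuous_precomp cf; first exact: continuous_affine.
  by move=> x; rewrite /= !in_itv /= => /andP[? ?]; apply/andP; split; lra.
apply: (@within_continuous_eq _ _ _ (g \o (fun x => 2 * x + (- 1)))).
  by move=> x; rewrite /= in_itv /= => /andP[h _]; rewrite loop_concat_r.
apply: within_continuous_precomp cg; first exact: continuous_affine.
by move=> x; rewrite /= !in_itv /= => /andP[? ?]; apply/andP; split; lra.
Qed.

Lemma is_loop_concat (x0 : X) f g :
  is_loop x0 f -> is_loop x0 g -> is_loop x0 (loop_concat f g).
Proof.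
move=> [cf f0 f1] [cg g0 g1]; split.
- by apply: loop_concat_continuous; rewrite ?f1.
- by rewrite loop_concat_l ?mulr0 // invr_ge0.
- rewrite loop_concat_r ?f1 //; last lra.
  by have -> : 2 * 1 - 1 = 1 :> R by lra.
Qed.

End Concat.

Section Holonomy.
Context {R : realType} {X : topologicalType} {H : groupType} (t : X -> X -> H).

(** Flatness: near every point the jumps have a common lift. *)
Hypothesis flat : forall x : X, exists c : X -> H, \forall z \near x,
  \forall z' \near z, c z' = (c z * t z z')%g.

Definition seg (a b : R) := [set x : R | a <= x <= b].

(** The parallel transport along the path f, as a relation so that existence
    and uniqueness are separate facts. *)
Definition holonomy (f : R -> X) a b h := exists2 K : R -> H,
  is_lift (fun y z => t (f y) (f z)) (seg a b) K & h = ((K a)^-1 * K b)%g.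

Lemma lift_comp (Y Z : topologicalType) (s : Y -> Y -> H) (D : set Y) (B : set Z) K
    (g : Z -> Y) : continuous g -> (forall z, B z -> D (g z)) -> is_lift s D K ->
  is_lift (fun y z => s (g y) (g z)) B (K \o g).
Proof.
move=> cg gB l z Bz; have := cg z _ (l _ (gB _ Bz)).
by rewrite /nbhs /=; apply: filterS => w h /gB; exact: h.
Qed.

(** The pullback of a flat jump function is flat. *)
Lemma lift_square (F : R * R -> X) a b c d : a <= b -> c <= d ->
  {within box a b c d, continuous F} ->
  exists K, is_lift (fun y z => t (F y) (F z)) (box a b c d) K.
Proof.
move=> ab cd /within_continuousP cF; apply: lift_box => // y Dy.
have [k hk] := flat (F y); exists (k \o F).
have := cF y Dy _ hk; apply: filterS => z h Dz; have {}h := h Dz.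
exact: cF z Dz _ h.
Qed.

Lemma holonomy_exists f a b : a <= b -> {within `[a, b], continuous f} ->
  exists h, holonomy f a b h.
Proof.
move=> ab cf.
have cF : {within box a b 0 0, continuous (f \o fst)}.
  apply: within_continuous_precomp cf; first by move=> x; exact: cvg_fst.
  by move=> z [zab _] /=; rewrite in_itv.
have [K lK] := lift_square ab (lexx 0) cF.
exists ((K (a, 0%R))^-1 * K (b, 0%R))%g; exists (fun x => K (x, 0)) => //.
apply: (lift_comp _ _ lK (g := fun x => (x, 0))).
  by apply: continuous_pair => x; [exact: cvg_id|exact: cvg_cst].
by move=> x xab; split => //=; rewrite lexx.
Qed.

Lemma holonomy_unique f a b h h' : a <= b ->
  holonomy f a b h -> holonomy f a b h' -> h = h'.
Proof.
move=> ab [K lK ->] [K' lK' ->].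
have := locally_constant ab (lift_ratio lK lK') (y := b).
rewrite lexx ab => /(_ isT) e.
have -> : K b = (K a * (K' a)^-1 * K' b)%g by rewrite -e mulgVK.
by rewrite -!mulgA mulKg.
Qed.

Lemma holonomy_eq f g a b h : (forall x, a <= x <= b -> f x = g x) ->
  holonomy f a b h -> holonomy g a b h.
Proof.
move=> e [K lK ->]; exists K => // y yab; have := lK y yab.
by apply: filterS => z hz zab; rewrite -!e //; exact: hz.
Qed.

Lemma holonomy_comp f (g : R -> R) a b a' b' h : continuous g ->
  (forall x, a' <= x <= b' -> a <= g x <= b) -> g a' = a -> g b' = b ->
  holonomy f a b h -> holonomy (f \o g) a' b' h.
Proof.
move=> cg gab ga gb [K lK ->]; exists (K \o g); last by rewrite /= ga gb.
exact: (lift_comp cg gab lK).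
Qed.

Lemma closed_seg a b : closed (seg a b).
Proof.
have -> : seg a b = `[a, b]%classic by apply/seteqP; split => x; rewrite /= in_itv.
exact: itv_closed.
Qed.

Lemma holonomy_cat f a b c h h' : a <= b -> b <= c ->
  holonomy f a b h -> holonomy f b c h' -> holonomy f a c (h * h')%g.
Proof.
move=> ab bc [K lK ->] [K' lK' ->].
have := lift_glue (@closed_seg a b) (@closed_seg b c) lK
  (lift_mull (K b * (K' b)^-1)%g lK').
set k := (fun y => if _ then _ else _) => l.
have lk : is_lift (fun y z => t (f y) (f z)) (seg a c) k.
  apply: lift_sub (l _) => [x /= /andP[ax xc]|y /= /andP[_ yb] /andP[b_y _]].
    by have [xb|bx] := leP x b; [left|right]; apply/andP; split => //; exact: ltW.
  by have -> : y = b by [apply/le_anti/andP]; rewrite mulgVK.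
exists k => //; rewrite /k asboolT; last by rewrite /seg /= lexx.
case: asboolP => [/andP[_ cb]|_]; last by rewrite !mulgA.
have -> : c = b by apply/le_anti/andP.
by rewrite mulVg mulg1.
Qed.

Lemma holonomy_concat f g h h' : f 1 = g 0 -> holonomy f 0 1 h ->
  holonomy g 0 1 h' -> holonomy (loop_concat f g) 0 1 (h * h')%g.
Proof.
move=> e hf hg; have h2 : 2^-1 + 2^-1 = 1 :> R by lra.
apply: (@holonomy_cat _ _ 2^-1); [lra|lra| |].
  apply: (@holonomy_eq (f \o (fun x => 2 * x + 0))).
    by move=> x /andP[_ ?]; rewrite loop_concat_l //= addr0.
  apply: holonomy_comp hf; first exact: continuous_affine.
  - by move=> x /andP[? ?]; apply/andP; split; lra.
  - by lra.
  - by lra.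
apply: (@holonomy_eq (g \o (fun x => 2 * x + (- 1)))).
  by move=> x /andP[? _]; rewrite loop_concat_r.
apply: holonomy_comp hg; first exact: continuous_affine.
- by move=> x /andP[? ?]; apply/andP; split; lra.
- by lra.
- by lra.
Qed.

Lemma jump_refl x : t x x = 1%g.
Proof.
have [c /nbhs_singleton/nbhs_singleton h] := flat x.
by apply: (mulgI (c x)); rewrite -h mulg1.
Qed.

(** A lift over the square of a homotopy is constant on the two edges where
    the homotopy is. *)
Lemma holonomy_homotopic x0 f g h h' : loop_homotopic x0 f g ->
  holonomy f 0 1 h -> holonomy g 0 1 h' -> h = h'.
Proof.
move=> [F [cF F01 F0]] hf hg; have l01 : 0 <= 1 :> R by [].
have sq : `[0, 1]%classic `*` `[0, 1]%classic = box 0 1 0 1 :> set (R * R).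
  by apply/seteqP; split => x; rewrite /box /= !in_itv.
rewrite sq in cF; have [K lK] := lift_square l01 l01 cF.
have edge c : 0 <= c <= 1 -> (forall x, 0 <= x <= 1 -> F (x, c) = x0) ->
    K (1, c) = K (0, c).
  move=> c01 Fc; apply: (@locally_constant R H (fun x => K (x, c)) 0 1) => // [x x01|].
    have cp : continuous (fun x : R => (x, c)).
      by apply: continuous_pair => y; [exact: cvg_id|exact: cvg_cst].
    have gB z : seg 0 1 z -> box 0 1 0 1 (z, c) by move=> ?; split.
    have := lift_comp cp gB lK (x01 : seg 0 1 x); apply: filterS => z hz z01.
    by have := hz z01; rewrite /= !Fc // jump_refl mulg1.
  by rewrite lexx l01.
have side c f' k : 0 <= c <= 1 -> (forall x, 0 <= x <= 1 -> F (c, x) = f' x) ->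
    holonomy f' 0 1 k -> k = ((K (c, 0%R))^-1 * K (c, 1%R))%g.
  move=> c01 Fc hk; apply: (holonomy_unique l01 hk) => {hk}.
  apply: (@holonomy_eq (F \o (fun x => (c, x)))); first by move=> x /Fc.
  exists (fun x => K (c, x)) => //.
  apply: (lift_comp _ _ lK (g := fun x => (c, x))); last by move=> x x01; split.
  by apply: continuous_pair => x; [exact: cvg_cst|exact: cvg_id].
have i01 x : 0 <= x <= 1 -> x \in `[0, 1] by rewrite in_itv.
rewrite (side 0 f h) ?lexx ?l01 => // [|x /i01/F01[]//].
rewrite (side 1 g h') ?lexx ?l01 => // [|x /i01/F01[]//].
by rewrite !edge ?lexx ?l01 // => x /i01/F0[].
Qed.

(** The holonomy of loops is invariant under homotopy and multiplicative. *)
Theorem monodromy_hom x0 (G : groupType) : @is_fundamental_group R X x0 G ->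
  exists2 phi : G -> H, (forall x y, phi (x * y)%g = (phi x * phi y)%g) &
    forall f h, is_loop x0 f -> holonomy f 0 1 h -> exists x, phi x = h.
Proof.
move=> [cls [clsS clsH clsM]].
have ex c : exists h, exists f, [/\ is_loop x0 f, cls f = c & holonomy f 0 1 h].
  have [f lf fc] := clsS c; have [cf _ _] := lf.
  by have [h hf] := holonomy_exists ler01 cf; exists h, f.
pose phi c := proj1_sig (cid (ex c)).
have phiP f h : is_loop x0 f -> holonomy f 0 1 h -> phi (cls f) = h.
  move=> lf hf; rewrite /phi; case: cid => k [g [lg gc hg]] /=.
  exact: holonomy_homotopic ((clsH _ _ lg lf).1 gc) hg hf.
exists phi => [x y|f h lf hf]; last by exists (cls f); exact: phiP.
have [h [f [lf <- hf]]] := ex x; have [k [g [lg <- hg]]] := ex y.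
rewrite -clsM // (phiP _ _ lf hf) (phiP _ _ lg hg); apply: phiP.
  exact: is_loop_concat.
by apply: holonomy_concat => //; case: lf lg => [_ _ ->] [_ -> _].
Qed.

End Holonomy.

(** * Crossing two curves on a surface *)

Section Strips.
Variables (R : realType) (n : nat).
Hypothesis n2 : (2 <= n)%N.

Let n2r : 2 <= n%:R :> R. Proof. by rewrite ler_nat. Qed.

Definition side_angle : R := 2 * pi / (4 * n)%:R.
Local Notation alpha := side_angle.

Let alphaE : alpha * (4 * n%:R) = 2 * pi.
Proof. by rewrite /side_angle natrM divfK // mulf_neq0 ?pnatr_eq0; lra || by case: n n2. Qed.

Let alpha0 : 0 < alpha.
Proof. by rewrite divr_gt0 ?mulr_gt0 ?pi_gt0 ?ltr0n ?muln_gt0 //; case: n n2. Qed.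

Let alphaM (x y : R) : (alpha * x <= alpha * y) = (x <= y).
Proof. by rewrite ler_pM2l. Qed.

Let alpha_pi : alpha * (2 * n%:R) = pi.
Proof. by apply: (@mulfI _ 2) => //; rewrite -alphaE; ring. Qed.

Let in_0_pi z : 0 <= z -> z <= 2 * n%:R -> alpha * z \in `[0, pi].
Proof. by move=> z0 zn; rewrite in_itv /= -alpha_pi alphaM zn andbT mulr_ge0 // ltW. Qed.

Lemma ler_cos_side (x y : R) : 0 <= x -> x <= y -> y <= 2 * n%:R ->
  cos (alpha * y) <= cos (alpha * x).
Proof.
move=> x0 xy yn; rewrite leNgt ltr_cos -?leNgt ?alphaM //; apply: in_0_pi => //.
  exact: le_trans x0 xy.
exact: le_trans xy yn.
Qed.

(** Cosines of the angular distances, from the midpoint of a side, of its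
    endpoints (hi) and of the far endpoints of its two neighbours (lo). *)
Definition lo : R := cos (alpha * (3 / 2)).
Definition hi : R := cos (alpha * (1 / 2)).
Definition mid : R := (lo + hi) / 2.

Lemma lo_lt_hi : lo < hi.
Proof.
rewrite /lo /hi ltr_cos ?ltr_pM2l //; first lra.
all: by apply: in_0_pi; have := n2r; lra.
Qed.

Lemma cos_far x : 3 / 2 <= x -> x <= 4 * n%:R - 3 / 2 -> cos (alpha * x) <= lo.
Proof.
move=> x1 x2; have [h|h] := leP x (2 * n%:R); first by apply: ler_cos_side => //; lra.
have -> : cos (alpha * x) = cos (alpha * (4 * n%:R - x)).
  rewrite mulrBr alphaE -(cosN (alpha * x)) -[cos (- _)]cosD2pi mulr_natl.
  by congr cos; rewrite addrC.
by apply: ler_cos_side; lra.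
Qed.

Lemma cos_farN x : 3 / 2 <= - x -> - x <= 4 * n%:R - 3 / 2 -> cos (alpha * x) <= lo.
Proof. by move=> *; rewrite -cosN -mulrN; exact: cos_far. Qed.

(** The boundary parameter of the midpoint of side 4 b + 1. *)
Definition cap_center (b : bool) : R := 4 * (b : nat)%:R + 3 / 2.

(** The scalar product with that midpoint. The cap xi b > lo is cut off by the
    chord under the three sides 4 b, 4 b + 1 and 4 b + 2. *)
Definition xi (b : bool) (p : R * R) : R :=
  p.1 * cos (alpha * cap_center b) + p.2 * sin (alpha * cap_center b).

Lemma xi_bd b s : xi b (polygon_bd n s) = cos (alpha * (s - cap_center b)).
Proof. by rewrite mulrBr cosB /xi /polygon_bd /= /side_angle mulrAC. Qed.

Lemma continuous_xi b : continuous (xi b).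
Proof.
move=> p; apply: cvgD; apply: cvgM; [exact: cvg_fst|exact: cvg_cst|exact: cvg_snd|exact: cvg_cst].
Qed.

(** The midpoints have angular distance 4 alpha, so the sum of the two functions
    xi is at most 2 cos (2 alpha) <= 2 lo on the disk. *)
Lemma caps_disjoint b p : disk p -> lo < xi b p -> xi (~~ b) p < lo.
Proof.
move=> dp; suff : xi false p + xi true p <= 2 * lo by case: b => /=; lra.
pose w : R := 7 / 2; pose v := p.1 * cos (alpha * w) + p.2 * sin (alpha * w).
have -> : xi false p + xi true p = 2 * cos (alpha * 2) * v.
  rewrite /xi /v; have -> : alpha * cap_center true = alpha * w + alpha * 2.
    by rewrite /cap_center /w /=; field.
  have -> : alpha * cap_center false = alpha * w - alpha * 2 by rewrite /cap_center /w /=; field.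
  by rewrite cosB cosD sinB sinD; ring.
have c0 : 0 <= cos (alpha * 2).
  apply: cos_ge0_pihalf; rewrite -alpha_pi.
  have -> : alpha * (2 * n%:R) / 2 = alpha * n%:R by field.
  by rewrite -mulrN !alphaM; have := n2r; lra.
have cl : cos (alpha * 2) <= lo by apply: cos_far; have := n2r; lra.
have v1 : v <= 1.
  have cs := cos2Dsin2 (alpha * w).
  have : (p.1 - cos (alpha * w)) ^+ 2 + (p.2 - sin (alpha * w)) ^+ 2 >= 0.
    by rewrite addr_ge0 ?sqr_ge0.
  move: dp; rewrite /disk /= /v !expr2 in cs *; lra.
rewrite -mulrA ler_pM2l //; apply: le_trans cl.
by rewrite ler_piMr.
Qed.

Definition strip b (P : set R) : set (R * R) :=
  [set p | lo < xi b p < hi /\ P (xi b p)].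

(** The only sides that meet the strip lo < xi b < hi are 4 b and 4 b + 2. They
    are paired with each other by the reflection that preserves xi b, so that
    the strip becomes an annulus in the surface. *)
Lemma strip_pairing b P p p' : side_pairing n p p' -> strip b P p <-> strip b P p'.
Proof.
move=> [j [c [t []]]]; rewrite in_itv /= => /andP[t0 t1] -> ->.
rewrite /strip /= !xi_bd.
have jn : j%:R + 1 <= n%:R :> R by rewrite natr1 ler_nat.
set s := (_%:R + t); set s' := (_ + (1 - t)).
have sE : s = 4 * j%:R + c%:R + t by rewrite /s natrD natrM.
have s'E : s' = 4 * j%:R + c%:R + 3 - t by rewrite /s' (natrD _ (4 * j + c)) (natrD _ (4 * j)) natrM; ring.
have [out|[out|e]] : (cos (alpha * (s - cap_center b)) <= lo /\ cos (alpha * (s' - cap_center b)) <= lo)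
  \/ (hi <= cos (alpha * (s - cap_center b)) /\ cos (alpha * (s' - cap_center b)) <= lo)
  \/ cos (alpha * (s - cap_center b)) = cos (alpha * (s' - cap_center b)); last by rewrite e.
- rewrite sE s'E /cap_center; have [jb|jb|jb] := ltngtP (j : nat) b.
  + left; have j0 : j%:R = 0 :> R by move: jb; case: (b); case: (j : nat).
    have -> : b = true by move: jb; case: (b).
    rewrite j0; case: c {s s' sE s'E} => /=.
      by split; apply: cos_farN; have := n2r; lra.
    by split; apply: cos_farN; have := n2r; lra.
  + left; have bj : b%:R + 1 <= j%:R :> R by rewrite natr1 ler_nat.
    have b0 : 0 <= b%:R :> R by [].
    by case: c {s s' sE s'E} => /=; split; apply: cos_far; have := n2r; lra.
  + right; rewrite jb; case: c {s s' sE s'E} => /=.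
      left; split; last by apply: cos_far; have := n2r; lra.
      have [th|th] := leP (1 / 2) t.
        by apply: ler_cos_side; have := n2r; lra.
      by rewrite -[leRHS]cosN -mulrN; apply: ler_cos_side; have := n2r; lra.
    by right; rewrite -[LHS]cosN -mulrN; congr (cos (alpha * _)); field.
- case: out => h1 h2; split=> -[/andP[? ?]]; lra.
- case: out => h1 h2; split=> -[/andP[? ?]]; lra.
Qed.

Lemma strip_glued b P p p' :
  clos_refl_sym_trans _ (@side_pairing R n) p p' -> strip b P p <-> strip b P p'.
Proof.
elim=> [x y|x|x y _ ->|x y z _ -> _ ->] //; exact: strip_pairing.
Qed.

Lemma lo_lt_mid : lo < mid.
Proof. by have := lo_lt_hi; rewrite /mid; lra. Qed.

Lemma mid_lt_hi : mid < hi.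
Proof. by have := lo_lt_hi; rewrite /mid; lra. Qed.

Lemma open_strip b P : open P -> open (strip b P).
Proof.
move=> oP; have -> : strip b P = xi b @^-1` (`]lo, hi[ `&` P).
  by apply/seteqP; split => p; rewrite /strip /= in_itv.
apply: open_comp; last by apply: openI => //; exact: itv_open.
by move=> p _; exact: continuous_xi.
Qed.

Lemma disk_convex (p q : R * R) u : disk p -> disk q -> 0 <= u <= 1 ->
  disk ((1 - u) * p.1 + u * q.1, (1 - u) * p.2 + u * q.2).
Proof.
rewrite /disk /= => dp dq /andP[u0 u1].
have -> : ((1 - u) * p.1 + u * q.1) ^+ 2 + ((1 - u) * p.2 + u * q.2) ^+ 2 =
  (1 - u) * (p.1 ^+ 2 + p.2 ^+ 2) + u * (q.1 ^+ 2 + q.2 ^+ 2)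
  - u * (1 - u) * ((p.1 - q.1) ^+ 2 + (p.2 - q.2) ^+ 2) by ring.
have h : 0 <= u * (1 - u) * ((p.1 - q.1) ^+ 2 + (p.2 - q.2) ^+ 2).
  by rewrite mulr_ge0 ?addr_ge0 ?sqr_ge0 // mulr_ge0 // subr_ge0.
have h1 : (1 - u) * (p.1 ^+ 2 + p.2 ^+ 2) <= (1 - u) * 1 by rewrite ler_wpM2l // subr_ge0.
have h2 : u * (q.1 ^+ 2 + q.2 ^+ 2) <= u * 1 by rewrite ler_wpM2l.
lra.
Qed.

End Strips.

Section SurfaceHom.
Context {R : realType} (n : nat) (X : topologicalType) (q : R * R -> X)
  (H : groupType) (h : bool -> H).
Hypotheses (n2 : (2 <= n)%N) (q_onto : q @` (@disk R) = setT)
  (q_open : forall U : set X,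
     open U <-> open (q @^-1` U : set (subspace (@disk R))))
  (q_fibre : {in @disk R &, forall x y, q x = q y <->
         clos_refl_sym_trans _ (@side_pairing R n) x y}).

Local Notation lo := (@lo R n).
Local Notation hi := (@hi R n).
Local Notation mid := (@mid R n).
Local Notation xi := (@xi R n).
Local Notation strip := (@strip R n).

Lemma gluing_pt x : exists2 p, disk p & q p = x.
Proof. by have : (q @` (@disk R)) x by rewrite q_onto. Qed.

Lemma gluing_continuous : {within @disk R, continuous q}.
Proof. by apply/continuousP => U /q_open. Qed.

Lemma gluing_open (U : set X) (V : set (R * R)) : open V ->
  (forall p, disk p -> U (q p) <-> V p) -> open U.
Proof.
move=> oV UV; apply/q_open/open_subspaceP; exists V => //.
by apply/seteqP; split=> p [h1 h2]; split=> //; apply/(UV p h2).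
Qed.

Definition band b (P : set R) : set X := q @` (@disk R `&` strip b P).

Lemma bandE b P p : disk p -> band b P (q p) <-> strip b P p.
Proof.
move=> dp; split=> [[p' [dp' sp'] /q_fibre]|sp]; last by exists p.
by rewrite !inE => /(_ dp' dp) /(strip_glued n2 b P) <-.
Qed.

Lemma open_band b P : open P -> open (band b P).
Proof.
move=> oP; apply: (@gluing_open _ (strip b P)); first exact: open_strip.
by move=> p; exact: bandE.
Qed.

(** The jump is h b on leaving the core curve xi b = mid of band b towards the
    half where xi b is larger, and trivial otherwise. *)
Definition crossing (x y : X) : H :=
  if `[< band false [set mid] x /\ band false [set s | mid < s] y >] then h false
  else if `[< band true [set mid] x /\ band true [set s | mid < s] y >] then h true
  else 1%g.

Lemma band_sub b P P' : P `<=` P' -> band b P `<=` band b P'.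
Proof. by move=> PP' _ [p [dp [sp /PP' Pp]] <-]; exists p. Qed.

Lemma band_disjoint b x : band b setT x -> ~ band (~~ b) setT x.
Proof.
have [p dp <-] := gluing_pt x; rewrite !bandE // => -[/andP[l _] _] [/andP[l' _] _].
by have := caps_disjoint n2 dp l; lra.
Qed.

Lemma crossing_band b x y : band b setT x -> crossing x y =
  if `[< band b [set mid] x /\ band b [set s | mid < s] y >] then h b else 1%g.
Proof.
have sub b' : band b' [set mid] x -> band b' setT x by exact: band_sub.
rewrite /crossing; case: b => hb.
  by rewrite (asboolF (P := _ /\ band false _ _)) // => -[/sub /band_disjoint].
case: asboolP => // _; rewrite asboolF // => -[/sub /band_disjoint].
exact.
Qed.

Lemma crossing_off x y : ~ band false [set mid] x -> ~ band true [set mid] x ->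
  crossing x y = 1%g.
Proof. by move=> h0 h1; rewrite /crossing !asboolF // => -[]. Qed.

(** On band b the function that is h b on the upper half is a lift, because the
    two halves are open; away from both core curves constants are lifts. *)
Lemma crossing_flat (x : X) : exists c : X -> H, \forall z \near x,
  \forall z' \near z, c z' = (c z * crossing z z')%g.
Proof.
have [[b xb]|nb] := pselect (exists b, band b setT x).
  exists (fun z => if `[< band b [set s | mid < s] z >] then h b else 1%g).
  have : nbhs x (band b setT) by apply: open_nbhs_nbhs; split=> //; exact: open_band openT.
  apply: filterS => z zb.
  have [p dp pz] := gluing_pt z; rewrite -pz in zb *.
  have [l _] := (bandE b _ dp).1 zb.
  have [xm|xm|xm] := ltgtP (xi b p) mid.
  - have : nbhs (q p) (band b [set s | s < mid]).
      apply: open_nbhs_nbhs; split; first exact/open_band/open_lt.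
      by apply/bandE.
    apply: filterS => z' z'b; rewrite (crossing_band (b := b)) //.
    have [p' dp' pz'] := gluing_pt z'; rewrite -pz' in z'b *.
    move/(bandE b _ dp'): z'b => [_ /= z'm].
    rewrite !asboolF ?mulg1 //.
    - by move=> [/(bandE b _ dp)[_ /= e]]; rewrite e ltxx in xm.
    - by move=> /(bandE b _ dp)[_ /=]; lra.
    - by move=> /(bandE b _ dp')[_ /=]; lra.
  - have : nbhs (q p) (band b [set s | mid < s]).
      apply: open_nbhs_nbhs; split; first exact/open_band/open_gt.
      by apply/bandE.
    move=> nb; have pb := nbhs_singleton nb.
    move: nb; apply: filterS => z' z'b; rewrite (crossing_band (b := b)) //.
    rewrite [X in (_ * (if X then _ else _))%g]asboolF ?mulg1.
      by rewrite !asboolT.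
    by move=> [/(bandE b _ dp)[_ /= e]]; rewrite e ltxx in xm.
  - apply: nearW => z'; rewrite (crossing_band (b := b)) //.
    have pm : band b [set mid] (q p) by apply/bandE.
    rewrite [X in ((if X then _ else _) * _)%g]asboolF ?mul1g.
      by congr (if _ then _ else _); apply: asbool_equiv_eq; split=> [|[]].
    by move=> /(bandE b _ dp)[_ /=]; lra.
exists (fun=> 1%g).
pose V := [set p | xi false p != mid] `&` [set p | xi true p != mid].
have oV : open V.
  have o b : open [set p | xi b p != mid].
    apply: (@open_comp _ _ (xi b) [set s | s != mid]); last exact: open_neq.
    by move=> p _; exact: continuous_xi.
  exact: openI.
pose U := ~` band false [set mid] `&` ~` band true [set mid].
have oU : open U.
  apply: gluing_open oV _ => p dp.
  have e b : ~ band b [set mid] (q p) <-> xi b p != mid.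
    rewrite bandE //; split=> [np|/eqP np [] //].
    apply/eqP => e; apply: np; split=> //.
    by rewrite e lo_lt_mid ?mid_lt_hi.
  by rewrite /U /V /setI /setC /= !e.
have : nbhs x U.
  apply: open_nbhs_nbhs; split=> //.
  by split=> /(band_sub (@subsetT _ _)) hx; apply: nb; eexists; exact: hx.
by apply: filterS => z [z0 z1]; apply: nearW => z'; rewrite crossing_off // mulg1.
Qed.

(** A lift of the crossings over the whole polygon: it is h b beyond the curve
    xi b = mid. *)
Definition sheet (p : R * R) : H :=
  if mid < xi false p then h false else if mid < xi true p then h true else 1%g.

Lemma sheet_cap b p : disk p -> lo < xi b p ->
  sheet p = if mid < xi b p then h b else 1%g.
Proof.
move=> dp l; have := caps_disjoint n2 dp l; have := lo_lt_mid R n2; rewrite /sheet.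
case: b l => /= l lm o; first by case: ltP => // ?; exfalso; lra.
by case: ifP => // _; case: ltP => // ?; exfalso; lra.
Qed.

Lemma sheet_crossing p : disk p -> \forall p' \near p, disk p' ->
  sheet p' = (sheet p * crossing (q p) (q p'))%g.
Proof.
move=> dp; have near_xi b (P : set R) : open P -> P (xi b p) ->
    \forall p' \near p, P (xi b p').
  by move=> oP Pp; apply: continuous_xi; apply: open_nbhs_nbhs.
have lm := lo_lt_mid R n2; have mh := mid_lt_hi R n2.
have [[b e]|ne] := pselect (exists b, xi b p = mid).
  have : nbhs p (fun p' => (xi b p') \in `]lo, hi[).
    apply: (near_xi b `]lo, hi[%classic); first exact: itv_open.
    by rewrite e /= in_itv /= lm.
  apply: filterS => p'; rewrite in_itv /= => /andP[l1 l2] dp'.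
  rewrite (sheet_cap dp' l1) (sheet_cap (b := b) dp) ?e // ltxx mul1g.
  have pm : band b [set mid] (q p) by apply/bandE => //; split=> //; rewrite e lm.
  rewrite (crossing_band (b := b)); last exact: band_sub pm.
  case: asboolP => [[_ /(bandE b _ dp')[_ /= ->]] //|np].
  case: ltP => // mp; exfalso; apply: np; split=> //; apply/bandE => //.
  by split=> //; rewrite l1.
have off b y : band b y (q p) -> y = [set mid] -> False.
  by move=> /(bandE b _ dp)[_ py] ey; rewrite ey in py; apply: ne; exists b.
have side b : \forall p' \near p, (mid < xi b p') = (mid < xi b p).
  have [m|m|m] := ltgtP (xi b p) mid; last by exfalso; apply: ne; exists b.
    have := near_xi b [set s | s < mid] (@open_lt _ _) m.
    by apply: filterS => p' /= h'; apply/negbTE; rewrite -leNgt ltW.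
  by have := near_xi b [set s | mid < s] (@open_gt _ _) m; apply: filterS.
have := side true; have := side false; apply: filterS2 => p' h0 h1 dp'.
by rewrite crossing_off ?mulg1 /sheet ?h0 ?h1 // => hb; exact: off hb erefl.
Qed.

Definition segment (a b : R * R) (u : R) : R * R :=
  ((1 - u) * a.1 + u * b.1, (1 - u) * a.2 + u * b.2).

Lemma segment_disk a b u : disk a -> disk b -> u \in `[0, 1] -> disk (segment a b u).
Proof. by move=> da db; rewrite in_itv /=; exact: disk_convex. Qed.

Lemma continuous_segment a b : continuous (segment a b).
Proof.
have e (x y : R) : (fun u => (1 - u) * x + u * y) = (fun u => (y - x) * u + x).
  by apply/funext => u; ring.
by apply: continuous_pair; rewrite e; exact: continuous_affine.
Qed.

Lemma segment_holonomy a b : disk a -> disk b ->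
  {within `[0, 1], continuous (q \o segment a b)} /\
  holonomy crossing (q \o segment a b) 0 1 ((sheet a)^-1 * sheet b)%g.
Proof.
move=> da db; have sd u : seg 0 1 u -> disk (segment a b u) by exact: disk_convex.
split.
  apply: within_continuous_precomp gluing_continuous; first exact: continuous_segment.
  by move=> u u01; exact: segment_disk.
exists (sheet \o segment a b) => [u u01|].
  have : \forall v \near u, disk (segment a b v) -> sheet (segment a b v) =
      (sheet (segment a b u) * crossing (q (segment a b u)) (q (segment a b v)))%g.
    exact: @continuous_segment a b u _ (sheet_crossing (sd u u01)).
  by apply: filterS => v hv /sd; exact: hv.
by rewrite /segment /= subr0 subrr !mul1r !mul0r !addr0 !add0r -!surjective_pairing.
Qed.

Lemma polygon_bd_disk s : disk (polygon_bd n s : R * R).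
Proof. by rewrite /disk /= cos2Dsin2. Qed.

(** The loop runs straight to the midpoint A of side 4 b + 1, which is identified
    with the midpoint B of side 4 b + 3, and straight back from B. It crosses
    the core of band b once, on the way to A. *)
Lemma dual_loop (p0 : R * R) b : disk p0 -> exists2 f : R -> X, is_loop (q p0) f &
  holonomy crossing f 0 1 (h b ^ sheet p0)%g.
Proof.
move=> dp; have n2r : 2 <= n%:R :> R by rewrite ler_nat.
pose A : R * R := polygon_bd n (cap_center R b); pose B : R * R := polygon_bd n (cap_center R b + 2).
have dA : disk A by exact: polygon_bd_disk.
have dB : disk B by exact: polygon_bd_disk.
have bn : (b < n)%N by apply: leq_trans n2; case: (b).
have qAB : q A = q B.
  apply/q_fibre; rewrite ?inE //; apply: rst_step.
  exists (Ordinal bn), true, (1 / 2); split.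
  - by rewrite in_itv /=; apply/andP; split; lra.
  - by rewrite /A /cap_center /= natrD natrM; congr polygon_bd; field.
  - rewrite /B /cap_center /= (natrD _ (4 * b + 1)) (natrD _ (4 * b)) natrM.
    by congr polygon_bd; field.
have far b' : xi b' B <= lo.
  rewrite xi_bd /cap_center; case: (b) b' => [] [] /=.
  - by apply: cos_far => //; lra.
  - by apply: cos_far => //; lra.
  - by apply: cos_farN => //; lra.
  - by apply: cos_far => //; lra.
have lm := lo_lt_mid R n2.
have sB : sheet B = 1%g.
  by rewrite /sheet !ifN // -leNgt (le_trans (far _)) // ltW.
have m1 : mid < 1.
  by apply: lt_le_trans (mid_lt_hi R n2) _; exact: cos_le1.
have xA : xi b A = 1 by rewrite xi_bd subrr mulr0 cos0.
have sA : sheet A = h b by rewrite (sheet_cap (b := b) dA) xA ?m1 // (lt_trans lm).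
have [c1 h1] := segment_holonomy dp dA.
have [c2 h2] := segment_holonomy dB dp.
have s0 a a' : segment a a' 0 = a.
  by rewrite /segment subr0 !mul1r !mul0r !addr0 -surjective_pairing.
have s1 a a' : segment a a' 1 = a'.
  by rewrite /segment subrr !mul1r !mul0r !add0r -surjective_pairing.
have jump : (q \o segment p0 A) 1 = (q \o segment B p0) 0 by rewrite /= s0 s1.
exists (loop_concat (q \o segment p0 A) (q \o segment B p0)).
  split; first exact: loop_concat_continuous.
  - by rewrite loop_concat_l ?invr_ge0 // mulr0 /= s0.
  - rewrite loop_concat_r //; last lra.
    have -> : 2 * 1 - 1 = 1 :> R by lra.
    by rewrite /= s1.
have := holonomy_concat jump h1 h2.
by rewrite sA sB invg1 mul1g conjgE mulgA.
Qed.

End SurfaceHom.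

(** The conjugating element accounts for the sheet over the base point. *)
Theorem surface_hom (R : realType) (G H : groupType) (h : bool -> H) :
  hyperbolic_surface_group R G ->
  exists2 phi : G -> H, (forall x y, phi (x * y)%g = (phi x * phi y)%g) &
    exists k, forall b, exists x, phi x = (h b ^ k)%g.
Proof.
move=> [n [X [x0 [n2 [q [qo qU qf]] fg]]]].
have [phi phiM phiP] := monodromy_hom (crossing_flat h n2 qo qU qf) fg.
exists phi => //.
have [p dp px] := gluing_pt qo x0.
exists (sheet n h p) => b.
have [f lf hf] := dual_loop h n2 qo qU qf b dp.
by apply: phiP hf; rewrite -px.
Qed.

(** * Surface groups and the main estimate *)

(** The integers with addition as the group law. *)
Definition infinite_cyclic : Type := int.
HB.instance Definition _ := Choice.on infinite_cyclic.
HB.instance Definition _ := isGroup.Build infinite_cyclic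
  (@addrA int) (@add0r int) (@addr0 int) (@addNr int) (@addrN int).

Lemma infinite_cyclicX (z : infinite_cyclic) n :
  (z ^+ n)%g = (z : int) *+ n :> int.
Proof. by elim: n => [|n IH]; rewrite ?expg0 // expgS mulrS -IH. Qed.

Lemma infinite_cyclic_torsion_free (z : infinite_cyclic) n :
  (0 < n)%N -> z <> 1%g -> (z ^+ n)%g <> 1%g.
Proof.
move=> n0 z1 /(congr1 (fun w => w : int)); rewrite infinite_cyclicX => /eqP.
by rewrite mulrn_eq0 eqn0Ngt n0 => /eqP.
Qed.

Lemma conj_neq1 (H : groupType) (x k : H) : x <> 1%g -> (x ^ k)%g <> 1%g.
Proof. by move=> x1 /eqP; rewrite conjg_eq1 => /eqP. Qed.

Lemma surface_hom_to_Z (R : realType) (G : groupType) :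
  hyperbolic_surface_group R G ->
  exists2 phi : G -> infinite_cyclic,
    (forall x y, phi (x * y)%g = (phi x * phi y)%g) & exists g, phi g <> 1%g.
Proof.
move=> sG; have [phi phiM [k hk]] := surface_hom (fun=> (1 : int) : infinite_cyclic) sG.
by exists phi => //; have [x px] := hk true; exists x; rewrite px; exact: conj_neq1.
Qed.

Section Unipotents.
Variable R : realType.

Fact upper_unipotent_subproof : \det (mx2 1 1 0 1 : 'M[R[i]]_2) == 1.
Proof. by rewrite det2 !mxE /= !mulr1 mulr0 subr0. Qed.
Definition upper_unipotent : SL2 R := MkSL2 upper_unipotent_subproof.

Fact lower_unipotent_subproof : \det (mx2 1 0 1 1 : 'M[R[i]]_2) == 1.
Proof. by rewrite det2 !mxE /= !mulr1 subr0. Qed.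
Definition lower_unipotent : SL2 R := MkSL2 lower_unipotent_subproof.

Lemma mulmx_mx2 (a b c d a' b' c' d' : R[i]) :
  mx2 a b c d *m mx2 a' b' c' d' =
  mx2 (a * a' + b * c') (a * b' + b * d') (c * a' + d * c') (c * b' + d * d').
Proof. by apply: mx2P; rewrite mulmx2 !mxE. Qed.

Lemma adj2_mx2 (a b c d : R[i]) : adj2 (mx2 a b c d) = mx2 d (- b) (- c) a.
Proof. by apply: mx2P; rewrite !mxE. Qed.

Lemma unipotents_double_commutator :
  [~ [~ upper_unipotent, lower_unipotent],
     [~ upper_unipotent, lower_unipotent^-1]]%g <> 1%g.
Proof.
set x := [~ _, lower_unipotent]%g; set y := [~ _, _^-1]%g.
have xE : sl2_val x = mx2 3 1 (-1) 0.
  rewrite /x commgEl conjgE !sl2_valM !sl2_valV /= !adj2_mx2 !mulmx_mx2.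
  by congr mx2; ring.
have yE : sl2_val y = mx2 1 (-1) (-1) 2.
  rewrite /y commgEl conjgE !sl2_valM !sl2_valV /= !adj2_mx2 !mulmx_mx2.
  by congr mx2; ring.
clearbody x y; move=> /eqP/commgP/(congr1 (fun A : SL2 R => sl2_val A 0 0)).
rewrite !sl2_valM xE yE !mulmx_mx2 !mxE /= => /eqP; rewrite -subr_eq0.
have -> : 3 * 1 + 1 * -1 - (1 * 3 + -1 * -1) = - 2 :> R[i] by ring.
by rewrite oppr_eq0 pnatr_eq0.
Qed.

End Unipotents.

(** Two unipotent matrices with a nontrivial double commutator are simultaneously
    conjugate to values of a homomorphism to SL_2. *)
Lemma surface_not_metabelian (R : realType) (G : groupType) :
  hyperbolic_surface_group R G ->
  exists x y z t : G, [~ [~ x, y], [~ z, t]]%g <> 1%g.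
Proof.
move=> sG; pose h b := if b then lower_unipotent R else upper_unipotent R.
have [phi phiM [k hk]] := surface_hom h sG.
have [[x px] [y py]] := (hk false, hk true).
exists x, y, x, (y^-1)%g => /(congr1 phi).
have phi1 : phi 1%g = 1%g by apply: (mulgI (phi 1%g)); rewrite -phiM !mulg1.
have phiV u : phi (u^-1)%g = ((phi u)^-1)%g.
  by apply: (mulgI (phi u)); rewrite -phiM !mulgV.
have phiR u v : phi [~ u, v]%g = [~ phi u, phi v]%g.
  by rewrite !commgEl !conjgE !phiM !phiV.
rewrite !phiR phiV phi1 px py -conjVg -!conjRg; apply: conj_neq1.
exact: unipotents_double_commutator.
Qed.

(** The numerical point is 4 ln 31 <= 10 ln 4, that is, 31 ^ 2 <= 4 ^ 5. *)
Lemma error_term_bound (R : realType) (D L M : R) : 0 <= D -> 6 * D < L -> 0 <= M ->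
  (M * L + 4 * ln 31) / (L - 4 * D) <=
  L / (L - 6 * D) * M + 2 * 5 * ln 4 / (L - 6 * D).
Proof.
move=> D0 DL M0; have d0 : 0 < L - 6 * D by lra.
have e31 : 4 * ln 31 <= 10 * ln 4 :> R.
  have h : ln (31 ^+ 2) <= ln (4 ^+ 5) :> R.
    by rewrite ler_ln ?posrE ?exprn_gt0 // -!natrX ler_nat.
  by move: h; rewrite !lnXn // -!(mulr_natl (ln _)); lra.
have l4 : 0 <= ln 4 :> R by rewrite ln_ge0 // ler1n.
have num0 : 0 <= M * L + 10 * ln 4.
  by rewrite addr_ge0 ?mulr_ge0 //; lra.
have -> : L / (L - 6 * D) * M + 2 * 5 * ln 4 / (L - 6 * D) =
    (M * L + 10 * ln 4) / (L - 6 * D).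
  by field; apply: lt0r_neq0.
apply: (@le_trans _ _ ((M * L + 10 * ln 4) / (L - 4 * D))).
  by rewrite ler_wpM2r ?invr_ge0 ?lerD2l //; lra.
rewrite ler_wpM2l // lef_pV2 ?posrE //; lra.
Qed.

Theorem corollary1p5 (R : realType) :
  exists2 K : R, 0 < K &
  forall (G : groupType) (rho rho_star : {multiplicative G -> PSL2 R}),
    hyperbolic_surface_group R G ->
    convex_cocompact rho -> convex_cocompact rho_star ->
  forall D L : R, 0 <= D ->
    cobounded_on rho (limit_hull rho) D -> 6 * D < L ->
  exists2 M : R,
    max_of [set len rho_star g / len rho g | g in
              [set g | 0 < len rho g <= L]] M &
    (Dil rho_star rho <=
       (L / (L - 6 * D) * M + 2 * K * ln 4 / (L - 6 * D))%:E)%E.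
Proof.
exists 5 => // G rho rho' sG [rho_inj rho_disc _] _ D L D0 cob DL.
have DL2 : 2 * D < L by lra.
have DL4 : 4 * D < L by lra.
have L0 : 0 <= L by lra.
have [phi phiM [g pg]] := surface_hom_to_Z sG.
have [x [y [z [t xyzt]]]] := surface_not_metabelian sG.
have tf := infinite_cyclic_torsion_free.
have gt : non_torsion g.
  move=> n n0 gn; apply: (tf (phi g) n n0 pg).
  have phi1 : phi 1%g = 1%g by apply: (mulgI (phi 1%g)); rewrite -phiM !mulg1.
  rewrite -phi1 -gn; elim: (n) => [|k IH]; first by rewrite !expg0 phi1.
  by rewrite !expgS phiM IH.
have [g0 g0l] := exists_loxodromic rho_inj rho_disc gt xyzt.
have [g1 g1l pg1] := exists_loxodromic_hom rho_inj phiM (fun z => tf z 2 isT) g0l pg.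
have [u0 u0L] := short_loxodromic rho_inj rho_disc D0 DL2 cob phiM tf g1l pg1.
have [A [hull _]] := loxodromic_axis g0l.
have [s hs] := finitely_many_short rho_inj rho_disc L D0 cob (hull 0).
pose ratio v := len rho' v / len rho v.
pose ratios := [seq ratio v | v <- s & 0 < len rho v <= L].
have in_ratios v : 0 < len rho v <= L -> ratio v \in ratios.
  move=> vL; have [w ws [h wE]] := hs v vL; apply/mapP; exists w.
    by rewrite mem_filter ws wE len_conj vL.
  by rewrite /ratio wE !len_conj.
have [M Ms hM] := seq_max (in_ratios u0 u0L).
have [v0 v0L ME] : exists2 v, 0 < len rho v <= L & M = ratio v.
  by have /mapP[v + ->] := Ms; rewrite mem_filter => /andP[vL _]; exists v.
have M0 : 0 <= M by rewrite ME divr_ge0 ?len_ge0.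
exists M.
  by split=> [|_ [v vL <-]]; [exists v0 | apply: hM; exact: in_ratios].
have short v : len rho v <= L -> len rho' v <= M * len rho v.
  move=> vL; have [vl|] := ltP 0 (len rho v).
    by rewrite -ler_pdivrMr //; apply: hM; apply: in_ratios; rewrite vl.
  move=> vl; have lv0 : len rho v = 0 by apply/le_anti; rewrite vl len_ge0.
  have [n n0 vn] := len0_torsion rho_inj rho_disc g0l cob lv0.
  by rewrite (len_torsion rho' n0 vn) lv0 mulr0.
apply: ge_ereal_sup => _ [v _ <-]; rewrite lee_fin.
apply: le_trans (error_term_bound D0 DL M0).
have [vl|vl] := ltP 0 (len rho v).
  by rewrite ler_pdivrMr // mulrC; exact: (length_comparison D0 cob DL4 M0 short vl).
(* Elements of length zero have ratio 0, the value of a division by 0. *)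
have -> : len rho v = 0 by apply/le_anti; rewrite vl len_ge0.
have ln31 : 0 <= ln 31 :> R by rewrite ln_ge0 // ler1n.
rewrite invr0 mulr0 divr_ge0 ?subr_ge0 ?(ltW DL4) //.
by rewrite addr_ge0 ?mulr_ge0.
Qed.
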